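(* Let $T>0$. Assume that $q\in L^\infty(0,1)$, $q\ge0$, $a\in L^\infty[0,T]$, $a(t)\ge a_0>0$ for all $t\in[0,T]$, and $u_0\in L^2(0,1)$. Consider the initial/boundary value problem $$\begin{cases} i\partial_t u(t,x)+a(t)\left(-\partial_x^2u(t,x)+q(x)u(t,x)\right)=0, & (t,x)\in[0,T]\times(0,1),\\ u(0,x)=u_0(x), & x\in(0,1),\\ u(t,0)=0=u(t,1), & t\in[0,T],\end{cases}\qquad( * )$$ and let a very weak solution of $( * )$ be given. Then for any families $(q_\varepsilon)$, $(a_\varepsilon)$, $(u_{0,\varepsilon})$ such that $$\|q-q_\varepsilon\|_{L^\infty(0,1)}\to0,\qquad \|a-a_\varepsilon\|_{L^\infty[0,T]}\to0,\qquad \|u_0-u_{0,\varepsilon}\|_{L^2(0,1)}\to0\qquad\text{as }\varepsilon\to0,$$ any representative $(u_\varepsilon)$ of the very weak solution converges, as $$\sup_{0\le t\le T}\|u(t,\cdot)-u_\varepsilon(t,\cdot)\|_{L^2}\to0\quad\text{for }\varepsilon\to0,$$ to the unique classical solution $u\in C([0,T];L^2(0,1))$ of $( * )$.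
   Context: Nets are indexed by $\varepsilon\in(0,1]$. Moderateness. A net $(u_\varepsilon(t,x))$ is uniformly $L^2$-moderate if there exist $N\in\mathbb{N}_0$, $C>0$ with $\|u_\varepsilon(t,\cdot)\|_{L^2}\le C\varepsilon^{-N}$ for all $t\in[0,T]$. A net $(u_{0,\varepsilon}(x))$ is $H^2$-moderate if there exist $N\in\mathbb{N}_0$, $C>0$ with $\|u_{0,\varepsilon}\|_{L^2}\le C\varepsilon^{-N}$ and $\|u_{0,\varepsilon}''\|_{L^2}\le C\varepsilon^{-N}$. Nets $(q_\varepsilon(x))$, respectively $(a_\varepsilon(t))$, are $L^\infty$-moderate if there exist $N\in\mathbb{N}_0$, $C>0$ with $\|q_\varepsilon\|_{L^\infty(0,1)}\le C\varepsilon^{-N}$, respectively $\|a_\varepsilon\|_{L^\infty[0,T]}\le C\varepsilon^{-N}$. Very weak solution. A net $(u_\varepsilon)_{\varepsilon>0}$ is a very weak solution of $( * )$ if there exist an $L^\infty$-moderate regularisation $q_\varepsilon$ of $q$, an $L^\infty$-moderate regularisation $a_\varepsilon$ of $a$, and an $H^2$-moderate regularisation $u_{0,\varepsilon}$ of $u_0$ such that, for every $\varepsilon$, $u_\varepsilon$ solves $$\begin{cases} i\partial_t u_\varepsilon+a_\varepsilon(t)\left(-\partial_x^2u_\varepsilon+q_\varepsilon(x)u_\varepsilon\right)=0, & (t,x)\in[0,T]\times(0,1),\\ u_\varepsilon(0,x)=u_{0,\varepsilon}(x), & x\in(0,1),\\ u_\varepsilon(t,0)=0=u_\varepsilon(t,1),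 & t\in[0,T],\end{cases}$$ and $(u_\varepsilon)$ and $(\partial_t u_\varepsilon)$ are uniformly $L^2$-moderate. In the present statement an $L^\infty$-regularisation $q_\varepsilon$ of $q$ (resp. $a_\varepsilon$ of $a$) means a net with $\|q_\varepsilon-q\|_{L^\infty}\to0$ (resp. $\|a_\varepsilon-a\|_{L^\infty[0,T]}\to0$) as $\varepsilon\to0$. A representative $(u_\varepsilon)$ of the very weak solution is a net as in this definition, corresponding to the given families $q_\varepsilon$, $a_\varepsilon$, $u_{0,\varepsilon}$. The classical solution is the unique solution $u\in C([0,T];L^2(0,1))$ of $( * )$, which is understood via the operator $\mathcal{L}=-\frac{d^2}{dx^2}+q$ on $(0,1)$ with Dirichlet boundary conditions $y(0)=y(1)=0$ (the equation $i\partial_tu+a(t)\mathcal{L}u=0$ being understood, for almost every $t$, in the dual of $\bigcap_{m\ge1}\mathrm{Dom}(\mathcal{L}^m)$). *)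

(* Defs.v *)
From HB Require Import structures.
From mathcomp Require Import all_boot all_order all_algebra.
From mathcomp Require Import all_classical all_reals all_analysis.
From mathcomp Require Import complex.

Set Implicit Arguments.
Unset Strict Implicit.
Unset Printing Implicit Defensive.

Import Order.TTheory GRing.Theory Num.Theory.
Import numFieldNormedType.Exports.

Local Open Scope classical_set_scope.
Local Open Scope ring_scope.
Local Open Scope complex_scope.

Section Defs.
Context {R : realType}.
Local Notation mu := (@lebesgue_measure R).

(* Elements of L^p and L^oo are represented by Borel measurable functions; they
   are only ever compared almost everywhere on the relevant interval, and their
   values outside of it are irrelevant. *)

Definition Lpnorm (p : \bar R) (D : set R) (f : R -> R) : \bar R :=
  'N[mu]_p[(EFin \o f) \_ D]%E.

Definition Linfty (D : set R) (f : R -> R) : Prop :=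
  measurable_fun D f /\ (Lpnorm +oo D f < +oo)%E.

Definition L2norm (f : R -> R[i]) : \bar R :=
  Lpnorm 2%:E `]0, 1[ (fun x => Normc.normc (f x)).

Definition L2 (f : R -> R[i]) : Prop :=
  [/\ measurable_fun (`]0, 1[ : set R) (fun x => complex.Re (f x)),
      measurable_fun (`]0, 1[ : set R) (fun x => complex.Im (f x)) &
      (L2norm f < +oo)%E].

Definition ae_eq01 (f g : R -> R[i]) : Prop :=
  {ae mu, forall x, x \in `]0, 1[ -> f x = g x}.

Definition cintegrable (D : set R) (f : R -> R[i]) : Prop :=
  mu.-integrable D (fun x => (complex.Re (f x))%:E) /\
  mu.-integrable D (fun x => (complex.Im (f x))%:E).

Definition cintegral (D : set R) (f : R -> R[i]) : R[i] :=
  (\int[mu]_(x in D) complex.Re (f x)) +i*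
  (\int[mu]_(x in D) complex.Im (f x)).

(* F is absolutely continuous on [a, b], with derivative g almost everywhere. *)
Definition is_primitive (a b : R) (F g : R -> R[i]) : Prop :=
  cintegrable `[a, b] g /\
  forall x, x \in `[a, b] -> F x = F a + cintegral `[a, x] g.

Definition continuous_L2 (T : R) (u : R -> R -> R[i]) : Prop :=
  (forall t, t \in `[0, T] -> L2 (u t)) /\
  forall t, t \in `[0, T] ->
    L2norm (u s \- u t) @[s --> within `[0, T] (nbhs t)] --> 0%E.

(* y is a C^1 representative of f on [0, 1], whose second derivative, in the
   sense of Sobolev, is g; in particular f is in H^2(0, 1). *)
Definition H2_representative (f y g : R -> R[i]) : Prop :=
  [/\ L2 f, L2 g, ae_eq01 f y &
      exists y', is_primitive 0 1 y y' /\ is_primitive 0 1 y' g].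

Definition has_deriv2 (f g : R -> R[i]) : Prop :=
  exists y, H2_representative f y g.

(* The graph of L = - d^2/dx^2 + q with Dirichlet boundary conditions: f is in
   Dom L = {f in H^2(0, 1) | f(0) = f(1) = 0}, and g = L f. *)
Definition SL_graph (q : R -> R) (f g : R -> R[i]) : Prop :=
  L2 g /\
  exists y f'', [/\ H2_representative f y f'', y 0 = 0, y 1 = 0 &
    ae_eq01 g (fun x => - f'' x + (q x)%:C * f x)].

Fixpoint SL_dom (q : R -> R) (m : nat) (f : R -> R[i]) : Prop :=
  if m is m'.+1 then exists g, SL_graph q f g /\ SL_dom q m' g else L2 f.

Definition SL_test (q : R -> R) (f : R -> R[i]) : Prop :=
  forall m : nat, SL_dom q m f.

(* The embedding of L^2(0, 1) into the dual of SL_test q is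
   f |-> (phi |-> pairing f phi). *)
Definition pairing (f phi : R -> R[i]) : R[i] :=
  cintegral `]0, 1[ (fun x => f x * phi x).

(* U = du/dt on [0, T], with values in the dual of SL_test q: every function
   t |-> <u(t), phi> is absolutely continuous with derivative <U(t), phi>. The
   mere existence of a derivative for almost every t would not determine u
   (Cantor's function). *)
Definition time_derivative (T : R) (q : R -> R) (u : R -> R -> R[i])
    (U : R -> (R -> R[i]) -> R[i]) : Prop :=
  forall phi, SL_test q phi ->
    is_primitive 0 T (fun t => pairing (u t) phi) (fun t => U t phi).

(* i du/dt + a L u = 0 and u(0) = u0, with u in C([0, T]; L^2). The equation
   holds for almost every t in the dual of SL_test q, where
   <L u(t), phi> = <u(t), L phi>; it forces U t to be linear and continuous for
   almost every t. The boundary conditions are those in the domain of L. *)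
Definition solution (T : R) (q a : R -> R) (u0 : R -> R[i])
    (u : R -> R -> R[i]) : Prop :=
  [/\ continuous_L2 T u, ae_eq01 (u 0) u0 &
      exists U, time_derivative T q u U /\
        {ae mu, forall t, t \in `[0, T] ->
          forall phi Lphi, SL_test q phi -> SL_graph q phi Lphi ->
            'i%C * U t phi + (a t)%:C * pairing (u t) Lphi = 0}].

Definition moderate (norm : R -> \bar R) : Prop :=
  exists (N : nat) (C : R), 0 < C /\
    forall e, e \in `]0, 1] -> (norm e <= (C * e ^- N)%:E)%E.

Definition Linfty_moderate (D : set R) (f : R -> R -> R) : Prop :=
  (forall e, e \in `]0, 1] -> Linfty D (f e)) /\
  moderate (fun e => Lpnorm +oo D (f e)).

Definition H2_moderate (f : R -> R -> R[i]) : Prop :=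
  exists f'' : R -> R -> R[i],
    [/\ forall e, e \in `]0, 1] -> has_deriv2 (f e) (f'' e),
        moderate (fun e => L2norm (f e)) &
        moderate (fun e => L2norm (f'' e))].

Definition uniformly_L2_moderate (T : R) (u : R -> R -> R -> R[i]) : Prop :=
  (forall e t, e \in `]0, 1] -> t \in `[0, T] -> L2 (u e t)) /\
  exists (N : nat) (C : R), 0 < C /\
    forall e t, e \in `]0, 1] -> t \in `[0, T] ->
      (L2norm (u e t) <= (C * e ^- N)%:E)%E.

(* The net (u e), e in ]0, 1], is a very weak solution corresponding to the
   families qe, ae and u0e. That these regularise q, a and u0 is a separate
   assumption. *)
Definition very_weak_solution (T : R) (qe ae : R -> R -> R)
    (u0e : R -> R -> R[i]) (u : R -> R -> R -> R[i]) : Prop :=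
  [/\ [/\ Linfty_moderate `]0, 1[ qe, Linfty_moderate `[0, T] ae &
          H2_moderate u0e],
      forall e, e \in `]0, 1] -> solution T (qe e) (ae e) (u0e e) (u e),
      uniformly_L2_moderate T u &
      exists dtu : R -> R -> R -> R[i],
        (forall e, e \in `]0, 1] ->
          time_derivative T (qe e) (u e) (fun t => pairing (dtu e t))) /\
        uniformly_L2_moderate T dtu].

End Defs.

(* Main.v *)
Require Import Defs.
From HB Require Import structures.
From mathcomp Require Import all_boot all_order all_algebra.
From mathcomp Require Import all_classical all_reals all_analysis.
From mathcomp Require Import complex measurable_realfun ess_sup_inf ring lra.

Set Implicit Arguments.
Unset Strict Implicit.
Unset Printing Implicit Defensive.

Import Order.TTheory GRing.Theory Num.Theory.
Import numFieldNormedType.Exports.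

Local Open Scope classical_set_scope.
Local Open Scope ring_scope.

(** Let L_q be the operator - y'' + q y with Dirichlet conditions and K_q its
inverse, a bounded injective self-adjoint operator of L^2(0, 1). Applying K_q
turns i u' + a L_q u = 0 into

  K_q (u t - u s) = int_s^t i a u,

where nothing unbounded is left ([integral_evolution]). This equation carries
the whole proof; no eigenfunctions are used.

The inverse. The unknown is h = y' rather than y. Every y in the form domain is
T h, where T h is the primitive of h minus its mean and so vanishes at 0 and 1,
and y = T h solves L_q y = f when <h, k> + <q T h, T k> = <f, T k> for all k
([form_inverse]). Since |T h| <= |h|, this form is coercive for q >= - 1/2,
which leaves room for regularisations that are only close to a nonnegative q.

Test functions. A Mittag-Leffler argument makes the intersection of the ranges
of the powers of K_q dense ([mittag_leffler]). Hence the equation in the dual of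
the test functions and the integrated equation are equivalent
([solution_integral_evolution], [integral_evolution_solution]).

Regularity. For a fixed parameter the time derivative of a very weak solution is
bounded in L^2, so u is Lipschitz in time. As K_q u' = i a u with a bounded
below, |<u, psi>| <= C |K_q psi|, and a Riesz argument gives u = K_q g with g
bounded: u takes its values in the domain of L_q ([weak_domain]). Measuring time
by the clock A t = int_0^t a then gives a solution U of i U' + L_q U = 0 with
U (A t) = u t ([smooth_of_weak]).

Comparison. For two such solutions U1 and U2, with potentials q1 and q2,

  d/dt |U1 - U2|^2 = 2 <i (q1 - q2) U2, U1 - U2>

because i L_q is skew. The bound that follows ([comparison_le]) depends only on
the norms of U1 and U2 and on |q1 - q2|, not on the Lipschitz constants, which
may blow up along the net. With q1 = q2 it says that |U| does not increase and
that |U t - U s| <= |U (t - s) - U 0|. The latter turns the modulus of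
continuity at 0 of a single member of the net into one for all later members,
which absorbs the differences between their clocks. So the net is uniformly
Cauchy ([net_cauchy]).

The limit. The integrated equation passes to uniform limits
([integral_evolution_limit]), so the limit of the net is a solution. Solutions
are unique because |K_q v|^2 is constant along the difference v of two of them
([weak_unique]).

Derivatives of real functions of time are avoided throughout: an increment bound
with a quadratic error, f t - f s <= c (t - s) + C (t - s)^2, gives
f t - f s <= c (t - s) after subdivision ([partition_le]). *)

(** * Semi-inner product spaces *)

(** Functions equal almost everywhere are not identified, so the form may have
null vectors, and equality of vectors is expressed by [nrm b (x - y) = 0]. *)
Record semi_ip (R : realType) (V : lmodType R) := SemiIp {
  ip :> V -> V -> R;
  ipC : forall x y, ip x y = ip y x;
  ipPl : forall a x y z, ip (a *: x + y) z = a * ip x z + ip y z;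
  ip_ge0 : forall x, 0 <= ip x x }.

Section SemiInner.
Context {R : realType} {V : lmodType R} (b : semi_ip V).
Implicit Types x y z : V.

Definition nrm x := Num.sqrt (b x x).

Lemma ip0l x : b 0 x = 0.
Proof. by have := ipPl b (-1) 0 0 x; rewrite scaler0 addr0 => h; lra. Qed.
Lemma ip0r x : b x 0 = 0. Proof. by rewrite ipC ip0l. Qed.
Lemma ipDl x y z : b (x + y) z = b x z + b y z.
Proof. by have := ipPl b 1 x y z; rewrite scale1r mul1r. Qed.
Lemma ipZl a x z : b (a *: x) z = a * b x z.
Proof. by have := ipPl b a x 0 z; rewrite addr0 ip0l addr0. Qed.
Lemma ipNl x z : b (- x) z = - b x z.
Proof. by rewrite -scaleN1r ipZl mulN1r. Qed.
Lemma ipBl x y z : b (x - y) z = b x z - b y z.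
Proof. by rewrite ipDl ipNl. Qed.
Lemma ipDr x y z : b z (x + y) = b z x + b z y.
Proof. by rewrite ipC ipDl ![b _ z]ipC. Qed.
Lemma ipZr a x z : b z (a *: x) = a * b z x.
Proof. by rewrite ipC ipZl ![b _ z]ipC. Qed.
Lemma ipNr x z : b z (- x) = - b z x.
Proof. by rewrite ipC ipNl ![b _ z]ipC. Qed.
Lemma ipBr x y z : b z (x - y) = b z x - b z y.
Proof. by rewrite ipDr ipNr. Qed.
Definition ipE := (ipDl, ipDr, ipBl, ipBr, ipZl, ipZr, ipNl, ipNr, ip0l, ip0r).

Lemma nrm_ge0 x : 0 <= nrm x. Proof. exact: sqrtr_ge0. Qed.
Lemma sqr_nrm x : nrm x ^+ 2 = b x x. Proof. by rewrite sqr_sqrtr // ip_ge0. Qed.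

Lemma cauchy_schwarz x y : `|b x y| <= nrm x * nrm y.
Proof.
rewrite -(@ler_pXn2r _ 2) ?nnegrE ?mulr_ge0 ?nrm_ge0 //.
rewrite exprMn !sqr_nrm real_normK ?num_real //.
have h t : 0 <= b x x - 2 * t * b x y + t ^+ 2 * b y y.
  have := ip_ge0 b (x - t *: y); rewrite !ipE (ipC b y x) => h; nra.
have [y0|y0] := eqVneq (b y y) 0.
  have [->|xy0] := eqVneq (b x y) 0; first by rewrite y0 mulr0 expr0n.
  have := h ((b x x + 1) / (2 * b x y)); rewrite y0.
  rewrite (_ : 2 * _ * _ = b x x + 1); first by move=> ?; lra.
  by field.
have yp : 0 < b y y by rewrite lt_neqAle eq_sym y0 ip_ge0.
have := h (b x y / b y y).
rewrite (_ : _ + _ = (b x x * b y y - b x y ^+ 2) / b y y); last by field.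
by rewrite pmulr_lge0 ?invr_gt0 // subr_ge0.
Qed.

Lemma ip_le_nrm x y : b x y <= nrm x * nrm y.
Proof. exact: le_trans (ler_norm _) (cauchy_schwarz _ _). Qed.

Lemma nrmD x y : nrm (x + y) <= nrm x + nrm y.
Proof.
rewrite -(@ler_pXn2r _ 2) ?nnegrE ?addr_ge0 ?nrm_ge0 //.
rewrite sqrrD !sqr_nrm !ipE (ipC b y x).
by have := ip_le_nrm x y; rewrite -mulr_natr => ?; lra.
Qed.

Lemma nrmN x : nrm (- x) = nrm x. Proof. by rewrite /nrm !ipE opprK. Qed.
Lemma nrm0 : nrm 0 = 0. Proof. by rewrite /nrm ip0l sqrtr0. Qed.
Lemma nrmBC x y : nrm (x - y) = nrm (y - x). Proof. by rewrite -nrmN opprB. Qed.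
Lemma nrmZ a x : nrm (a *: x) = `|a| * nrm x.
Proof. by rewrite /nrm !ipE mulrA -expr2 sqrtrM ?sqr_ge0 // sqrtr_sqr. Qed.
Lemma nrmB x y : nrm (x - y) <= nrm x + nrm y.
Proof. by rewrite (le_trans (nrmD _ _)) // nrmN. Qed.
Lemma nrm_triangle z x y : nrm (x - y) <= nrm (x - z) + nrm (z - y).
Proof. by rewrite (le_trans _ (nrmD _ _)) // addrA subrK. Qed.
Lemma nrm_le_add x y : nrm x <= nrm y + nrm (x - y).
Proof. by rewrite (le_trans _ (nrmD _ _)) // addrC subrK. Qed.

Lemma nrm_le c x : 0 <= c -> b x x <= c ^+ 2 -> nrm x <= c.
Proof. by move=> c0 h; rewrite -(@ler_pXn2r _ 2) ?nnegrE ?nrm_ge0 // sqr_nrm. Qed.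

Lemma nrm_dual_le c x : 0 <= c -> (forall y, b x y <= c * nrm y) -> nrm x <= c.
Proof.
move=> c0 /(_ x); rewrite -sqr_nrm expr2 => h.
have [->//|n0] := eqVneq (nrm x) 0.
by rewrite -(@ler_pM2r _ (nrm x)) // lt_neqAle eq_sym n0 nrm_ge0.
Qed.

Lemma nrm0_ipl x y : nrm x = 0 -> b x y = 0.
Proof. by move=> x0; have := cauchy_schwarz x y; rewrite x0 mul0r normr_le0 => /eqP. Qed.

Lemma nrm0_ipB x y z : nrm (x - y) = 0 -> b x z = b y z.
Proof. by move=> /(nrm0_ipl z)/eqP; rewrite ipBl subr_eq0 => /eqP. Qed.

Lemma nrm0_eq x y : nrm (x - y) = 0 -> nrm x = nrm y.
Proof.
move=> e; rewrite /nrm; congr Num.sqrt.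
by rewrite (nrm0_ipB x e) ipC (nrm0_ipB y e).
Qed.

Lemma ip0_nrm0 x : (forall y, b x y = 0) -> nrm x = 0.
Proof. by move=> h; rewrite /nrm h sqrtr0. Qed.

Lemma null_trans y x z : nrm (x - y) = 0 -> nrm (y - z) = 0 -> nrm (x - z) = 0.
Proof.
move=> h1 h2; apply/eqP; rewrite eq_le nrm_ge0 andbT.
by have := nrm_triangle y x z; rewrite h1 h2 addr0.
Qed.

Definition cvg_nrm (x : nat -> V) (l : V) :=
  forall e, 0 < e -> exists N, forall n, (N <= n)%N -> nrm (x n - l) <= e.

Definition cauchy_nrm (x : nat -> V) :=
  forall e, 0 < e -> exists N, forall m n, (N <= m)%N -> (N <= n)%N ->
    nrm (x m - x n) <= e.

Definition complete_nrm := forall x : nat -> V, cauchy_nrm x -> exists l, cvg_nrm x l.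

Lemma le_eps (x y : R) : (forall e, 0 < e -> x <= y + e) -> x <= y.
Proof. by move=> h; apply/ler_addgt0Pr => e e0; apply: h. Qed.

(** Identifies the inner products of a limit from those of the sequence, by
Cauchy-Schwarz. *)
Lemma cvg_nrm_ip (x : nat -> V) l y c : cvg_nrm x l ->
  (forall e, 0 < e -> exists N, forall n, (N <= n)%N -> `|b (x n) y - c| <= e) ->
  b l y = c.
Proof.
move=> xl xc; apply/eqP; rewrite -subr_eq0 -normr_le0; apply: le_eps => e e0.
have y0 := nrm_ge0 y.
have e1 : 0 < e / (2 * (nrm y + 1)) by rewrite divr_gt0 // mulr_gt0 // ltr_wpDl.
have [N hN] := xl _ e1; have [M hM] := xc _ (divr_gt0 e0 (ltr0Sn R 1)).
have := hN _ (leq_maxl N M); have := hM _ (leq_maxr N M).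
set n := maxn N M => h2 h1.
have h3 : `|b l y - b (x n) y| <= e / 2.
  rewrite distrC -ipBl (le_trans (cauchy_schwarz _ _)) //.
  apply: (@le_trans _ _ (e / (2 * (nrm y + 1)) * nrm y)); first by rewrite ler_wpM2r.
  rewrite mulrAC ler_pdivrMr; first by lra.
  by rewrite mulr_gt0 // ltr_wpDl.
rewrite add0r; apply: (le_trans (ler_distD (b (x n) y) _ _)); lra.
Qed.

End SemiInner.

(** * Riesz representation on an incomplete subspace *)

Lemma inv_succ_le {R : realType} (e : R) : 0 < e ->
  exists N, forall n, (N <= n)%N -> n.+1%:R^-1 <= e.
Proof.
move=> e0; have ei : 0 < e^-1 by rewrite invr_gt0.
have := archi_boundP (ltW ei); set N := Num.bound _ => hN; exists N => n Nn.
rewrite -[e]invrK lef_pV2 ?posrE ?invr_gt0 //; apply: (le_trans (ltW hN)).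
by rewrite ler_nat (leq_trans Nn).
Qed.

Section Riesz.
Context {R : realType} {V H : lmodType R} (b : semi_ip H).

(** Riesz representation on the image of a map [F] that is linear only up to null
vectors. The vector [h] lies in the closure of the image and is found by
minimising [b (F x) (F x) - 2 * l x]; a minimising sequence is Cauchy by the
parallelogram identity. With [F] the identity this is the usual theorem; with
[F] an operator it describes the closure and the dual of its range. *)
Lemma riesz_closure (F : V -> H) (l : V -> R) (C : R) :
  complete_nrm b ->
  (forall a x y z, b (F (a *: x + y)) z = a * b (F x) z + b (F y) z) ->
  (forall a x y, l (a *: x + y) = a * l x + l y) ->
  0 <= C -> (forall x, l x <= C * nrm b (F x)) ->
  exists h, [/\ forall y, b h (F y) = l y, nrm b h <= C &
    forall e, 0 < e -> exists x, nrm b (F x - h) <= e].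
Proof.
move=> cb Flin llin C0 lC.
have F0 z : b (F 0) z = 0.
  by have := Flin (-1) 0 0 z; rewrite scaler0 addr0 => h; lra.
have FZ a x z : b (F (a *: x)) z = a * b (F x) z.
  by have := Flin a x 0 z; rewrite addr0 F0 addr0.
have FP a x y z : b z (F (a *: x + y)) = a * b z (F x) + b z (F y).
  by rewrite ipC Flin !(ipC _ z).
have FZr a x z : b z (F (a *: x)) = a * b z (F x) by rewrite ipC FZ (ipC _ z).
have l0 : l 0 = 0 by have := llin (-1) 0 0; rewrite scaler0 addr0 => h; lra.
have lZ a x : l (a *: x) = a * l x by have := llin a x 0; rewrite addr0 l0 addr0.
pose J x := b (F x) (F x) - 2 * l x.
have Jge x : - C ^+ 2 <= J x.
  rewrite /J -sqr_nrm; have := lC x; move: (nrm _ _) (l x) => n k.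
  have := sqr_ge0 (n - C); nra.
have infJ : has_inf [set J x | x in setT].
  split; first by exists (J 0); exists 0.
  by exists (- C ^+ 2) => _ [x _ <-].
pose m := inf [set J x | x in setT].
have mJ x : m <= J x by apply: ge_inf; [exact: infJ.2|by exists x].
have /choice[x hx] n : exists x, J x < m + n.+1%:R^-1.
  have [] := @inf_adherent _ _ n.+1%:R^-1 _ infJ; first by rewrite invr_gt0.
  by move=> _ [x _ <-] h; exists x.
clearbody m.
(* parallelogram identity: the midpoint cannot do better than the infimum *)
have hd i j : b (F (x i) - F (x j)) (F (x i) - F (x j)) <=
    2 * (i.+1%:R^-1 + j.+1%:R^-1).
  have := mJ (2^-1 *: (x i) + 2^-1 *: (x j)).
  rewrite /J !(Flin, FP, FZ, FZr, llin, lZ) !ipE (ipC _ (F (x j)) (F (x i))).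
  have := hx i; have := hx j; rewrite /J.
  by move: (i.+1%:R^-1) (j.+1%:R^-1) => di dj *; lra.
(* first variation in the direction y, with the nearly optimal step
   - d / (|F y|^2 + 1); the 1 covers the case F y = 0 *)
have hl y : exists B, 0 < B /\ forall n, (b (F (x n)) (F y) - l y) ^+ 2 <= B * n.+1%:R^-1.
  exists (b (F y) (F y) + 1); split => [|n]; first by rewrite ltr_wpDl // ip_ge0.
  set d := _ - l y; have be0 := ip_ge0 b (F y); set be := b (F y) (F y) in be0 *.
  have := mJ ((- d / (be + 1)) *: y + x n); have := hx n.
  rewrite /J !(Flin, FP, llin) (ipC _ (F y) (F (x n))) -/be.
  set t := - d / (be + 1) => h1 h2.
  have h : - n.+1%:R^-1 <= 2 * t * d + t ^+ 2 * be by rewrite /d; move: (n.+1%:R^-1) h1 h2 => dn *; lra.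
  have be1 : 0 < be + 1 by rewrite ltr_wpDl.
  have e1 : 2 * t * d + t ^+ 2 * be = - (d ^+ 2 / (be + 1)) - d ^+ 2 / (be + 1) ^+ 2.
    by rewrite /t; field; rewrite gt_eqF.
  have : d ^+ 2 / (be + 1) <= n.+1%:R^-1.
    have : 0 <= d ^+ 2 / (be + 1) ^+ 2 by rewrite divr_ge0 // ?sqr_ge0 // exprn_ge0 // ltW.
    by rewrite -subr_ge0 -(subr_ge0 _ n.+1%:R^-1); move: h; rewrite e1; move: (n.+1%:R^-1) (d ^+ 2 / (be + 1)) (d ^+ 2 / (be + 1) ^+ 2) => *; lra.
  by rewrite ler_pdivrMr // mulrC.
have [h hh] : exists h, cvg_nrm b (fun n => F (x n)) h.
  apply: cb => e e0; have e2 : 0 < e ^+ 2 / 4 by rewrite divr_gt0 // exprn_gt0.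
  have [N hN] := inv_succ_le e2; exists N => i j Ni Nj.
  apply: nrm_le; first exact: ltW.
  have := hd i j; have := hN _ Ni; have := hN _ Nj.
  by move: (i.+1%:R^-1) (j.+1%:R^-1) (e ^+ 2) => *; lra.
have hF y : b h (F y) = l y.
  apply: (cvg_nrm_ip hh) => e e0; have [B [B0 hB]] := hl y.
  have [N hN] := inv_succ_le (divr_gt0 (exprn_gt0 2 e0) B0).
  exists N => n Nn; rewrite -(@ler_pXn2r _ 2) ?nnegrE ?(ltW e0) //.
  rewrite real_normK ?num_real //; apply: (le_trans (hB n)).
  by rewrite mulrC -ler_pdivlMr //; exact: hN.
exists h; split => // [|e e0]; last first.
  by have [N hN] := hh _ e0; exists (x N); apply: hN.
have [->//|n0] := eqVneq (nrm b h) 0.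
have np : 0 < nrm b h by rewrite lt_neqAle eq_sym n0 nrm_ge0.
apply: le_eps => e e0; rewrite -(@ler_pM2r _ (nrm b h)) // -expr2 sqr_nrm.
have [N hN] := hh (e * nrm b h / (nrm b h + C)) (ltac:(by rewrite divr_gt0 ?mulr_gt0 // ltr_wpDr)).
have := hN _ (leqnn N); set g := F (x N) => hg.
rewrite (_ : b h h = b h (h - g) + b h g); last by rewrite -ipDr subrK.
rewrite hF; have := lC (x N); have := nrm_le_add b g h; have := ip_le_nrm b h (h - g).
rewrite (nrmBC _ h g) -/g => h1 h2 h3.
have h4 : C * nrm b g <= C * (nrm b h + nrm b (g - h)) by rewrite ler_wpM2l.
have h5 : (nrm b h + C) * nrm b (g - h) <= e * nrm b h.
  by rewrite mulrC -ler_pdivlMr // ltr_wpDr.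
by lra.
Qed.
End Riesz.

(** * Bounded inverses of self-adjoint operators *)

Lemma half_pow_le {R : realType} (e : R) : 0 < e ->
  exists N, forall n, (N <= n)%N -> 2^-1 ^+ n <= e.
Proof.
move=> /inv_succ_le[N hN]; exists N => n /hN; apply: le_trans.
by rewrite exprVn lef_pV2 ?posrE ?exprn_gt0 // -natrX ler_nat ltn_expl.
Qed.

(** Replaces the mean value inequality: cutting [s, t] into n pieces divides the
total quadratic error by n. *)
Lemma partition_le {R : realType} (f : R -> R) (S c C : R) :
  (forall s t, 0 <= s -> s <= t -> t <= S ->
    f t - f s <= c * (t - s) + C * (t - s) ^+ 2) ->
  forall s t, 0 <= s -> s <= t -> t <= S -> f t - f s <= c * (t - s).
Proof.
move=> h s t s0 st tS.
have hn n : f t - f s <= c * (t - s) + C * (t - s) ^+ 2 * n.+1%:R^-1.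
  pose d := (t - s) / n.+1%:R.
  have d0 : 0 <= d by rewrite divr_ge0 // subr_ge0.
  have dn : d * n.+1%:R = t - s by rewrite /d divfK // pnatr_eq0.
  have hk k : (k <= n.+1)%N -> f (s + d * k%:R) - f s <= (c * d + C * d ^+ 2) * k%:R.
    elim: k => [_|k ih kn]; first by rewrite !mulr0 addr0 subrr.
    have := ih (ltnW kn); have := h (s + d * k%:R) (s + d * k.+1%:R).
    have -> : s + d * k.+1%:R - (s + d * k%:R) = d by rewrite -(natr1 k); ring.
    have k0 : 0 <= s + d * k%:R by rewrite addr_ge0 // mulr_ge0.
    have k1 : s + d * k%:R <= s + d * k.+1%:R by rewrite lerD2l ler_wpM2l // ler_nat.
    have k2 : s + d * k.+1%:R <= S.
      apply: le_trans tS; rewrite -lerBrDl -dn ler_wpM2l // ler_nat //.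
    move=> /(_ k0 k1 k2); rewrite -(natr1 k).
    by move=> *; lra.
  have := hk _ (leqnn _); rewrite dn (addrC s) subrK => /le_trans; apply.
  have -> : (c * d + C * d ^+ 2) * n.+1%:R = c * (d * n.+1%:R) + C * d * (d * n.+1%:R) by ring.
  have -> : C * (t - s) ^+ 2 * n.+1%:R^-1 = C * ((t - s) * n.+1%:R^-1) * (t - s) by ring.
  by rewrite dn.
apply: le_eps => e e0; have C0 : 0 < `|C * (t - s) ^+ 2| + 1 by rewrite ltr_wpDl.
have [N /(_ N (leqnn N)) hN] := inv_succ_le (divr_gt0 e0 C0).
apply: (le_trans (hn N)); rewrite lerD2l.
apply: (@le_trans _ _ ((`|C * (t - s) ^+ 2| + 1) * N.+1%:R^-1)).
  by rewrite ler_wpM2r ?invr_ge0 // (le_trans (ler_norm _)) // lerDl.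
by rewrite mulrC -ler_pdivlMr.
Qed.

Section Operator.
Context {R : realType} {V : lmodType R} (b : semi_ip V) (K : V -> V).

(** The properties of the inverse of a self-adjoint operator that the evolution
equation needs. Linearity up to null vectors follows from symmetry. The bound
[1 <= C] makes the powers of [C] nondecreasing. *)
Record inverse_op (C : R) : Prop := InverseOp {
  op_sym : forall x y, b (K x) y = b x (K y);
  op_bound_ge1 : 1 <= C;
  op_bound : forall x, nrm b (K x) <= C * nrm b x;
  op_inj : forall x, nrm b (K x) = 0 -> nrm b x = 0 }.

Variable C : R.
Hypotheses (cb : complete_nrm b) (Kop : inverse_op C).

Lemma op_lin a x y z : b (K (a *: x + y)) z = a * b (K x) z + b (K y) z.
Proof. by rewrite !(op_sym Kop) ipPl. Qed.

Lemma op_null x y : nrm b (x - y) = 0 -> nrm b (K x - K y) = 0.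
Proof.
move=> h; apply: (ip0_nrm0 (b := b)) => z.
by rewrite ipBl !(op_sym Kop) -ipBl (nrm0_ipl _ h).
Qed.

Lemma op_opB x y z : b (K (x - y)) z = b (K x - K y) z.
Proof. by rewrite ipBl !(op_sym Kop) ipBl. Qed.

Lemma op_nrmB x y : nrm b (K (x - y)) = nrm b (K x - K y).
Proof. by apply: nrm0_eq; apply: ip0_nrm0 => z; rewrite ipBl op_opB subrr. Qed.

(** A symmetric operator without kernel has dense range: a vector orthogonal to
the range is in the kernel. *)
Lemma op_dense f e : 0 < e -> exists g, nrm b (K g - f) <= e.
Proof.
have C0 : 0 <= C by have := op_bound_ge1 Kop; lra.
have [|||h [hf _ hcl]] := riesz_closure (F := K) (l := fun y => b f (K y))
    (C := nrm b f) cb op_lin.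
- by move=> a x y; rewrite ipC op_lin !(ipC _ f).
- exact: nrm_ge0.
- by move=> x; apply: ip_le_nrm.
move=> e0; have [x hx] := hcl _ e0; exists x; apply: le_trans hx.
have fh : nrm b (h - f) = 0.
  apply: (op_inj Kop); apply: (ip0_nrm0 (b := b)) => y.
  by rewrite (op_sym Kop) ipBl hf subrr.
by have := nrm_triangle b h (K x) f; rewrite fh addr0.
Qed.

Lemma iter_op_nrmB n x y :
  nrm b (iter n K x - iter n K y) <= C ^+ n * nrm b (x - y).
Proof.
have C0 : 0 <= C by have := op_bound_ge1 Kop; lra.
elim: n => [|n ih]; first by rewrite expr0 mul1r.
rewrite /= -op_nrmB (le_trans (op_bound Kop _)) // exprS -mulrA.
exact: ler_wpM2l.
Qed.

(** The chains [g 0 = K (g 1)], [g 1 = K (g 2)], and so on, have a dense set of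
starting points. An approximate chain [F] is chosen with errors so small that
they stay summable after the iterates of [K] are applied; the exact chain is
[g m], the limit of [iter n K (F (m + n))]. *)
Lemma mittag_leffler f e : 0 < e ->
  exists g : nat -> V, nrm b (g 0%N - f) <= e /\
    forall m, nrm b (K (g m.+1) - g m) = 0.
Proof.
move=> e0; have C1 := op_bound_ge1 Kop.
have C0 : 0 < C by lra.
pose ee n := e / (2 * C) ^+ n / 2.
have ee0 n : 0 < ee n by rewrite divr_gt0 // divr_gt0 // exprn_gt0 // mulr_gt0.
have /choice[step hstep] : forall p : nat * V, exists y, nrm b (K y - p.2) <= ee p.1.
  by move=> p; apply: op_dense.
pose F := fix F n := if n is n'.+1 then step (n', F n') else f.
have hF n : nrm b (K (F n.+1) - F n) <= ee n by apply: (hstep (n, F n)).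
pose s m n := iter n K (F (m + n)%N).
have hs m n : nrm b (s m n.+1 - s m n) <= e * (2^-1 ^+ n - 2^-1 ^+ n.+1).
  rewrite /s iterSr; apply: (le_trans (iter_op_nrmB _ _ _)).
  have h1 : nrm b (K (F (m + n.+1)%N) - F (m + n)%N) <= ee n.
    rewrite addnS (le_trans (hF _)) // /ee ler_wpM2r // ler_wpM2l ?(ltW e0) //.
    have C2 : 1 <= 2 * C by lra.
    rewrite lef_pV2 ?posrE ?exprn_gt0 ?mulr_gt0 //.
    by rewrite ler_weXn2l // leq_addl.
  apply: (le_trans (ler_wpM2l (exprn_ge0 n (ltW C0)) h1)).
  rewrite /ee exprMn le_eqVlt; apply/orP; left; apply/eqP.
  rewrite exprS exprVn; field.
  by rewrite !expf_neq0 ?gt_eqF.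
have hs2 m n k : nrm b (s m (n + k)%N - s m n) <= e * (2^-1 ^+ n - 2^-1 ^+ (n + k)).
  elim: k => [|k ih]; first by rewrite addn0 !subrr nrm0 mulr0.
  rewrite addnS; apply: (le_trans (nrm_triangle b (s m (n + k)%N) _ _)).
  by have := hs m (n + k)%N => *; lra.
have hs3 m n k : (n <= k)%N -> nrm b (s m k - s m n) <= e * 2^-1 ^+ n.
  move=> nk; have := hs2 m n (k - n)%N; rewrite subnKC // => /le_trans; apply.
  by rewrite ler_wpM2l ?(ltW e0) // lerBlDr lerDl exprn_ge0.
have sc m : exists g, cvg_nrm b (s m) g.
  apply: cb => d d0; have [N hN] := half_pow_le (divr_gt0 (divr_gt0 d0 (ltr0Sn R 1)) e0).
  have {}hN := hN _ (leqnn N); exists N => i j Ni Nj.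
  have h i' : (N <= i')%N -> nrm b (s m i' - s m N) <= d / 2.
    by move=> /hs3 /le_trans; apply; rewrite mulrC -ler_pdivlMr.
  have := h _ Ni; have := h _ Nj; rewrite (nrmBC _ (s m j)) => *.
  apply: (le_trans (nrm_triangle b (s m N) _ _)); lra.
have {sc}/choice[g hg] := sc; exists g; split => [|m].
  apply: le_eps => d d0; have [N /(_ N (leqnn N)) hN] := hg 0%N _ d0.
  have := hs2 0%N 0%N N; rewrite add0n expr0 [s 0%N 0%N]/= => h.
  rewrite (le_trans (nrm_triangle b (s 0%N N) _ _)) // addrC.
  rewrite (nrmBC b (g _)) lerD // (le_trans h) // ler_piMr ?(ltW e0) //.
apply/eqP; rewrite eq_le nrm_ge0 andbT; apply: le_eps => d d0.
have d1 : 0 < d / (C + 1) by rewrite divr_gt0 // addr_gt0.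
have [N hN] := hg m.+1 _ d1; have [M hM] := hg m _ d1.
have := hN _ (leq_maxl N M); have := hM _ (leqW (leq_maxr N M)).
set n := maxn N M => h1 h2; rewrite add0r.
apply: (le_trans (nrm_triangle b (s m n.+1) _ _)).
have -> : s m n.+1 = K (s m.+1 n) by rewrite /s addnS addSn.
rewrite -op_nrmB [X in _ <= X](_ : d = C * (d / (C + 1)) + d / (C + 1)); last first.
  by field; rewrite gt_eqF // addr_gt0.
rewrite lerD //; last by rewrite /s addSn -iterS -addnS.
apply: (le_trans (op_bound Kop _)); by rewrite ler_wpM2l ?(ltW C0) // nrmBC.
Qed.

(** The range of [K] is characterised by duality: [u] is in the range as soon as
[b u x] is bounded by the norm of [K x]. *)
Lemma op_range u c : 0 <= c -> (forall x, b u x <= c * nrm b (K x)) ->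
  exists g, nrm b (u - K g) = 0 /\ nrm b g <= c.
Proof.
move=> c0 hu.
have [||h [hl hc _]] := riesz_closure (F := K) (l := b u) cb op_lin _ c0.
- by move=> a x y; rewrite ipDr ipZr.
- exact: hu.
exists h; split => //; apply: (ip0_nrm0 (b := b)) => y.
by rewrite ipBl (op_sym Kop) hl subrr.
Qed.

End Operator.

(** * Abstract evolution equations and their comparison *)

Lemma subrACA {V : zmodType} (x y z t : V) : x - y - (z - t) = x - z - (y - t).
Proof. by rewrite opprD addrACA -opprD. Qed.

Section Evolution.
Context {R : realType} {V : lmodType R} (b : semi_ip V) (J : V -> V).

(** Multiplication by the imaginary unit, on a real space. *)
Record rotation : Prop := Rotation {
  rot_skew : forall x y, b (J x) y = - b x (J y);
  rot_ip : forall x y, b (J x) (J y) = b x y;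
  rotB : forall x y, J (x - y) = J x - J y }.

Definition commutes_rot (K : V -> V) := forall x, nrm b (J (K x) - K (J x)) = 0.

(** Encodes [b (u t - u s) (K psi) = int_s^t b (J (u r)) psi dA], the integrated
form of [u' = A' J L u], without an integral: the increment is close to
[(A t - A s) * c] when the integrand is close to [c]. *)
Record weak_evolution (K : V -> V) (T Abar : R) (A : R -> R) (u : R -> V) : Prop :=
  WeakEvolution {
  weak_evol_bound : forall s t psi c m, 0 <= s -> s <= t -> t <= T ->
    (forall r, s <= r -> r <= t -> `|b (J (u r)) psi - c| <= m) ->
    `|b (u t - u s) (K psi) - (A t - A s) * c| <= m * (Abar * (t - s)) }.

(** Encodes a solution of [U' = J L U] in the domain of [L], with [G = L U]. The
last field is the differential equation after application of [K]. *)
Record smooth_evolution (K : V -> V) (S C : R) (U G : R -> V) : Prop :=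
  SmoothEvolution {
  smooth_lip : forall s t, 0 <= s -> s <= t -> t <= S ->
    nrm b (U t - U s) <= C * (t - s);
  smooth_dom : forall s, 0 <= s -> s <= S ->
    nrm b (U s - K (G s)) = 0 /\ nrm b (G s) <= C;
  smooth_eq : forall s t, 0 <= s -> s <= t -> t <= S ->
    nrm b (K (U t - U s) - (t - s) *: J (U s)) <= C * (t - s) ^+ 2 }.

Hypothesis rot : rotation.

Lemma rot_isom x : nrm b (J x) = nrm b x.
Proof. by rewrite /nrm (rot_ip rot). Qed.

Lemma rot_ip0 K C x : inverse_op b K C -> commutes_rot K -> b (J x) (K x) = 0.
Proof.
move=> Kop KJ; have h : b (J x) (K x) = - b (J x) (K x).
  by rewrite -{1}(op_sym Kop) -(nrm0_ipB _ (KJ x)) (rot_skew rot) ipC.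
by move: h; lra.
Qed.

Lemma rot0 : J 0 = 0.
Proof. by have := rotB rot 0 0; rewrite !subrr. Qed.

(** Testing the increment of [U] against an element [Y = K Z] of the domain gains
an error that is quadratic in time. *)
Lemma increment_ip K C S D U G s t Y Z :
  inverse_op b K C -> commutes_rot K -> smooth_evolution K S D U G ->
  0 <= s -> s <= t -> t <= S -> (forall z, b Y z = b (K Z) z) ->
  `|b (U t - U s) Y - (t - s) * b (J (G s)) Y| <= D * (t - s) ^+ 2 * nrm b Z.
Proof.
move=> Kop KJ hU s0 st tS YZ; have sS := le_trans st tS.
rewrite !(ipC _ _ Y) !YZ !(ipC _ (K Z)) -!(op_sym Kop) -(nrm0_ipB _ (KJ _)).
have -> : b (J (K (G s))) Z = b (J (U s)) Z.
  apply: esym; apply: nrm0_ipB; rewrite -(rotB rot) rot_isom.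
  exact: (smooth_dom hU s0 sS).1.
rewrite -ipZl -ipBl (le_trans (cauchy_schwarz _ _ _)) // ler_wpM2r ?nrm_ge0 //.
exact: (smooth_eq hU).
Qed.

(** The resolvent identities [K2 = K1 (1 + Q K2)] and [K1 = K2 (1 - Q K1)], where
[Q] is the difference of the two operators inverted by [K1] and [K2]. *)
Definition op_close (K1 K2 : V -> V) (kappa : R) := exists Q : V -> V,
  [/\ forall x, nrm b (Q x) <= kappa * nrm b x,
      forall g, nrm b (K2 g - K1 (g + Q (K2 g))) = 0 &
      forall g, nrm b (K1 g - K2 (g - Q (K1 g))) = 0].

Lemma op_close_refl K C : inverse_op b K C -> op_close K K 0.
Proof.
move=> Kop; exists (fun=> 0); split=> g; first by rewrite nrm0 mul0r.
  by rewrite addr0 subrr nrm0.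
by rewrite subr0 subrr nrm0.
Qed.

Section Comparison.
Variables (K1 K2 : V -> V) (C1 C2 kappa S D1 D2 : R) (U1 U2 G1 G2 : R -> V).
Hypotheses (K1op : inverse_op b K1 C1) (K2op : inverse_op b K2 C2).
Hypotheses (K1J : commutes_rot K1) (K2J : commutes_rot K2) (kappa0 : 0 <= kappa).
Hypothesis K12 : op_close K1 K2 kappa.
Hypotheses (hU1 : smooth_evolution K1 S D1 U1 G1) (hU2 : smooth_evolution K2 S D2 U2 G2).

Definition gap t := U1 t - U2 t.
Local Notation W := gap.

(** The energy estimate for the difference [W] of two solutions. The equations are
[U1' = J L1 U1] and [U2' = J L2 U2] with [L1 = L2 + Q], so
[L1 U1 - L2 U2 = L1 W + Q U2]; the first term drops out against [W] because
[J L1] is skew, and the second gives the bound. The constants [D1] and [D2] occur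
only in the quadratic error, hence not in the conclusion. *)
Lemma comparison_le M1 M2 t : 0 <= t -> t <= S ->
  (forall s, 0 <= s -> s <= S -> nrm b (U1 s) <= M1) ->
  (forall s, 0 <= s -> s <= S -> nrm b (U2 s) <= M2) ->
  nrm b (W t) ^+ 2 <= nrm b (W 0) ^+ 2 + 2 * kappa * M2 * (M1 + M2) * t.
Proof.
move=> t0 tS hM1 hM2; have [Q [Qle K12' K21]] := K12.
have M10 : 0 <= M1 by apply: le_trans (hM1 t t0 tS); exact: nrm_ge0.
have M20 : 0 <= M2 by apply: le_trans (hM2 t t0 tS); exact: nrm_ge0.
have D10 : 0 <= D1 by apply: le_trans (smooth_dom hU1 t0 tS).2; exact: nrm_ge0.
have D20 : 0 <= D2 by apply: le_trans (smooth_dom hU2 t0 tS).2; exact: nrm_ge0.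
have WM s : 0 <= s -> s <= S -> nrm b (W s) <= M1 + M2.
  by move=> s0 sS; rewrite (le_trans (nrmB _ _ _)) // lerD // ?hM1 ?hM2.
(* X1 = L1 W and X2 = L2 W, computed without applying L1 or L2 *)
pose X1 s := G1 s - G2 s - Q (K2 (G2 s)).
pose X2 s := G1 s - Q (K1 (G1 s)) - G2 s.
have nK2 s : 0 <= s -> s <= S -> nrm b (K2 (G2 s)) <= M2.
  move=> s0 sS; rewrite -(nrm0_eq (smooth_dom hU2 s0 sS).1); exact: hM2.
have nK1 s : 0 <= s -> s <= S -> nrm b (K1 (G1 s)) <= M1.
  move=> s0 sS; rewrite -(nrm0_eq (smooth_dom hU1 s0 sS).1); exact: hM1.
have WX1 s z : 0 <= s -> s <= S -> b (W s) z = b (K1 (X1 s)) z.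
  move=> s0 sS; rewrite ipBl (nrm0_ipB _ (smooth_dom hU1 s0 sS).1).
  rewrite (nrm0_ipB _ (smooth_dom hU2 s0 sS).1) (nrm0_ipB _ (K12' _)).
  by rewrite !(op_sym K1op) -ipBl /X1 opprD addrA.
have WX2 s z : 0 <= s -> s <= S -> b (W s) z = b (K2 (X2 s)) z.
  move=> s0 sS; rewrite ipBl (nrm0_ipB _ (smooth_dom hU1 s0 sS).1).
  rewrite (nrm0_ipB _ (smooth_dom hU2 s0 sS).1) (nrm0_ipB _ (K21 _)).
  by rewrite !(op_sym K2op) -ipBl.
pose B1 := D1 + D2 + kappa * M2; pose B2 := D1 + D2 + kappa * M1.
have X1B s : 0 <= s -> s <= S -> nrm b (X1 s) <= B1.
  move=> s0 sS; rewrite (le_trans (nrmB _ _ _)) // lerD //.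
    by rewrite (le_trans (nrmB _ _ _)) // lerD ?(smooth_dom hU1 s0 sS).2 ?(smooth_dom hU2 s0 sS).2.
  by rewrite (le_trans (Qle _)) // ler_wpM2l // nK2.
have X2B s : 0 <= s -> s <= S -> nrm b (X2 s) <= B2.
  move=> s0 sS; rewrite (le_trans (nrmB _ _ _)) // /B2 addrAC lerD //; last first.
    exact: (smooth_dom hU2 s0 sS).2.
  rewrite (le_trans (nrmB _ _ _)) // lerD //.
    exact: (smooth_dom hU1 s0 sS).2.
  by rewrite (le_trans (Qle _)) // ler_wpM2l // nK1.
pose f s := nrm b (W s) ^+ 2.
have key s r : 0 <= s -> s <= r -> r <= S -> f r - f s <=
    2 * kappa * M2 * (M1 + M2) * (r - s) +
    (D1 * (B1 + B1) + D2 * (B2 + B2) + (D1 + D2) ^+ 2) * (r - s) ^+ 2.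
  move=> s0 sr rS; have sS := le_trans sr rS; have r0 := le_trans s0 sr.
  have rs0 : 0 <= r - s by rewrite subr_ge0.
  (* |x|^2 - |y|^2 = <x - y, x + y> keeps the increments of U1 and U2 apart *)
  have -> : f r - f s = b (U1 r - U1 s) (W r + W s) - b (U2 r - U2 s) (W r + W s).
    have e : U1 r - U1 s - (U2 r - U2 s) = W r - W s.
      by rewrite /gap subrACA.
    rewrite -ipBl e /f !sqr_nrm; move: (W r) (W s) => x y.
    by rewrite !ipE (ipC b y x); lra.
  have h1 : `|b (U1 r - U1 s) (W r + W s) - (r - s) * b (J (G1 s)) (W r + W s)|
      <= D1 * (B1 + B1) * (r - s) ^+ 2.
    have := increment_ip (Y := W r + W s) (Z := X1 r + X1 s) K1op K1J hU1 s0 sr rS.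
    have hz z : b (W r + W s) z = b (K1 (X1 r + X1 s)) z.
      by rewrite ipDl !WX1 // !(op_sym K1op) ipDl.
    move=> /(_ hz) /le_trans; apply.
    rewrite mulrAC ler_wpM2r ?sqr_ge0 // ler_wpM2l //.
    by rewrite (le_trans (nrmD _ _ _)) // lerD // X1B.
  have h2 : `|b (U2 r - U2 s) (W r + W s) - (r - s) * b (J (G2 s)) (W r + W s)|
      <= D2 * (B2 + B2) * (r - s) ^+ 2.
    have := increment_ip (Y := W r + W s) (Z := X2 r + X2 s) K2op K2J hU2 s0 sr rS.
    have hz z : b (W r + W s) z = b (K2 (X2 r + X2 s)) z.
      by rewrite ipDl !WX2 // !(op_sym K2op) ipDl.
    move=> /(_ hz) /le_trans; apply.
    rewrite mulrAC ler_wpM2r ?sqr_ge0 // ler_wpM2l //.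
    by rewrite (le_trans (nrmD _ _ _)) // lerD // X2B.
  (* G1 - G2 = X1 + Q U2, and J X1 is orthogonal to W = K1 X1 *)
  have e3 : J (G1 s) - J (G2 s) = J (X1 s) - J (- Q (K2 (G2 s))).
    by rewrite -!(rotB rot) /X1 opprK subrK.
  have h3 : b (J (G1 s)) (W r + W s) - b (J (G2 s)) (W r + W s) <=
      2 * kappa * M2 * (M1 + M2) + (D1 + D2) ^+ 2 * (r - s).
    have e4 (x y : V) : x + y = 2 *: y + (x - y).
      by rewrite scaler_nat mulr2n addrACA subrr addr0 addrC.
    rewrite (e4 (W r)).
    rewrite -ipBl ipDr ipZr lerD //.
      have -> : b (J (G1 s) - J (G2 s)) (W s) = b (J (Q (K2 (G2 s)))) (W s).
        rewrite e3 -(sub0r (Q _)) (rotB rot 0) rot0 sub0r opprK ipDl.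
        by rewrite (ipC _ (J (X1 s))) WX1 // ipC (rot_ip0 _ K1op K1J) add0r.
      rewrite -!mulrA ler_wpM2l // (le_trans (ip_le_nrm _ _ _)) // rot_isom.
      rewrite mulrA ler_pM ?nrm_ge0 // ?WM // (le_trans (Qle _)) //.
      by rewrite ler_wpM2l // nK2.
    rewrite (le_trans (ip_le_nrm _ _ _)) // expr2 -mulrA ler_pM ?nrm_ge0 //.
      rewrite (le_trans (nrmB _ _ _)) // !rot_isom lerD //.
        exact: (smooth_dom hU1 s0 sS).2.
      exact: (smooth_dom hU2 s0 sS).2.
    have -> : W r - W s = U1 r - U1 s - (U2 r - U2 s).
      by rewrite /gap subrACA.
    rewrite (le_trans (nrmB _ _ _)) // mulrDl lerD //.
      exact: (smooth_lip hU1).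
    exact: (smooth_lip hU2).
  have {}h3 := ler_wpM2l rs0 h3.
  move: h1 h2; rewrite !ler_norml => /andP[_ h1] /andP[h2 _].
  by lra.
have := partition_le key (lexx 0) t0 tS.
by rewrite /f subr0; lra.
Qed.

End Comparison.

Section Single.
Variables (K : V -> V) (C S D : R) (U G : R -> V).
Hypotheses (Kop : inverse_op b K C) (KJ : commutes_rot K).
Hypothesis hU : smooth_evolution K S D U G.

Lemma smooth_bounded s : 0 <= s -> s <= S -> nrm b (U s) <= C * D.
Proof.
move=> s0 sS; rewrite (nrm0_eq (smooth_dom hU s0 sS).1).
rewrite (le_trans (op_bound Kop _)) // ler_wpM2l ?(smooth_dom hU s0 sS).2 //.
by have := op_bound_ge1 Kop; lra.
Qed.

(** Comparison with the zero solution. *)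
Lemma smooth_conservation t : 0 <= t -> t <= S -> nrm b (U t) <= nrm b (U 0).
Proof.
move=> t0 tS.
have h0 : smooth_evolution K S 0 (fun=> 0) (fun=> 0).
  have Kz : nrm b (K 0) = 0.
    by apply: (ip0_nrm0 (b := b)) => y; rewrite (op_sym Kop) ip0l.
  split => [*|*|*]; first by rewrite subrr nrm0 mul0r.
    by rewrite sub0r nrmN Kz nrm0.
  by rewrite rot0 scaler0 !subr0 Kz mul0r.
have := comparison_le Kop Kop KJ KJ (lexx 0) (op_close_refl Kop) hU h0 t0 tS
  smooth_bounded (M2 := 0).
rewrite /gap !subr0 => h; rewrite -(@ler_pXn2r _ 2) ?nnegrE ?nrm_ge0 //.
apply: le_trans (h _) _; last by rewrite mulr0 !mul0r addr0.
by move=> *; rewrite nrm0.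
Qed.

(** Comparison of the solution with its own translate in time, which solves the
same equation. *)
Lemma smooth_shift s t : 0 <= s -> s <= t -> t <= S ->
  nrm b (U t - U s) <= nrm b (U (t - s) - U 0).
Proof.
move=> s0 st tS; set h := t - s; have h0 : 0 <= h by rewrite subr_ge0.
have SE : s <= S - h by rewrite /h; lra.
have h1 : smooth_evolution K (S - h) D (fun r => U (r + h)) (fun r => G (r + h)).
  split => [r r'|r|r r'] r0.
  - move=> rr' r'S; rewrite -[r' - r](_ : r' + h - (r + h) = _); last by ring.
    by apply: (smooth_lip hU); lra.
  - by move=> rS; apply: (smooth_dom hU); lra.
  - move=> rr' r'S; rewrite -[r' - r](_ : r' + h - (r + h) = _); last by ring.
    by apply: (smooth_eq hU); lra.
have h2 : smooth_evolution K (S - h) D U G.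
  split => [r r'|r|r r'] r0.
  - by move=> rr' r'S; apply: (smooth_lip hU); lra.
  - by move=> rS; apply: (smooth_dom hU); lra.
  - by move=> rr' r'S; apply: (smooth_eq hU); lra.
have := comparison_le Kop Kop KJ KJ (lexx 0) (op_close_refl Kop) h1 h2 s0 SE
  (M1 := C * D) (M2 := C * D).
rewrite /gap add0r (_ : s + h = t); last by rewrite /h; ring.
rewrite mulr0 !mul0r addr0 => h3.
rewrite -(@ler_pXn2r _ 2) ?nnegrE ?nrm_ge0 //; apply: h3 => r r0 rS.
  by apply: smooth_bounded; lra.
by apply: smooth_bounded; lra.
Qed.
End Single.

Section Reparametrize.
Variables (K : V -> V) (C T Abar M alpha : R) (A : R -> R) (u : R -> V).
Hypotheses (cb : complete_nrm b) (Kop : inverse_op b K C) (KJ : commutes_rot K).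
Hypotheses (hu : weak_evolution K T Abar A u) (T0 : 0 < T) (alpha0 : 0 < alpha).
Hypothesis ulip : forall s t, 0 <= s -> s <= t -> t <= T ->
  nrm b (u t - u s) <= M * (t - s).
Hypothesis A0 : A 0 = 0.
Hypothesis Aincr : forall s t, 0 <= s -> s <= t -> t <= T ->
  alpha * (t - s) <= A t - A s <= Abar * (t - s).
Hypothesis Asurj : forall s, 0 <= s -> s <= A T ->
  exists t, [/\ 0 <= t, t <= T & A t = s].

Let M0 : 0 <= M.
Proof.
have := ulip (lexx 0) (ltW T0) (lexx T) => /(le_trans (nrm_ge0 _ _)).
by rewrite subr0 pmulr_lge0.
Qed.

Lemma weak_increment s t r psi : 0 <= s -> s <= t -> t <= T -> s <= r -> r <= t ->
  `|b (u t - u s) (K psi) - (A t - A s) * b (J (u r)) psi|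
    <= M * Abar * (t - s) ^+ 2 * nrm b psi.
Proof.
move=> s0 st tT sr rt.
have -> : M * Abar * (t - s) ^+ 2 * nrm b psi =
  M * (t - s) * nrm b psi * (Abar * (t - s)) by ring.
apply: (weak_evol_bound hu) => // r' sr' r't.
rewrite -ipBl -(rotB rot) (le_trans (cauchy_schwarz _ _ _)) // rot_isom.
rewrite ler_wpM2r ?nrm_ge0 //.
have [rr|/ltW rr] := leP r r'.
  apply: (le_trans (ulip _ rr _)); [lra|lra|rewrite ler_wpM2l //; lra].
rewrite nrmBC; apply: (le_trans (ulip _ rr _)); [lra|lra|rewrite ler_wpM2l //; lra].
Qed.

(** A solution that is Lipschitz in time has values in the range of [K]. On a short
interval of length [d] around [s], the equation reads
[A' * b (J (u s)) psi = b (u') (K psi)] up to a quadratic error, and [A'] is at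
least [alpha]; so [b (J (u s)) psi] is bounded by the norm of [K psi]. *)
Lemma weak_domain s : 0 <= s -> s <= T ->
  exists g, nrm b (u s - K g) = 0 /\ nrm b g <= M / alpha.
Proof.
move=> s0 sT; apply: (op_range cb Kop); first by rewrite divr_ge0 // ltW.
have main psi : `|b (J (u s)) psi| <= M / alpha * nrm b (K psi).
  apply: le_eps => e e0.
  pose L := M * Abar * nrm b psi / alpha.
  pose d := Num.min (T / 2) (e / (`|L| + 1)).
  have L1 : 0 < `|L| + 1 by rewrite ltr_wpDl.
  have d0 : 0 < d by rewrite lt_min !divr_gt0.
  have dT : d <= T / 2 by rewrite ge_min lexx.
  have de : `|L| * d <= e.
    apply: (@le_trans _ _ ((`|L| + 1) * d)); first by rewrite ler_wpM2r ?(ltW d0) // lerDl.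
    by rewrite mulrC -ler_pdivlMr // ge_min lexx orbT.
  (* the interval lies to the right of s, or to its left when s is near T *)
  have [r [t [[r0 rt tT] rst]]] : exists r t, [/\ 0 <= r, t = r + d & t <= T] /\ r <= s <= t.
    have [h|h] := leP (s + d) T.
      by exists s, (s + d); split => //; rewrite lexx lerDl ltW.
    by exists (s - d), s; split; [split|]; lra.
  have /andP[rs st] := rst; have tr : t - r = d by lra.
  have {}rt : r <= t by lra.
  have := weak_increment psi r0 rt tT rs st; have := Aincr r0 rt tT.
  have := ulip r0 rt tT; rewrite tr => h1 /andP[h2 _] h3.
  have h4 : `|b (u t - u r) (K psi)| <= M * d * nrm b (K psi).
    by rewrite (le_trans (cauchy_schwarz _ _ _)) // ler_wpM2r // nrm_ge0.
  have h5 : (A t - A r) * `|b (J (u s)) psi| <=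
      M * d * nrm b (K psi) + M * Abar * d ^+ 2 * nrm b psi.
    have Ap : 0 <= A t - A r by rewrite (le_trans _ h2) // mulr_ge0 ?ltW.
    rewrite -(ger0_norm Ap) -normrM.
    rewrite -[X in `|X|](subKr (b (u t - u r) (K psi))).
    by rewrite (le_trans (ler_normB _ _)) // lerD.
  have h6 : alpha * d * `|b (J (u s)) psi| <= (A t - A r) * `|b (J (u s)) psi|.
    by rewrite ler_wpM2r.
  rewrite -(@ler_pM2l _ (alpha * d)) ?mulr_gt0 //.
  apply: (le_trans h6); apply: (le_trans h5).
  have -> : alpha * d * (M / alpha * nrm b (K psi) + e) =
    M * d * nrm b (K psi) + alpha * d * e by field; rewrite gt_eqF.
  rewrite lerD2l (_ : M * Abar * d ^+ 2 * nrm b psi = alpha * d * (L * d)); last first.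
    by rewrite /L; field; rewrite gt_eqF.
  have ad : 0 <= alpha * d by rewrite mulr_ge0 // ltW.
  by rewrite (ler_wpM2l ad) // (le_trans _ de) // (ler_wpM2r (ltW d0)) // ler_norm.
move=> x; rewrite -(rot_ip rot); apply: (le_trans (ler_norm _)).
by rewrite (le_trans (main _)) // -(nrm0_eq (KJ _)) rot_isom.
Qed.

(** The change of time [A]: its inverse [B] is Lipschitz because [A] increases at
rate at least [alpha], so [u \o B] inherits the Lipschitz bound of [u]. *)
Lemma smooth_of_weak : exists U G D, smooth_evolution K (A T) D U G /\
  forall t, 0 <= t -> t <= T -> U (A t) = u t.
Proof.
have /choice[B hB] s : exists t, 0 <= s -> s <= A T -> [/\ 0 <= t, t <= T & A t = s].
  have [s0|s0] := boolP (0 <= s); last by exists 0.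
  have [sS|sS] := boolP (s <= A T); last by exists 0.
  by have [t ht] := Asurj s0 sS; exists t.
have /choice[G hG] s : exists g, 0 <= s -> s <= T ->
    nrm b (u s - K g) = 0 /\ nrm b g <= M / alpha.
  have [s0|s0] := boolP (0 <= s); last by exists 0.
  have [sS|sS] := boolP (s <= T); last by exists 0.
  by have [t ht] := weak_domain s0 sS; exists t.
have Binc s t : 0 <= s -> s <= t -> t <= A T -> 0 <= B t - B s <= (t - s) / alpha.
  move=> s0 st tS; have [a1 a2 a3] := hB t (le_trans s0 st) tS.
  have [b1 b2 b3] := hB s s0 (le_trans st tS).
  have [h|/ltW h] := leP (B s) (B t).
    rewrite subr_ge0 h /= ler_pdivlMr // mulrC -{2}a3 -{2}b3.
    by have /andP[] := Aincr b1 h a2.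
  have /andP[h2 _] := Aincr a1 h b2.
  have h3 : 0 <= alpha * (B s - B t) by rewrite mulr_ge0 ?(ltW alpha0) // subr_ge0.
  have e : t = s by lra.
  by rewrite e !subrr mul0r lexx.
have Abar0 : 0 <= Abar.
  have /andP[h1 h2] := Aincr (lexx 0) (ltW T0) (lexx T).
  have := le_trans h1 h2; rewrite subr0 ler_pM2r // => /(le_trans _); apply.
  exact: ltW.
have Ma0 : 0 <= M / alpha by rewrite divr_ge0 // ltW.
have Mb0 : 0 <= M * Abar / alpha ^+ 2.
  by rewrite divr_ge0 ?mulr_ge0 // (ltW alpha0).
exists (fun s => u (B s)), (fun s => G (B s)), (M / alpha + M * Abar / alpha ^+ 2).
split; last first.
  move=> t t0 tT; have [h1 h2] : 0 <= A t /\ A t <= A T.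
    have /andP[h1 _] := Aincr (lexx 0) t0 tT; have /andP[h2 _] := Aincr t0 tT (lexx T).
    have : 0 <= alpha * (t - 0) by rewrite mulr_ge0 ?subr0 // (ltW alpha0).
    have : 0 <= alpha * (T - t) by rewrite mulr_ge0 ?subr_ge0 // (ltW alpha0).
    by move: h1 h2; rewrite A0; lra.
  have [a1 a2 a3] := hB _ h1 h2; congr u.
  have [h|/ltW h] := leP (B (A t)) t.
    have /andP[] := Aincr a1 h tT; rewrite a3 subrr pmulr_rle0 //; lra.
  have /andP[] := Aincr t0 h a2; rewrite a3 subrr pmulr_rle0 //; lra.
split => [s t|s|s t] s0 => [st tS|sS|st tS].
- have [a1 a2 a3] := hB t (le_trans s0 st) tS.
  have [b1 b2 b3] := hB s s0 (le_trans st tS).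
  have /andP[h1 h2] := Binc _ _ s0 st tS; rewrite subr_ge0 in h1.
  rewrite (le_trans (ulip b1 h1 a2)) // (le_trans (ler_wpM2l M0 h2)) //.
  rewrite mulrA mulrAC ler_wpM2r ?subr_ge0 // lerDl //.
- have [b1 b2 b3] := hB s s0 sS; have [h1 h2] := hG _ b1 b2.
  by split => //; rewrite (le_trans h2) // lerDl.
- have [a1 a2 a3] := hB t (le_trans s0 st) tS.
  have [b1 b2 b3] := hB s s0 (le_trans st tS).
  have /andP[h1 h2] := Binc _ _ s0 st tS; rewrite subr_ge0 in h1.
  apply: nrm_dual_le => [|psi]; first by rewrite mulr_ge0 ?sqr_ge0 // addr_ge0.
  rewrite ipBl ipZl (op_sym Kop); apply: (le_trans (ler_norm _)).
  have := weak_increment psi b1 h1 a2 (lexx _) h1; rewrite a3 b3 => /le_trans; apply.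
  rewrite ler_wpM2r ?nrm_ge0 //.
  apply: (@le_trans _ _ (M * Abar * ((t - s) / alpha) ^+ 2)).
    by rewrite ler_wpM2l ?mulr_ge0 // lerXn2r // nnegrE ?subr_ge0 // divr_ge0 ?subr_ge0 // ltW.
  rewrite expr_div_n mulrA mulrAC ler_wpM2r ?sqr_ge0 // lerDr //.
Qed.
End Reparametrize.

Section Uniqueness.
Variables (K : V -> V) (C T Abar M : R) (A : R -> R) (u : R -> V).
Hypotheses (Kop : inverse_op b K C) (KJ : commutes_rot K).
Hypotheses (hu : weak_evolution K T Abar A u) (Abar0 : 0 <= Abar).
Hypothesis uM : forall t, 0 <= t -> t <= T -> nrm b (u t) <= M.

(** The derivative of [b (K u) (K u)] is a multiple of [b (J u) (K u)], which vanishes; the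
square is differentiated through increments. *)
Lemma weak_unique t : nrm b (u 0) = 0 -> 0 <= t -> t <= T -> nrm b (u t) = 0.
Proof.
move=> u0 t0 tT; apply: (op_inj Kop).
have M0 : 0 <= M by apply: le_trans (uM t0 tT); exact: nrm_ge0.
have Klip s r : 0 <= s -> s <= r -> r <= T ->
    nrm b (K (u r - u s)) <= M * (Abar * (r - s)).
  move=> s0 sr rT; apply: nrm_dual_le.
    by rewrite !mulr_ge0 // subr_ge0.
  move=> psi; rewrite (op_sym Kop).
  have := weak_evol_bound hu (psi := psi) (c := 0) (m := M * nrm b psi) s0 sr rT.
  rewrite mulr0 subr0 => h; apply: (le_trans (ler_norm _)); rewrite mulrAC.
  apply: h => r' sr' r'r; rewrite subr0 (le_trans (cauchy_schwarz _ _ _)) //.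
  by rewrite rot_isom ler_wpM2r ?nrm_ge0 // uM //; lra.
have KBl x y z : b (K (x - y)) z = b (K x) z - b (K y) z.
  by rewrite !(op_sym Kop) ipBl.
have KBr x y z : b z (K (x - y)) = b z (K x) - b z (K y).
  by rewrite ipC KBl !(ipC _ z).
have KDr x y z : b z (K (x + y)) = b z (K x) + b z (K y).
  by rewrite -!(op_sym Kop) ipDr.
pose f s := nrm b (K (u s)) ^+ 2.
have key s r : 0 <= s -> s <= r -> r <= T ->
    f r - f s <= 0 * (r - s) + (2 * (M * Abar) ^+ 2) * (r - s) ^+ 2.
  move=> s0 sr rT; rewrite mul0r add0r.
  have rs0 : 0 <= r - s by rewrite subr_ge0.
  have -> : f r - f s = b (u r - u s) (K (K (u r + u s))).
    rewrite /f !sqr_nrm -(op_sym Kop (u r - u s)) KDr !KBl.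
    have := ipC b (K (u r)) (K (u s)); lra.
  have := weak_evol_bound hu (psi := K (u r + u s)) (c := 0)
    (m := M * (2 * (M * (Abar * (r - s))))) s0 sr rT.
  rewrite mulr0 subr0 => h; apply: (le_trans (ler_norm _)).
  have -> : 2 * (M * Abar) ^+ 2 * (r - s) ^+ 2 =
    M * (2 * (M * (Abar * (r - s)))) * (Abar * (r - s)) by ring.
  apply: h => p sp pr; rewrite subr0.
  have -> : b (J (u p)) (K (u r + u s)) = b (J (u p)) (K (u r - u p) - K (u p - u s)).
    rewrite KDr ipBr !KBr (rot_ip0 (u p) Kop KJ); lra.
  rewrite (le_trans (cauchy_schwarz _ _ _)) // ler_pM ?nrm_ge0 //.
    by rewrite rot_isom uM //; lra.
  rewrite (le_trans (nrmB _ _ _)) // mulrDl mul1r lerD //.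
    rewrite (le_trans (Klip _ _ _ _ _)) //; [lra|]; rewrite ler_wpM2l // ler_wpM2l //; lra.
  rewrite (le_trans (Klip _ _ _ _ _)) //; [lra|]; rewrite ler_wpM2l // ler_wpM2l //; lra.
have := partition_le key (lexx 0) t0 tT.
have K0 : nrm b (K (u 0)) = 0.
  have := op_bound Kop (u 0); rewrite u0 mulr0 => h.
  by apply/eqP; rewrite eq_le h nrm_ge0.
rewrite mul0r /f K0 expr0n subr0 => h.
by apply/eqP; rewrite -sqrf_eq0 eq_le h sqr_ge0.
Qed.
End Uniqueness.

End Evolution.

(** * Nets of evolutions *)

Section Net.
Context {R : realType} {V : lmodType R} (b : semi_ip V) (J : V -> V).
Hypothesis rot : rotation b J.
Variables (K : R -> V -> V) (U G : R -> R -> V) (A : R -> R -> R) (S D : R -> R).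
Variables (C M smin Sbar T e1 : R).
Hypotheses (e10 : 0 < e1) (smin0 : 0 < smin).
Hypothesis evol : forall e, 0 < e -> e <= e1 ->
  [/\ inverse_op b (K e) C, commutes_rot b J (K e) &
      smooth_evolution b J (K e) (S e) (D e) (U e) (G e)].
Hypothesis UM : forall e, 0 < e -> e <= e1 -> nrm b (U e 0) <= M.
Hypothesis Sle : forall e, 0 < e -> e <= e1 -> smin <= S e <= Sbar.
Hypothesis Ale : forall e t, 0 < e -> e <= e1 -> 0 <= t -> t <= T -> 0 <= A e t <= S e.
Hypothesis close : forall eta, 0 < eta -> exists e2, 0 < e2 /\
  forall e d, 0 < e -> e <= e2 -> 0 < d -> d <= e2 ->
  [/\ nrm b (U e 0 - U d 0) <= eta, op_close b (K e) (K d) eta &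
      forall t, 0 <= t -> t <= T -> `|A e t - A d t| <= eta].

Let M0 : 0 <= M.
Proof. exact: le_trans (nrm_ge0 _ _) (UM e10 (lexx _)). Qed.
Let Sbar0 : 0 <= Sbar.
Proof. by have /andP[h1 h2] := Sle e10 (lexx _); rewrite (le_trans (ltW smin0)) // (le_trans h1). Qed.

(** Members of the net are compared in their own time, on the common part of
their intervals of definition. *)
Lemma gap_uniform eta : 0 < eta -> exists e2, [/\ 0 < e2, e2 <= e1 &
  forall e d s, 0 < e -> e <= e2 -> 0 < d -> d <= e2 ->
    0 <= s -> s <= S e -> s <= S d -> nrm b (U e s - U d s) <= eta].
Proof.
move=> eta0; pose L := 2 * M * (M + M) * Sbar.
have L0 : 0 <= L by rewrite !mulr_ge0 // addr_ge0.
pose k := Num.min (eta / 2) (eta ^+ 2 / 2 / (L + 1)).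
have eta20 : 0 < eta ^+ 2 / 2 by rewrite divr_gt0 // exprn_gt0.
have L1 : 0 < L + 1 by rewrite ltr_wpDl.
have k0 : 0 < k by rewrite lt_min !divr_gt0 // exprn_gt0.
have k1 : k <= eta / 2 by rewrite ge_min lexx.
have k2 : k * L <= eta ^+ 2 / 2.
  apply: (@le_trans _ _ (k * (L + 1))); first by rewrite ler_wpM2l ?(ltW k0) // lerDl.
  by rewrite -ler_pdivlMr // ge_min lexx orbT.
have [e2 [e20 he2]] := close k0.
exists (Num.min e1 e2); split; [by rewrite lt_min e10|by rewrite ge_min lexx|].
move=> e d s e0; rewrite le_min => /andP[ee1 ee2] d0; rewrite le_min => /andP[de1 de2].
move=> s0 sSe sSd.
have [Kop KJ hU] := evol e0 ee1; have [Kop' KJ' hU'] := evol d0 de1.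
have [h1 h2 _] := he2 e d e0 ee2 d0 de2.
have restrict f : smooth_evolution b J (K f) (S f) (D f) (U f) (G f) -> s <= S f ->
    smooth_evolution b J (K f) s (D f) (U f) (G f).
  move=> hf sf; split => [p q|p|p q] p0.
  - by move=> pq qs; apply: (smooth_lip hf) => //; exact: le_trans sf.
  - by move=> ps; apply: (smooth_dom hf) => //; exact: le_trans sf.
  - by move=> pq qs; apply: (smooth_eq hf) => //; exact: le_trans sf.
have bd f : 0 < f -> f <= e1 -> s <= S f -> forall p, 0 <= p -> p <= s -> nrm b (U f p) <= M.
  move=> f0 fe1 sf p p0 ps; have [? ? hf] := evol f0 fe1.
  have pS := le_trans ps sf.
  by apply: le_trans (UM f0 fe1); apply: (smooth_conservation rot _ _ hf); eassumption.
have := comparison_le rot Kop Kop' KJ KJ' (ltW k0) h2 (restrict _ hU sSe)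
   (restrict _ hU' sSd) s0 (lexx s) (bd _ e0 ee1 sSe) (bd _ d0 de1 sSd).
rewrite /gap => h3.
rewrite -(@ler_pXn2r _ 2) ?nnegrE ?nrm_ge0 ?(ltW eta0) //; apply: (le_trans h3).
have h4 : nrm b (U e 0 - U d 0) ^+ 2 <= (eta / 2) ^+ 2.
  by rewrite lerXn2r // ?nnegrE ?nrm_ge0 ?divr_ge0 ?(ltW eta0) // (le_trans h1).
have h5 : 2 * k * M * (M + M) * s <= k * L.
  rewrite /L (_ : 2 * k * M * (M + M) * s = k * (2 * M * (M + M) * s)); last by ring.
  rewrite ler_wpM2l ?(ltW k0) // ler_wpM2l //; last first.
    by rewrite (le_trans sSe) //; have /andP[] := Sle e0 ee1.
  by rewrite !mulr_ge0 // addr_ge0.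
have : (eta / 2) ^+ 2 = eta ^+ 2 / 4 by field.
by lra.
Qed.

(** The members [e] and [d] are evaluated at the times [A e t] and [A d t], which
are close but different. By [smooth_shift] a member moves between two times at
most as far as it does from time 0 in the same duration, and there every member
with a smaller parameter is close to the fixed member [e2], which is Lipschitz. *)
Lemma net_cauchy eta : 0 < eta -> exists e2, [/\ 0 < e2, e2 <= e1 &
  forall e d t, 0 < e -> e <= e2 -> 0 < d -> d <= e2 ->
    0 <= t -> t <= T -> nrm b (U e (A e t) - U d (A d t)) <= eta].
Proof.
move=> eta0; have eta4 : 0 < eta / 4 by rewrite divr_gt0.
have [e2 [e20 e21 he2]] := gap_uniform eta4.
pose h0 := Num.min smin (eta / 4 / (`|D e2| + 1)).
have D1 : 0 < `|D e2| + 1 by rewrite ltr_wpDl.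
have h00 : 0 < h0 by rewrite lt_min smin0 divr_gt0.
have [e3 [e30 he3]] := close h00.
(* equicontinuity at time 0, borrowed from the member e2 *)
have near0 e h : 0 < e -> e <= e2 -> 0 <= h -> h <= h0 -> h <= S e ->
    nrm b (U e h - U e 0) <= 3 * (eta / 4).
  move=> e0 ee2 hge0; rewrite le_min => /andP[h1 h2] h3.
  have [_ _ hU] := evol e20 e21; have /andP[h4 _] := Sle e20 e21.
  have h5 := le_trans h1 h4.
  have g1 := he2 e e2 h e0 ee2 e20 (lexx _) hge0 h3 h5.
  have Se0 : 0 <= S e by exact: le_trans h3.
  have S20 : 0 <= S e2 by exact: le_trans h5.
  have g2 := he2 e e2 0 e0 ee2 e20 (lexx _) (lexx _) Se0 S20.
  have g3 : nrm b (U e2 h - U e2 0) <= eta / 4.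
    rewrite (le_trans (smooth_lip hU (lexx _) hge0 h5)) // subr0.
    apply: (@le_trans _ _ ((`|D e2| + 1) * h)).
      by rewrite ler_wpM2r // (le_trans (ler_norm _)) // lerDl.
    by rewrite mulrC -ler_pdivlMr.
  apply: (le_trans (nrm_triangle b (U e2 h) _ _)).
  have := nrm_triangle b (U e2 0) (U e2 h) (U e 0); rewrite (nrmBC _ (U e2 0)).
  by lra.
have key e d t : 0 < e -> e <= Num.min e2 e3 -> 0 < d -> d <= Num.min e2 e3 ->
    0 <= t -> t <= T -> A e t <= A d t ->
    nrm b (U e (A e t) - U d (A d t)) <= eta.
  move=> e0; rewrite le_min => /andP[ee2 ee3] d0; rewrite le_min => /andP[de2 de3].
  move=> t0 tT Aed; have [_ _ /(_ t t0 tT) hA] := he3 e d e0 ee3 d0 de3.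
  have [Kop KJ hU] := evol d0 (le_trans de2 e21).
  have /andP[a1 a2] := Ale e0 (le_trans ee2 e21) t0 tT.
  have /andP[c1 c2] := Ale d0 (le_trans de2 e21) t0 tT.
  have g1 := he2 e d (A e t) e0 ee2 d0 de2 a1 a2 (le_trans Aed c2).
  have g2 := smooth_shift rot Kop KJ hU a1 Aed c2.
  have dA : A d t - A e t <= h0 by rewrite (le_trans _ hA) // distrC ler_norm.
  have dA0 : 0 <= A d t - A e t by rewrite subr_ge0.
  have g3 := near0 d (A d t - A e t) d0 de2 dA0 dA (ltac:(lra)).
  apply: (le_trans (nrm_triangle b (U d (A e t)) _ _)).
  by rewrite (nrmBC _ (U d (A e t)) (U d (A d t))); lra.
exists (Num.min e2 e3); split; first by rewrite lt_min e20.
  by rewrite (le_trans _ e21) // ge_min lexx.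
move=> e d t e0 ee2 d0 de2 t0 tT; have [h|/ltW h] := leP (A e t) (A d t).
  exact: key.
by rewrite nrmBC; apply: key.
Qed.

End Net.

(** * The real space L^2(0, 1) *)

Lemma one_le_two_ereal {R : realType} : (1 <= (2%:R : R)%:E)%E. Proof. by rewrite lee1n. Qed.

Section RealL2.
Context {R : realType}.
Local Notation mu := (@lebesgue_measure R).
Local Notation RL := (measurableTypeR R).
Definition unit_itv : set R := `]0, 1[.
Local Notation D := unit_itv.

Definition L2fun := LfunType mu (@one_le_two_ereal R).
Implicit Types f g h : L2fun.

Lemma ae_mono (P Q : R -> Prop) : (forall x, P x -> Q x) ->
  {ae mu, forall x, P x} -> {ae mu, forall x, Q x}.
Proof. by move=> PQ; apply: negligibleS => x /= h /PQ. Qed.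

Lemma ae_mono2 (P Q S : R -> Prop) : (forall x, P x -> Q x -> S x) ->
  {ae mu, forall x, P x} -> {ae mu, forall x, Q x} -> {ae mu, forall x, S x}.
Proof.
move=> PQ p q; have := negligibleU p q; apply: negligibleS => x /= h.
by apply: contrapT => /not_orP[/contrapT ? /contrapT ?]; apply: h; apply: PQ.
Qed.

Lemma mD : @measurable _ RL D. Proof. exact: measurable_itv. Qed.
Hint Resolve mD : core.

Lemma muD : (mu D = 1)%E.
Proof. by rewrite /D lebesgue_measure_itv /= lte_fin ltr01 -EFinD subr0. Qed.

Lemma L2funZ a f x : (a *: f) x = a * f x. Proof. by []. Qed.
Lemma L2funD f g x : (f + g) x = f x + g x. Proof. by []. Qed.
Lemma L2funB f g x : (f - g) x = f x - g x. Proof. by []. Qed.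
Lemma L2funN f x : (- f) x = - f x. Proof. by []. Qed.
Definition L2funE := (L2funZ, L2funD, L2funB, L2funN).

Lemma measurable_L2fun f (E : set RL) : measurable_fun E f.
Proof. by apply: measurable_funTS; have := LfunP f; rewrite inE => /andP[/[!inE]]. Qed.
Hint Resolve measurable_L2fun : core.

Lemma integrable_L2fun f g : mu.-integrable D (fun x => (f x * g x)%:E).
Proof.
apply: (integrableS measurableT) => //.
have := @Lfun2_mul_Lfun1 _ _ _ mu f g (LfunP f) (LfunP g).
by move/Lfun1_integrable.
Qed.

Definition square_integrable (f : R -> R) :=
  measurable_fun (D : set RL) f /\ mu.-integrable D (fun x => (f x ^+ 2)%:E).

Lemma square_integrable_Lfun (f : R -> R) : square_integrable f ->
  f \_ D \in Lfun mu 2%:E.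
Proof.
move=> [mf sf]; rewrite inE; apply/andP; split; rewrite inE /=.
  by apply/(measurable_restrictT f mD).
rewrite /finite_norm unlock poweR_lty // /=.
have /integrableP[_] := (integrable_mkcond _ mD).1 sf; apply: le_lt_trans.
rewrite le_eqVlt; apply/orP; left; apply/eqP; apply: eq_integral => x _ /=.
rewrite powR_mulrn // !patchE; case: ifP => _ /=.
  by rewrite real_normK ?num_real // ger0_norm // sqr_ge0.
by rewrite normr0 expr0n.
Qed.

(** Opaque, since only the values on the interval matter. *)
Lemma toL2_exists (f : R -> R) :
  {g : L2fun | square_integrable f -> forall x, D x -> g x = f x}.
Proof.
have [sf|nsf] := pselect (square_integrable f); last by exists 0.
exists (Lfun_Sub _ (square_integrable_Lfun sf)) => _ x Dx.
by rewrite Lfun_valP patchE mem_set.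
Qed.
Definition toL2 (f : R -> R) : L2fun := projT1 (toL2_exists f).

Lemma toL2E (f : R -> R) x : square_integrable f -> D x -> toL2 f x = f x.
Proof. by move=> sf; exact: (projT2 (toL2_exists f)). Qed.

Lemma square_integrable_L2 f : square_integrable f.
Proof. by split => //; under eq_fun do rewrite expr2; exact: integrable_L2fun. Qed.

Definition L2inner (f g : L2fun) : R := \int[mu]_(x in D) (f x * g x).

Lemma L2innerC f g : L2inner f g = L2inner g f.
Proof. by apply: eq_Rintegral => x _; rewrite mulrC. Qed.

Lemma L2inner_lin a f g h : L2inner (a *: f + g) h = a * L2inner f h + L2inner g h.
Proof.
rewrite /L2inner -RintegralZl //; last exact: integrable_L2fun.
rewrite -RintegralD //; last 2 first.
- rewrite (_ : _ \o _ = fun x => ((a *: f) x * h x)%:E); first exact: integrable_L2fun.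
  by apply/funext => x /=; rewrite mulrA.
- exact: integrable_L2fun.
by apply: eq_Rintegral => x _; rewrite mulrA -mulrDl.
Qed.

Lemma L2inner_ge0 f : 0 <= L2inner f f.
Proof. by apply: Rintegral_ge0 => x _; rewrite -expr2 sqr_ge0. Qed.

(** Opaque, so that the inner product is known only through [L2ipE]. *)
Lemma L2ip_exists : {b : semi_ip L2fun | forall f g, b f g = L2inner f g}.
Proof. by exists (SemiIp L2innerC L2inner_lin L2inner_ge0). Qed.
Definition L2ip : semi_ip L2fun := projT1 L2ip_exists.
Lemma L2ipE f g : L2ip f g = \int[mu]_(x in D) (f x * g x).
Proof. exact: (projT2 L2ip_exists). Qed.

Lemma L2ip_ae f g h : {ae mu, forall x, D x -> f x = g x} -> L2ip f h = L2ip g h.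
Proof.
move=> fg; rewrite !L2ipE; congr fine; apply: ae_eq_integral => //.
- by apply/measurable_EFinP; apply: measurable_funM.
- by apply/measurable_EFinP; apply: measurable_funM.
by apply: ae_mono fg => x /[apply] /= ->.
Qed.

Lemma nrm_ae0 f : {ae mu, forall x, D x -> f x = 0} -> nrm L2ip f = 0.
Proof.
move=> f0; apply: (@ip0_nrm0 _ _ L2ip) => g.
by rewrite (@L2ip_ae f 0) // ip0l.
Qed.

Lemma ae0_nrm f : nrm L2ip f = 0 -> {ae mu, forall x, D x -> f x = 0}.
Proof.
move=> f0; have : L2ip f f = 0 by rewrite -sqr_nrm f0 expr0n.
move=> h; have : (\int[mu]_(x in D) `|(f x * f x)%:E| = 0)%E.
  rewrite -[LHS]fineK.
    rewrite -[RHS]/(0%:E); congr EFin; rewrite -h L2ipE; congr fine; apply: eq_integral => x _.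
    by rewrite /= ger0_norm // -expr2 sqr_ge0.
  have /integrableP[_] := integrable_L2fun f f.
  by rewrite ge0_fin_numE // integral_ge0.
move/ae_eq_integral_abs => /(_ mD).
have m2 : measurable_fun (D : set RL) (fun x => (f x * f x)%:E).
  by apply/measurable_EFinP; apply: measurable_funM.
move=> /(_ m2); apply: ae_mono => x /[apply] /=.
by case=> /eqP; rewrite -expr2 sqrf_eq0 => /eqP.
Qed.

Lemma nrm_aeB f g : nrm L2ip (f - g) = 0 <-> {ae mu, forall x, D x -> f x = g x}.
Proof.
split=> [/ae0_nrm|fg].
  by apply: ae_mono => x /[apply] /eqP; rewrite subr_eq0 => /eqP.
by apply: nrm_ae0; apply: ae_mono fg => x fg Dx; apply/eqP; rewrite subr_eq0; apply/eqP/fg.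
Qed.

Lemma bounded_integrable (A : set RL) (f : R -> R) M :
  measurable A -> (mu A < +oo)%E -> measurable_fun A f ->
  {ae mu, forall x, A x -> `|f x| <= M} -> mu.-integrable A (fun x => (f x)%:E).
Proof.
move=> mA Afin mf fM; have mEf : measurable_fun A (EFin \o f) by exact/measurable_EFinP.
have M0 : (0 <= `|M|%:E)%E by rewrite lee_fin.
have h : {ae mu, forall x, A x -> (`|(EFin \o f) x| <= `|M|%:E)%E}.
  by apply: ae_mono fM => x /[apply] h; rewrite lee_fin (le_trans h) // ler_norm.
apply/integrableP; split => //.
by apply: le_lt_trans (integral_le_bound _ mA mEf M0 h) _; rewrite lte_mul_pinfty.
Qed.

Lemma muD_lty : (mu D < +oo)%E. Proof. by rewrite muD ltry. Qed.
Hint Resolve muD_lty : core.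

Lemma square_integrable_bounded (f : R -> R) M :
  measurable_fun (D : set RL) f -> {ae mu, forall x, D x -> `|f x| <= M} ->
  square_integrable f.
Proof.
move=> mf fM; split => //; apply: (@bounded_integrable _ _ (M ^+ 2)) => //.
  exact: measurable_funX.
apply: ae_mono fM => x /[apply] h.
by rewrite normrX lerXn2r // nnegrE // (le_trans (normr_ge0 _) h).
Qed.

Lemma square_integrableM (f g : R -> R) : square_integrable f -> square_integrable g ->
  mu.-integrable D (fun x => (f x * g x)%:E).
Proof.
move=> sf sg; apply: (eq_integrable mD _ _ _ (integrable_L2fun (toL2 f) (toL2 g))).
by move=> x /[!inE] Dx; rewrite !toL2E.
Qed.

Lemma square_integrableZ a (f : R -> R) : square_integrable f ->
  square_integrable (fun x => a * f x).
Proof.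
move=> sf; split; first by apply: measurable_funM => //; exact: sf.1.
apply: (eq_integrable mD _ _ _ (integrable_L2fun (a *: toL2 f) (a *: toL2 f))).
by move=> x /[!inE] Dx; rewrite L2funE toL2E // expr2.
Qed.

Lemma square_integrableD (f g : R -> R) : square_integrable f -> square_integrable g ->
  square_integrable (fun x => f x + g x).
Proof.
move=> sf sg; split; first by apply: measurable_funD; [exact: sf.1|exact: sg.1].
apply: (eq_integrable mD _ _ _ (integrable_L2fun (toL2 f + toL2 g) (toL2 f + toL2 g))).
by move=> x /[!inE] Dx; rewrite L2funE !toL2E // expr2.
Qed.

Definition one2 : L2fun := toL2 (cst 1).
Lemma square_integrable_cst c : square_integrable (cst c).
Proof. by apply: (@square_integrable_bounded _ `|c|) => //; apply: aeW. Qed.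
Lemma one2E x : D x -> one2 x = 1.
Proof. by move=> Dx; rewrite toL2E //; exact: square_integrable_cst. Qed.

Lemma integrable1_L2fun f : mu.-integrable D (fun x => (f x)%:E).
Proof.
apply: (eq_integrable mD _ _ _ (integrable_L2fun f one2)).
by move=> x /[!inE] Dx; rewrite one2E // mulr1.
Qed.

Lemma L2ip1 f : L2ip f one2 = \int[mu]_(x in D) f x.
Proof. by rewrite L2ipE; apply: eq_Rintegral => x /[!inE] Dx; rewrite one2E // mulr1. Qed.

Lemma nrm_one2 : nrm L2ip one2 = 1.
Proof.
rewrite /nrm L2ip1 (@eq_Rintegral _ _ _ mu D (cst 1)); last first.
  by move=> x /[!inE] Dx; rewrite one2E.
rewrite Rintegral_cst // mul1r (_ : fine _ = 1) ?sqrtr1 //.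
by rewrite -[RHS]/(fine 1%:E) -muD.
Qed.

(** Cauchy-Schwarz against the constant 1, the interval having measure 1. *)
Lemma L1_le_L2 f : \int[mu]_(x in D) `|f x| <= nrm L2ip f.
Proof.
have sf : square_integrable (fun x => `|f x|).
  split; first exact: measurableT_comp.
  apply: (eq_integrable mD _ _ _ (integrable_L2fun f f)).
  by move=> x _; rewrite real_normK ?num_real // expr2.
have -> : \int[mu]_(x in D) `|f x| = L2ip (toL2 (fun x => `|f x|)) one2.
  by rewrite L2ip1; apply: eq_Rintegral => x /[!inE] Dx; rewrite toL2E.
apply: (le_trans (ip_le_nrm _ _ _)); rewrite nrm_one2 mulr1 le_eqVlt; apply/orP; left.
apply/eqP; congr Num.sqrt; rewrite !L2ipE; apply: eq_Rintegral => x /[!inE] Dx.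
by rewrite toL2E // -!expr2 real_normK ?num_real.
Qed.

Lemma square_nrmE f : (nrm L2ip f ^+ 2)%:E = (\int[mu]_(x in D) (f x ^+ 2)%:E)%E.
Proof.
rewrite sqr_nrm L2ipE fineK; last exact: integrable_fin_num (integrable_L2fun f f).
by apply: eq_integral => x _; rewrite expr2.
Qed.

Lemma toL2_nrmB_le (f : R -> R) g c : 0 <= c -> square_integrable f ->
  (\int[mu]_(x in D) ((f x - g x) ^+ 2)%:E <= (c ^+ 2)%:E)%E ->
  nrm L2ip (toL2 f - g) <= c.
Proof.
move=> c0 sf h; apply: nrm_le => //; rewrite -sqr_nrm -lee_fin square_nrmE.
apply: le_trans h; rewrite le_eqVlt; apply/orP; left; apply/eqP.
by apply: eq_integral => x /[!inE] Dx; rewrite L2funE toL2E.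
Qed.

End RealL2.

(** * Completeness of L^2(0, 1) *)

Section RieszFischer.
Context {R : realType}.
Local Notation mu := (@lebesgue_measure R).
Local Notation RL := (measurableTypeR R).
Local Notation D := (@unit_itv R).
Local Notation ip := (@L2ip R).
Local Notation L2fun := (@L2fun R).
Hint Resolve mD muD_lty measurable_L2fun : core.

Lemma limn_einf_le (u : (\bar R)^nat) c N :
  (forall n, (N <= n)%N -> (u n <= c)%E) -> (limn_einf u <= c)%E.
Proof.
move=> h; rewrite limn_einf_lim; apply: lime_le; first exact: is_cvg_einfs.
near=> n; apply: ge_ereal_inf; exists (u n); last by apply: h; near: n; exists N.
by exists n => //=.
Unshelve. all: by end_near. Qed.

Lemma nneseries_lty (u : nat -> R) M : (forall n, 0 <= u n) ->
  (forall n, \sum_(0 <= k < n) u k <= M) ->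
  (\sum_(0 <= k <oo) (u k)%:E <= M%:E)%E.
Proof.
move=> u0 uM; apply: lime_le.
  by apply: is_cvg_nneseries => n _ _; rewrite lee_fin.
by apply: nearW => n; rewrite sumEFin lee_fin.
Qed.

Lemma cvg_absolute_telescope (u : nat -> R) M :
  (forall n, \sum_(0 <= k < n) `|u k.+1 - u k| <= M) -> cvgn u.
Proof.
move=> uM; have : cvgn (series (telescope u)).
  apply: normed_cvg; apply: nondecreasing_is_cvgn.
    by apply: nondecreasing_series => n _ _; rewrite normr_ge0.
  by exists M => _ [n _ <-]; exact: uM.
rewrite telescopeK => h.
rewrite (_ : u = fun n => (u n - u 0%N) + u 0%N); last by apply/funext => n; rewrite subrK.
by apply: is_cvgD => //; exact: is_cvg_cst.
Qed.

Lemma half_sum_le n : \sum_(0 <= k < n) 2^-1 ^+ k <= 2 :> R.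
Proof.
suff -> : \sum_(0 <= k < n) 2^-1 ^+ k = 2 - 2 * 2^-1 ^+ n :> R.
  by rewrite lerBlDr lerDl mulr_ge0 // exprn_ge0.
elim: n => [|n ih]; first by rewrite big_nil expr0 mulr1 subrr.
by rewrite big_nat_recr //= ih exprS; field.
Qed.

(** A sequence with summable increments converges almost everywhere, because the
sum of the increments has finite integral; Fatou's lemma then bounds the norms. *)
Lemma fast_cauchy_limit (y : nat -> L2fun) :
  (forall k j, (k <= j)%N -> nrm ip (y j - y k) <= 2^-1 ^+ k) ->
  exists l, forall k, nrm ip (l - y k) <= 2^-1 ^+ k.
Proof.
move=> hy; pose G (x : RL) := (\sum_(0 <= k <oo) `|y k.+1 x - y k x|%:E)%E.
have mdiff k : measurable_fun (D : set RL) (fun x => `|y k.+1 x - y k x|%:E).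
  apply/measurable_EFinP; apply: measurableT_comp => //.
  by apply: measurable_funB.
have intG : (\int[mu]_(x in D) G x <= 2%:E)%E.
  rewrite /G integral_nneseries //.
  have hk k : (\int[mu]_(x in D) `|y k.+1 x - y k x|%:E)%E =
      (\int[mu]_(x in D) `|(y k.+1 - y k) x|)%:E.
    rewrite /Rintegral fineK //.
    apply: integrable_fin_num => //.
    have := integrable1_L2fun (y k.+1 - y k) => /integrable_abse.
    by apply: eq_integrable.
  rewrite (eq_eseriesr (g := fun k => (\int[mu]_(x in D) `|(y k.+1 - y k) x|)%:E)) //.
  apply: nneseries_lty => [n|n]; first by apply: Rintegral_ge0.
  apply: le_trans (half_sum_le n); apply: ler_sum => k _.
  by apply: (le_trans (L1_le_L2 _)); exact: hy.
have aeG : {ae mu, forall x, D x -> exists l : R, y ^~ x @ \oo --> l}.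
  have iG : mu.-integrable D G.
    apply/integrableP; split.
      by apply: ge0_emeasurable_sum => // k x _ _; rewrite lee_fin.
    under eq_integral => x _.
      rewrite gee0_abs; last by apply: nneseries_ge0 => k _ _; rewrite lee_fin.
      over.
    by apply: le_lt_trans intG _; rewrite ltry.
  have := integrable_ae (@mD R) iG; apply: ae_mono => x /[apply] Gx.
  have : cvgn (y ^~ x).
    apply: (@cvg_absolute_telescope _ (fine (G x))) => n.
    rewrite -lee_fin fineK // -sumEFin.
    by apply: nneseries_lim_ge => k _ _; rewrite lee_fin.
  by move=> h; exists (lim (y ^~ x @ \oo)).
pose l (x : R) := fine (limn_esup (fun k => (y k x)%:E)).
have ml : measurable_fun (D : set RL) l.
  apply: measurableT_comp => //.
  apply: measurable_fun_limn_esup => k; exact/measurable_EFinP.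
have lE : {ae mu, forall x, D x -> y ^~ x @ \oo --> l x}.
  apply: ae_mono aeG => x /[apply] -[c hc].
  have hE : (fun k => (y k x)%:E) @ \oo --> c%:E by apply: cvg_EFin => //; exact: nearW.
  rewrite /l is_cvg_limn_esupE; last by apply/cvg_ex; exists c%:E.
  by rewrite (cvg_lim _ hE).
have fat k : (\int[mu]_(x in D) ((l x - y k x) ^+ 2)%:E <= ((2^-1 ^+ k) ^+ 2)%:E)%E.
  pose g j (x : RL) := ((y j x - y k x) ^+ 2)%:E.
  have mg j : measurable_fun (D : set RL) (g j).
    by apply/measurable_EFinP; apply: measurable_funX; apply: measurable_funB.
  have -> : (\int[mu]_(x in D) ((l x - y k x) ^+ 2)%:E =
      \int[mu]_(x in D) limn_einf (g ^~ x))%E.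
    apply: ge0_ae_eq_integral => //.
    - by apply/measurable_EFinP; apply: measurable_funX; apply: measurable_funB.
    - apply: (measurableT_comp (f := -%E)) => //.
      by apply: (measurable_fun_limn_esup (f := fun j x => - g j x)%E) => j; exact: measurableT_comp.
    - by move=> x _; rewrite lee_fin sqr_ge0.
    - move=> x _; rewrite limn_einf_lim; apply: lime_ge; first exact: is_cvg_einfs.
      by apply: nearW => n; apply/ereal_infP => _ [j _ <-]; rewrite lee_fin sqr_ge0.
    apply: ae_mono lE => x /[apply] hx.
    have hE : g ^~ x @ \oo --> ((l x - y k x) ^+ 2)%:E.
      apply: cvg_EFin; first exact: nearW.
      have hB : (fun j => y j x - y k x) @ \oo --> l x - y k x.
        by apply: cvgB => //; exact: cvg_cst.
      exact: (cvgM hB hB).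
    by rewrite /= is_cvg_limn_einfE ?(cvg_lim _ hE) //; apply/cvg_ex; exists ((l x - y k x) ^+ 2)%:E.
  have g0 j x : D x -> (0 <= g j x)%E by rewrite lee_fin sqr_ge0.
  apply: (le_trans (@fatou _ _ _ mu D (@mD R) g mg g0)).
  apply: (@limn_einf_le _ _ k) => j kj.
  have -> : (\int[mu]_(x in D) g j x = (nrm ip (y j - y k) ^+ 2)%:E)%E.
    by rewrite square_nrmE.
  by rewrite lee_fin lerXn2r ?nnegrE ?nrm_ge0 ?exprn_ge0 // hy.
have sl : square_integrable l.
  rewrite (_ : l = fun x => (l x - y 0%N x) + y 0%N x); last by apply/funext => x; rewrite subrK.
  apply: square_integrableD; last exact: square_integrable_L2.
  split; first by apply: measurable_funB.
  apply/integrableP; split.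
    by apply/measurable_EFinP; apply: measurable_funX; apply: measurable_funB.
  under eq_integral => x _ do rewrite gee0_abs ?lee_fin ?sqr_ge0 //.
  by apply: le_lt_trans (fat 0%N) _; rewrite ltry.
exists (toL2 l) => k; apply: toL2_nrmB_le => //; exact: exprn_ge0.
Qed.

(** Riesz-Fischer: a Cauchy sequence has a subsequence with summable increments. *)
Lemma L2_complete : complete_nrm ip.
Proof.
move=> x cx.
have /choice[N hN] k : exists N, forall m n, (N <= m)%N -> (N <= n)%N ->
    nrm ip (x m - x n) <= 2^-1 ^+ k.
  by apply: cx; rewrite exprn_gt0.
pose n k := (\sum_(i < k.+1) N i)%N.
have nN k : (N k <= n k)%N by rewrite /n big_ord_recr /= leq_addl.
have nmono j k : (k <= j)%N -> (n k <= n j)%N.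
  move=> kj; rewrite -(subnKC kj); elim: (j - k)%N => [|i ih]; first by rewrite addn0.
  by rewrite addnS (leq_trans ih) // /n [X in (_ <= X)%N]big_ord_recr /= leq_addr.
have [k j kj|l hl] := @fast_cauchy_limit (x \o n).
  apply: hN; last exact: nN.
  by rewrite (leq_trans (nN k)) // nmono.
exists l => e e0; have [k /(_ k (leqnn k)) hk] := half_pow_le (divr_gt0 e0 (ltr0Sn R 1)).
exists (N k) => m km.
apply: (le_trans (nrm_triangle _ (x (n k)) _ _)).
have := hN k m (n k) km (nN k); have := hl k; rewrite (nrmBC _ l) /=; lra.
Qed.
End RieszFischer.

(** * Primitives of square integrable functions *)

Section Primitive.
Context {R : realType}.
Local Notation mu := (@lebesgue_measure R).
Local Notation RL := (measurableTypeR R).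
Local Notation D := (@unit_itv R).
Local Notation ip := (@L2ip R).
Local Notation L2fun := (@L2fun R).
Hint Resolve mD muD_lty measurable_L2fun : core.

Lemma in_unit x : D x = (0 < x < 1) :> Prop.
Proof. by rewrite /unit_itv /= in_itv. Qed.

Definition prim (f : R -> R) (x : R) : R := \int[mu]_(t in `[0, x]) f t.

Lemma integrable_unit_cc (f : RL -> \bar R) :
  measurable_fun (`[0, 1]%classic : set RL) f ->
  mu.-integrable D f -> mu.-integrable `[0, 1] f.
Proof.
move=> mf /integrableP[_ fi]; apply/integrableP; split => //.
rewrite integral_itv_bndoo //.
by apply: measurableT_comp => //; apply: measurable_funS mf => //; apply: subset_itv_oo_cc.
Qed.

Lemma integrable_L2fun_cc (f : L2fun) : mu.-integrable `[0, 1] (fun x => (f x)%:E).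
Proof.
apply: integrable_unit_cc; last exact: integrable1_L2fun.
exact/measurable_EFinP.
Qed.

Lemma prim0 f : prim f 0 = 0.
Proof. by rewrite /prim set_itv1 Rintegral_set1. Qed.

Lemma prim_unit (f : R -> R) x : 0 <= x -> x <= 1 ->
  mu.-integrable `[0, 1] (fun x => (f x)%:E) ->
  prim f x = \int[mu]_(t in D) (if t <= x then f t else 0).
Proof.
move=> x0 x1 fi.
have h : prim f x = \int[mu]_(t in `]0, x[) f t.
  congr fine; rewrite /prim integral_itv_bndoo //.
  case/integrableP : fi => mf _; apply: measurable_funS mf => //.
  by apply: subset_itv => //; rewrite bnd_simp.
have h1 : mu.-integrable `]0, x[ (EFin \o f).
  by apply: integrableS fi => //; apply: subset_itv => //; rewrite bnd_simp.
rewrite h Rintegral_mkcond [RHS]Rintegral_mkcond.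
have [x1'|x1'] := ltP x 1; last first.
  apply: eq_Rintegral => t _; rewrite !patchE.
  have -> : x = 1 by apply/eqP; rewrite eq_le x1.
  case: ifPn => //; rewrite inE /= in_itv /= => /andP[_ /ltW ->] //.
rewrite -Rintegral_mkcond Rintegral_itv_bndo_bndc // Rintegral_mkcond.
apply: eq_Rintegral => t _; rewrite !patchE !mem_setE /= !in_itv /=.
have [tx|tx] := leP t x; last by rewrite andbF; case: ifP.
by rewrite andbT (le_lt_trans tx x1') andbT.
Qed.

Lemma eq_prim (f g : R -> R) x : 0 <= x -> x <= 1 ->
  mu.-integrable `[0, 1] (fun x => (f x)%:E) ->
  mu.-integrable `[0, 1] (fun x => (g x)%:E) ->
  {ae mu, forall x, D x -> f x = g x} -> prim f x = prim g x.
Proof.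
move=> x0 x1 fi gi fg; rewrite !prim_unit //.
have m (h : R -> R) : mu.-integrable `[0, 1] (fun x => (h x)%:E) ->
    measurable_fun (D : set RL) (fun t => (if t <= x then h t else 0)%:E).
  move=> hi; apply/measurable_EFinP; apply: measurable_fun_if => //.
    by apply: measurable_fun_ler.
  case/integrableP : hi => /measurable_EFinP mh _; apply: measurable_funS mh => //.
  by apply: (subset_trans (@subIsetl _ _ _)); apply: subset_itv_oo_cc.
congr fine; apply: ae_eq_integral => //; [exact: m|exact: m|].
by apply: ae_mono fg => t + Dt => ->.
Qed.

Lemma prim_continuous (f : R -> R) : mu.-integrable `[0, 1] (fun x => (f x)%:E) ->
  {within `[0, 1], continuous (prim f)}.
Proof. by move=> fi; apply: parameterized_integral_continuous. Qed.

Lemma measurable_prim (f : R -> R) : mu.-integrable `[0, 1] (fun x => (f x)%:E) ->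
  measurable_fun (`[0, 1]%classic : set RL) (prim f).
Proof. by move=> /prim_continuous h; apply: subspace_continuous_measurable_fun. Qed.

Lemma prim_le (f : L2fun) x : 0 <= x -> x <= 1 -> `|prim f x| <= nrm ip f.
Proof.
move=> x0 x1; apply: le_trans (L1_le_L2 f).
have fi := integrable_L2fun_cc f.
have fx : mu.-integrable `[0, x] (EFin \o f).
  by apply: integrableS fi => //; apply: subset_itv => //; rewrite bnd_simp.
apply: (le_trans (le_normr_Rintegral _ fx)) => //.
have -> : \int[mu]_(t in D) `|f t| = \int[mu]_(t in `[0, 1]) `|f t|.
  have mf : measurable_fun (D : set RL) (fun t => `|f t|%:E).
    by apply/measurable_EFinP; apply: measurableT_comp.
  by congr fine; rewrite [RHS]integral_itv_bndoo.
have fa : mu.-integrable `[0, 1] (fun t => `|f t|%:E) by apply: (integrable_abse fi).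
apply: fine_le.
- by apply: integrable_fin_num => //; apply: (integrable_abse fx).
- by apply: integrable_fin_num.
apply: ge0_subset_integral => //; first by apply/measurable_EFinP; apply: measurableT_comp.
by apply: subset_itv => //; rewrite bnd_simp.
Qed.

Lemma square_integrable_prim (f : L2fun) : square_integrable (prim f).
Proof.
apply: (@square_integrable_bounded _ _ (nrm ip f)).
  apply: measurable_funS (measurable_prim (integrable_L2fun_cc f)) => //.
  exact: subset_itv_oo_cc.
apply: aeW => x; rewrite in_unit => /andP[/ltW x0 /ltW x1].
exact: prim_le.
Qed.

Lemma measurable_patch_L2 (f : L2fun) : measurable_fun (setT : set RL) (f \_ D).
Proof. by apply/(measurable_restrictT f (@mD R)). Qed.

Lemma integrable_patch_L2 (f : L2fun) :
  mu.-integrable (setT : set RL) (fun x => ((f \_ D) x)%:E).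
Proof.
have /(integrable_mkcond _ (@mD R)) := integrable1_L2fun f.
by rewrite restrict_EFin.
Qed.

Lemma Rintegral_prim_le (f : L2fun) t : D t ->
  \int[mu]_(x in D) (if t <= x then f x else 0) = L2ip f (one2 : L2fun) - prim f t.
Proof.
rewrite in_unit => /andP[/ltW t0 /ltW t1].
rewrite L2ip1 prim_unit ?integrable_L2fun_cc //.
have mi (b : R -> bool) : measurable_fun (D : set RL) b ->
    mu.-integrable D (EFin \o (fun x => if b x then f x else 0)).
  move=> mb; apply: (le_integrable (@mD R) _ _ (integrable1_L2fun f)).
    by apply/measurable_EFinP; apply: measurable_fun_if => //; apply: measurable_funTS.
  by move=> x _ /=; case: ifP => // _; rewrite normr0 lee_fin.
rewrite -RintegralB //; last 2 first.
- exact: integrable1_L2fun.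
- by apply: mi; apply: measurable_fun_ler.
have -> : \int[mu]_(x in D) (f x - (if x <= t then f x else 0)) =
   \int[mu]_(x in D) (if t < x then f x else 0).
  by apply: eq_Rintegral => x _; case: leP; rewrite ?subrr ?subr0.
congr fine; apply: ae_eq_integral => //.
- have /integrableP[//] : mu.-integrable D (EFin \o (fun x => if t <= x then f x else 0)).
  by apply: mi; apply: measurable_fun_ler.
- have /integrableP[//] : mu.-integrable D (EFin \o (fun x => if t < x then f x else 0)).
  by apply: mi; apply: measurable_fun_ltr.
have : mu.-negligible [set t].
  by apply/negligibleP => //; apply: lebesgue_measure_set1.
apply: negligibleS => x /= h; apply: contrapT => xt; apply: h => _.
have -> // : (t <= x) = (t < x).
by rewrite le_eqVlt; case: eqP => // tx; case: xt.
Qed.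

(** Integration by parts, read as Fubini's theorem for [f x * h t] on the triangle
[t <= x]. Both primitives vanish at 0, so the boundary term is the product of the
two integrals. *)
Lemma prim_by_parts (f h : L2fun) :
  ip (toL2 (prim h)) f + ip h (toL2 (prim f)) = ip h one2 * ip f one2.
Proof.
pose F (z : RL * RL) := (if z.2 <= z.1 then (f \_ D) z.1 * (h \_ D) z.2 else 0)%:E.
have mF : measurable_fun setT F.
  apply/measurable_EFinP; apply: measurable_fun_if => //.
    by apply: measurable_fun_ler; [exact: measurable_snd|exact: measurable_fst].
  apply: measurable_funTS; apply: measurable_funM.
    by apply: measurableT_comp (measurable_patch_L2 f) _; exact: measurable_fst.
  by apply: measurableT_comp (measurable_patch_L2 h) _; exact: measurable_snd.
have abs_le x y : (`|F (x, y)| <= `|(f \_ D) x|%:E * `|(h \_ D) y|%:E)%E.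
  rewrite /F /= -EFinM lee_fin; case: ifP => _; first by rewrite normrM.
  by rewrite normr0 mulr_ge0.
have mF1 x : measurable_fun (setT : set RL) (fun y => F (x, y)).
  by apply: (measurableT_comp mF); exact: pair1_measurable.
have ah : mu.-integrable (setT : set RL) (fun y => `|(h \_ D) y|%:E).
  by have /integrable_abse := integrable_patch_L2 h.
have af : mu.-integrable (setT : set RL) (fun y => `|(f \_ D) y|%:E).
  by have /integrable_abse := integrable_patch_L2 f.
have iF : (mu \x mu)%E.-integrable setT F.
  apply: (integrable12ltyP mu mu mF).2.
  pose A := (\int[mu]_y `|(h \_ D) y|%:E)%E.
  have Afin : A \is a fin_num by apply: integrable_fin_num.
  apply: (@le_lt_trans _ _ (\int[mu]_x (`|(f \_ D) x|%:E * A))%E).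
    apply: ge0_le_integral => //.
    - by move=> x _; apply: integral_ge0.
    - apply: (measurable_fun_fubini_tonelli_F (abse \o F)); first exact: measurableT_comp.
      by move=> z; exact: abse_ge0.
    - by apply: emeasurable_funM => //; case/integrableP : af.
    move=> x _; rewrite /A -(integralZl measurableT ah).
    apply: ge0_le_integral => //; first exact: measurableT_comp.
    by apply: emeasurable_funM => //; case/integrableP : ah.
  rewrite -(fineK Afin) integralZr // lte_mul_pinfty //.
  - by apply: integral_ge0.
  - by apply: integrable_fin_num.
  - by rewrite ltry.
have sec (k : L2fun) (c : R) (p : RL -> bool) : measurable_fun setT p ->
    (\int[mu]_y (if p y then c * (k \_ D) y else 0)%:E)%E =
    (c * \int[mu]_(y in D) (if p y then k y else 0))%:E.
  move=> mp.
  have ip' : mu.-integrable D (EFin \o (fun y => if p y then k y else 0)).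
    apply: (le_integrable (@mD R) _ _ (integrable1_L2fun k)).
      apply/measurable_EFinP; apply: measurable_fun_if => //.
      exact: measurable_funTS.
    by move=> x _ /=; case: ifP => // _; rewrite normr0 lee_fin.
  rewrite EFinM /Rintegral fineK; last exact: integrable_fin_num.
  rewrite -integralZl // [RHS]integral_mkcond; apply: eq_integral => y _.
  by rewrite !patchE; case: ifP => _; case: ifP => _ //=; rewrite ?mulr0 ?mule0 ?EFinM.
have := Fubini iF.
rewrite /F /=.
under eq_integral => x _.
  rewrite (sec h ((f \_ D) x) (fun y => y <= x)); last exact: measurable_fun_ler.
  over.
under [in RHS]eq_integral => y _.
  under eq_integral => x _ do rewrite mulrC.
  rewrite (sec f ((h \_ D) y) (fun x => y <= x)); last exact: measurable_fun_ler.
  over.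
move=> /(congr1 fine) e.
have e1 : ip (toL2 (prim h)) f = ip h one2 * ip f one2 - ip h (toL2 (prim f)).
  have -> : ip h one2 * ip f one2 - ip h (toL2 (prim f)) =
      ip h (ip f one2 *: one2 - toL2 (prim f)) by rewrite ipBr ipZr mulrC.
  transitivity (\int[mu]_x ((f \_ D) x * \int[mu]_(y in D) (if y <= x then h y else 0))).
    rewrite L2ipE Rintegral_mkcond; apply: eq_Rintegral => x _.
    rewrite !patchE; case: ifPn => [|_]; last by rewrite mul0r.
    rewrite inE => Dx; rewrite (toL2E (square_integrable_prim h) Dx).
    have := Dx; rewrite in_unit => /andP[/ltW x0 /ltW x1].
    by rewrite prim_unit ?integrable_L2fun_cc // mulrC.
  rewrite [LHS]e -/(Rintegral _ _ _) L2ipE [RHS]Rintegral_mkcond; apply: eq_Rintegral => x _.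
  rewrite !patchE; case: ifPn => [|_]; last by rewrite mul0r.
  rewrite inE => Dx; rewrite L2funB L2funZ (one2E Dx) mulr1.
  by rewrite (toL2E (square_integrable_prim f) Dx) Rintegral_prim_le.
exact: (canLR (subrK _) e1).
Qed.

End Primitive.

(** * Primitives that vanish at both ends *)

Section Flux.
Context {R : realType}.
Local Notation mu := (@lebesgue_measure R).
Local Notation RL := (measurableTypeR R).
Local Notation D := (@unit_itv R).
Local Notation ip := (@L2ip R).
Local Notation L2fun := (@L2fun R).
Hint Resolve mD muD_lty measurable_L2fun : core.
Implicit Types f g h k : L2fun.

Lemma ae_dense (P : R -> Prop) x r : {ae mu, forall x, D x -> P x} -> D x -> 0 < r ->
  exists y, [/\ D y, `|x - y| < r & P y].
Proof.
move=> aeP; rewrite in_unit => /andP[x0 x1] r0; apply: contrapT => nP.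
pose d := Num.min r (1 - x); have d0 : 0 < d by rewrite lt_min r0 subr_gt0.
have dr : d <= r by rewrite ge_min lexx.
have dx : d <= 1 - x by rewrite ge_min lexx orbT.
have mI : @measurable _ RL `]x, x + d[ by exact: measurable_itv.
have /(measure_negligible mI) : mu.-negligible `]x, x + d[%classic.
  apply: negligibleS aeP => y /=; rewrite in_itv /= => /andP[xy yd] h; apply: nP.
  have Dy : D y by rewrite in_unit; apply/andP; split; lra.
  by exists y; split => //; [rewrite ltr_distlC; apply/andP; split; lra|exact: h].
have e : (mu `]x, (x + d)%R[ = d%:E)%E.
  by rewrite lebesgue_measure_itv /= lte_fin ltrDl d0 -EFinB addrAC subrr add0r.
by move=> /(etrans (esym e)) /eqP; rewrite eqe gt_eqF.
Qed.

(** The primitive is continuous, so it is constant everywhere, and Lebesgue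
differentiation recovers [f] from it almost everywhere. *)
Lemma prim_ae_cst (f : L2fun) c : {ae mu, forall x, D x -> prim f x = c} ->
  {ae mu, forall x, D x -> f x = 0}.
Proof.
move=> fc; have fi := integrable_L2fun_cc f.
have [cf _ _] := (continuous_within_itvP _ ltr01).1 (prim_continuous fi).
have {}fc x : D x -> prim f x = c.
  move=> Dx; apply/eqP; apply: contrapT => /negP; rewrite -subr_eq0 -normr_gt0 => e0.
  have /cf fx : x \in `]0, 1[ by [].
  have /cvgrPdist_lt/(_ _ e0)/nbhs_ballP[r /= r0 hr] := fx.
  have [y [Dy xy yc]] := ae_dense fc Dx r0.
  by have /= := hr y xy; rewrite yc ltxx.
have fDi := integrable_patch_L2 f.
have loc : locally_integrable [set: R] (f \_ D).
  by apply: integrable_locally (@mD R) _; exact: integrable1_L2fun.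
have fDy y : mu.-integrable [set` Interval (BLeft 0) (BRight y)] (EFin \o (f \_ D)).
  by apply: integrableS fDi.
have := @FTC1 R (f \_ D) (BLeft 0) fDy loc.
apply: ae_mono => x hx Dx; have := Dx; rewrite in_unit => /andP[x0 x1].
have b0x : (0%:E < x%:E)%E by rewrite lte_fin.
have [_] := hx b0x.
rewrite patchE mem_set // => <-.
rewrite derive1E (near_eq_derive (g := cst c)) ?derive_cst ?oner_eq0 //.
near=> y.
have Dy : D y by rewrite in_unit; apply/andP; split; near: y; [exact: lt_nbhsr|exact: lt_nbhsl].
rewrite /= -(fc y) //; apply: eq_prim => //.
- by have := Dy; rewrite in_unit => /andP[/ltW].
- by have := Dy; rewrite in_unit => /andP[_ /ltW].
- by apply: aeW => z Dz; rewrite patchE mem_set.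
Unshelve. all: by end_near. Qed.

(** The Volterra operator. *)
Definition volt (h : L2fun) : L2fun := toL2 (prim h).
Definition meanfree (h : L2fun) : L2fun := h - ip h one2 *: one2.
(** Removing the mean makes the primitive vanish at 1 as well as at 0. *)
Definition dirichlet_prim (h : L2fun) : L2fun := volt (meanfree h).

Lemma voltE h x : D x -> volt h x = prim h x.
Proof. by move=> Dx; rewrite (toL2E (square_integrable_prim h) Dx). Qed.

Lemma volt_by_parts f h : ip (volt h) f = ip h one2 * ip f one2 - ip h (volt f).
Proof. exact: (canRL (addrK _) (prim_by_parts f h)). Qed.

Lemma nrm_volt h : nrm ip (volt h) <= nrm ip h.
Proof.
have := @toL2_nrmB_le R (prim h) 0 (nrm ip h) (nrm_ge0 _ _) (square_integrable_prim h).
rewrite subr0; apply.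
apply: (@le_trans _ _ (\int[mu]_(x in D) cst (nrm ip h ^+ 2)%:E x)%E).
  have m1 : measurable_fun (D : set RL) (prim h) := (square_integrable_prim h).1.
  apply: ge0_le_integral => //.
  - by move=> x _; rewrite lee_fin sqr_ge0.
  - by apply/measurable_EFinP; apply: measurable_funX; apply: measurable_funB.
  - move=> x; rewrite in_unit => /andP[/ltW x0 /ltW x1]; rewrite lee_fin subr0.
    by rewrite -real_normK ?num_real // lerXn2r ?nnegrE ?nrm_ge0 // prim_le.
by rewrite integral_cst // -[leRHS]mule1 -muD.
Qed.

Lemma one2_ip : ip one2 one2 = 1.
Proof. by rewrite -sqr_nrm nrm_one2 expr1n. Qed.

Lemma meanfree_ip h z : ip (meanfree h) z = ip h (meanfree z).
Proof. by rewrite /meanfree !ipE (ipC _ one2 z); ring. Qed.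

Lemma meanfree_one2 h : ip (meanfree h) one2 = 0.
Proof. by rewrite /meanfree !ipE one2_ip; ring. Qed.

Lemma nrm_meanfree h : nrm ip (meanfree h) <= nrm ip h.
Proof.
apply: nrm_le; first exact: nrm_ge0.
rewrite meanfree_ip /meanfree !ipE one2_ip sqr_nrm.
by have := sqr_ge0 (ip h one2); lra.
Qed.

Lemma dirichlet_prim_ip h z : ip (dirichlet_prim h) z = - ip h (meanfree (volt z)).
Proof. by rewrite volt_by_parts meanfree_one2 mul0r add0r meanfree_ip. Qed.

Lemma nrm_dirichlet_prim h : nrm ip (dirichlet_prim h) <= nrm ip h.
Proof. exact: le_trans (nrm_volt _) (nrm_meanfree _). Qed.

(** The adjoint of [dirichlet_prim] is, up to sign, [meanfree \o volt]; if it kills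
[f], then the primitive of [f] is constant. *)
Lemma dirichlet_prim_dense f : (forall k, ip f (dirichlet_prim k) = 0) -> nrm ip f = 0.
Proof.
move=> h; apply: nrm_ae0.
have : nrm ip (meanfree (volt f)) = 0.
  apply: ip0_nrm0 => k; rewrite ipC -[LHS]opprK -dirichlet_prim_ip ipC h oppr0 //.
move/ae0_nrm => h1; apply: (@prim_ae_cst _ (ip (volt f) one2)).
apply: ae_mono h1 => x /[swap] Dx /(_ Dx).
rewrite /meanfree L2funB L2funZ one2E // mulr1 voltE // => /eqP.
by rewrite subr_eq0 => /eqP.
Qed.

Definition mulq (q : R -> R) (y : L2fun) : L2fun := toL2 (fun x => q x * y x).

Definition ess_bounded (q : R -> R) (C : R) :=
  [/\ measurable_fun (D : set RL) q, 0 <= C & {ae mu, forall x, D x -> `|q x| <= C}].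

Section Mulq.
Implicit Types y z : L2fun.
Variables (q : R -> R) (C : R).
Hypothesis qC : ess_bounded q C.

Lemma mulq_int y : (\int[mu]_(x in D) ((q x * y x) ^+ 2)%:E <= ((C * nrm ip y) ^+ 2)%:E)%E.
Proof.
have [mq C0 qle] := qC.
have -> : (((C * nrm ip y) ^+ 2)%:E = \int[mu]_(x in D) ((C *: y) x ^+ 2)%:E)%E.
  by rewrite -square_nrmE nrmZ ger0_norm.
apply: ae_ge0_le_integral => //.
- by move=> x _; rewrite lee_fin sqr_ge0.
- by apply/measurable_EFinP; apply: measurable_funX; apply: measurable_funM.
- by move=> x _; rewrite lee_fin sqr_ge0.
- by apply/measurable_EFinP; apply: measurable_funX.
apply: ae_mono qle => x /[apply] h; rewrite lee_fin L2funZ !exprMn ler_wpM2r ?sqr_ge0 //.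
by rewrite -[q x ^+ 2]real_normK ?num_real // lerXn2r // nnegrE.
Qed.

Lemma square_integrable_mulq y : square_integrable (fun x => q x * y x).
Proof.
have [mq C0 qle] := qC; split; first exact: measurable_funM.
apply/integrableP; split.
  by apply/measurable_EFinP; apply: measurable_funX; apply: measurable_funM.
under eq_integral => x _ do rewrite gee0_abs ?lee_fin ?sqr_ge0 //.
by apply: le_lt_trans (mulq_int y) _; rewrite ltry.
Qed.

Lemma mulqE y x : D x -> mulq q y x = q x * y x.
Proof. by move=> Dx; rewrite (toL2E (square_integrable_mulq y) Dx). Qed.

Lemma nrm_mulq y : nrm ip (mulq q y) <= C * nrm ip y.
Proof.
have [mq C0 qle] := qC.
have := @toL2_nrmB_le R (fun x => q x * y x) 0 (C * nrm ip y) (mulr_ge0 C0 (nrm_ge0 _ _)) (square_integrable_mulq y).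
rewrite subr0; apply; apply: le_trans (mulq_int y).
by rewrite le_eqVlt; apply/orP; left; apply/eqP; apply: eq_integral => x _; rewrite subr0.
Qed.

Lemma mulqC y z : ip (mulq q y) z = ip y (mulq q z).
Proof.
by rewrite !L2ipE; apply: eq_Rintegral => x /[!inE] Dx; rewrite !mulqE //; ring.
Qed.

Lemma mulq_ge c y : {ae mu, forall x, D x -> - c <= q x} ->
  - c * nrm ip y ^+ 2 <= ip (mulq q y) y.
Proof.
move=> qc; rewrite sqr_nrm -subr_ge0 -ipZl -ipBl.
have -> : ip (mulq q y - - c *: y) y =
    \int[mu]_(x in D) `|((mulq q y - - c *: y) x * y x)|.
  rewrite L2ipE; congr fine; apply: ae_eq_integral => //.
  - by apply/measurable_EFinP; apply: measurable_funM.
  - by apply/measurable_EFinP; apply: measurableT_comp => //; apply: measurable_funM.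
  apply: ae_mono qc => x /[swap] Dx /(_ Dx) h; congr EFin.
  rewrite ger0_norm // L2funB L2funZ mulqE // -mulrBl -mulrA -expr2.
  by rewrite mulr_ge0 ?sqr_ge0 // subr_ge0.
exact: Rintegral_ge0.
Qed.

End Mulq.
End Flux.

(** * Inverses of operators given by a quadratic form *)

Lemma sqr_le {R : realType} (x y : R) : 0 <= x -> x <= y -> x ^+ 2 <= y ^+ 2.
Proof. by move=> x0 xy; rewrite lerXn2r // nnegrE // (le_trans x0). Qed.

Section FormInverse.
Context {R : realType} {V : lmodType R} (b : semi_ip V).
Variables (T Tadj : V -> V).
Hypothesis cb : complete_nrm b.
Hypothesis T_adj : forall x y, b (T x) y = b x (Tadj y).
Hypothesis T_le : forall x, nrm b (T x) <= nrm b x.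
Hypothesis T_dense : forall f, (forall k, b f (T k) = 0) -> nrm b f = 0.

(** A symmetric perturbation bounded below by [- 1/2]; as [T] is a contraction, the
form [b h k + b (M (T h)) (T k)] then dominates half of [b]. *)
Record form_potential (M : V -> V) : Prop := FormPotential {
  pot_sym : forall x y, b (M x) y = b x (M y);
  pot_bound : exists2 C, 0 <= C & forall x, nrm b (M x) <= C * nrm b x;
  pot_ge : forall x, - 2^-1 * nrm b x ^+ 2 <= b (M x) x }.

(** For [T] the primitive with Dirichlet conditions and [M] the multiplication by
[q], this says that [T h] solves [- y'' + q y = f] weakly, [h] being [y']. *)
Definition weak_form (M : V -> V) (f h : V) :=
  forall k, b h k + b (M (T h)) (T k) = b f (T k).

Definition form_inverse (M : V -> V) (f : V) : V := T (xget 0 [set h | weak_form M f h]).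

Lemma T_lin a x y z : b (T (a *: x + y)) z = a * b (T x) z + b (T y) z.
Proof. by rewrite !T_adj ipPl. Qed.

Section Potential.
Variable (M : V -> V).
Hypothesis MP : form_potential M.

Lemma form_coercive h : 2^-1 * nrm b h ^+ 2 <= b h h + b (M (T h)) (T h).
Proof.
have := pot_ge MP (T h); rewrite -sqr_nrm.
have : nrm b (T h) ^+ 2 <= nrm b h ^+ 2 by rewrite lerXn2r ?nnegrE ?nrm_ge0.
move: (nrm b (T h) ^+ 2) (nrm b h ^+ 2) (b (M (T h)) (T h)) => x y z; lra.
Qed.

Definition energy_ip : semi_ip V.
Proof.
refine (@SemiIp R V (fun h k => b h k + b (M (T h)) (T k)) _ _ _).
- by move=> x y; rewrite (ipC b x y) (ipC b (M (T x))) (pot_sym MP).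
- move=> a x y z; rewrite ipPl !(pot_sym MP) T_lin; ring.
- move=> x; apply: le_trans (form_coercive x).
  by rewrite mulr_ge0 ?invr_ge0 // sqr_ge0.
Defined.

Lemma energy_ipE h k : energy_ip h k = b h k + b (M (T h)) (T k). Proof. by []. Qed.

Lemma nrm_le_energy h : nrm b h <= 2 * nrm energy_ip h.
Proof.
rewrite -(@ler_pXn2r _ 2) ?nnegrE ?mulr_ge0 ?nrm_ge0 // exprMn [X in _ <= _ * X]sqr_nrm energy_ipE.
by have := form_coercive h; have := sqr_ge0 (nrm b h); lra.
Qed.

Lemma energy_le_nrm : exists2 c, 0 < c & forall h, nrm energy_ip h <= c * nrm b h.
Proof.
have [c c0 hc] := pot_bound MP; exists (1 + c) => [|h]; first by lra.
apply: nrm_le; first by rewrite mulr_ge0 ?nrm_ge0 // addr_ge0.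
rewrite energy_ipE -sqr_nrm.
have h1 : b (M (T h)) (T h) <= c * nrm b h ^+ 2.
  apply: (le_trans (ip_le_nrm _ _ _)); rewrite expr2 mulrA ler_pM ?nrm_ge0 //.
  by rewrite (le_trans (hc _)) // ler_wpM2l.
have n0 := sqr_ge0 (nrm b h); rewrite exprMn; nra.
Qed.

Lemma energy_complete : complete_nrm energy_ip.
Proof.
move=> x cx; have [c c0 hc] := energy_le_nrm.
have [e e0|l hl] := cb (x := x).
  have [N hN] := cx _ (divr_gt0 e0 (ltr0Sn R 1)).
  exists N => m n Nm Nn; apply: (le_trans (nrm_le_energy _)).
  by rewrite mulrC -ler_pdivlMr // hN.
exists l => e e0; have [N hN] := hl _ (divr_gt0 e0 c0).
exists N => n Nn; apply: (le_trans (hc _)).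
by rewrite mulrC -ler_pdivlMr // hN.
Qed.

(** Riesz representation for the energy form, which is equivalent to [b]. *)
Lemma weak_form_exists f : exists h, weak_form M f h.
Proof.
have [||||h [hf _ _]] := riesz_closure (F := id) (b := energy_ip)
    (l := fun k => b f (T k)) (C := 2 * nrm b f) energy_complete.
- by move=> a x y z; rewrite ipPl.
- by move=> a x y; rewrite ipC T_lin !(ipC _ f).
- by rewrite mulr_ge0 ?nrm_ge0.
- move=> x; apply: (le_trans (ip_le_nrm _ _ _)).
  rewrite (mulrC 2) -mulrA ler_wpM2l ?nrm_ge0 //.
  by rewrite (le_trans (T_le _)) // nrm_le_energy.
by exists h.
Qed.

Lemma weak_form_unique f h h' : weak_form M f h -> weak_form M f h' -> nrm b (h - h') = 0.
Proof.
move=> hh hh'; apply/eqP; rewrite eq_le nrm_ge0 andbT.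
apply: (le_trans (nrm_le_energy _)); rewrite (_ : nrm energy_ip _ = 0) ?mulr0 //.
apply: ip0_nrm0 => k; rewrite (ipBl energy_ip) !energy_ipE hh hh' subrr //.
Qed.

Lemma weak_form_xget f : weak_form M f (xget 0 [set h | weak_form M f h]).
Proof. by have [h hh] := weak_form_exists f; apply: (@xgetPex _ 0 [set h | weak_form M f h]); exists h. Qed.

Lemma weak_form_inverse f h : weak_form M f h -> nrm b (T h - form_inverse M f) = 0.
Proof.
move=> hh; apply/eqP; rewrite eq_le nrm_ge0 andbT.
have e z : b (T h - form_inverse M f) z = b (T (h - xget 0 [set h | weak_form M f h])) z.
  by rewrite ipBl !T_adj ipBl.
rewrite (_ : nrm _ _ = nrm b (T (h - xget 0 [set h | weak_form M f h]))).
  by rewrite -(weak_form_unique hh (weak_form_xget f)) T_le.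
by apply: nrm0_eq; apply: ip0_nrm0 => z; rewrite ipBl e subrr.
Qed.

(** The constant 2 comes from coercivity with constant 1/2. Injectivity uses that
the range of [T] is dense: if the solution is null, so is its derivative, and
the weak form says that the right-hand side is orthogonal to the range. *)
Lemma form_inverse_op : inverse_op b (form_inverse M) 2.
Proof.
split => [x y||x|x]; rewrite ?ler1n //.
- have := weak_form_xget x (xget 0 [set h | weak_form M y h]).
  have := weak_form_xget y (xget 0 [set h | weak_form M x h]).
  rewrite /form_inverse (ipC b (T _) y) => <- <-.
  by rewrite !(pot_sym MP) !(ipC b _ (xget 0 [set h | weak_form M x h])) (ipC b (T _) (M _)) (pot_sym MP).
- apply: (le_trans (T_le _)); set h := xget _ _.
  have := weak_form_xget x h; have := form_coercive h; rewrite -/h => h1 h2.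
  have h3 : b x (T h) <= nrm b x * nrm b h.
    by rewrite (le_trans (ip_le_nrm _ _ _)) // ler_wpM2l ?nrm_ge0.
  have [->|n0] := eqVneq (nrm b h) 0; first by rewrite mulr_ge0 ?nrm_ge0.
  have np : 0 < nrm b h by rewrite lt_neqAle eq_sym n0 nrm_ge0.
  rewrite -(@ler_pM2r _ (nrm b h)) // -expr2; lra.
move=> Kx; set h := xget 0 [set h | weak_form M x h] in Kx.
have hh : weak_form M x h := weak_form_xget x.
have M0 z : b (M (T h)) z = 0 by rewrite (pot_sym MP) nrm0_ipl.
have h0 : nrm b h = 0.
  by rewrite /nrm -[b h h]addr0 -[X in _ + X](M0 (T h)) hh ipC nrm0_ipl // sqrtr0.
by apply: T_dense => k; rewrite -hh M0 addr0 nrm0_ipl.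
Qed.
End Potential.

(** Moving the difference of the two potentials to the right-hand side. *)
Lemma form_op_close M1 M2 Q kappa : form_potential M1 -> form_potential M2 ->
  (forall x, nrm b (Q x) <= kappa * nrm b x) ->
  (forall x z, b (Q x) z = b (M1 x) z - b (M2 x) z) ->
  op_close b (form_inverse M1) (form_inverse M2) kappa.
Proof.
move=> P1 P2 Qle QE; exists Q; split => // g.
  rewrite nrmBC; have := weak_form_xget P2 g; set h := xget _ _ => hh.
  rewrite nrmBC; apply: (weak_form_inverse P1) => k.
  by rewrite ipDl QE -(hh k) /form_inverse -/h; ring.
have := weak_form_xget P1 g; set h := xget _ _ => hh.
apply: (weak_form_inverse P2) => k.
by rewrite ipBl QE -(hh k) /form_inverse -/h; ring.
Qed.

End FormInverse.

Section Product.
Context {R : realType} {V : lmodType R} (b : semi_ip V).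
Local Notation W := (V * V)%type.

Definition prod_ip : semi_ip W.
Proof.
refine (@SemiIp R W (fun x y => b x.1 y.1 + b x.2 y.2) _ _ _).
- by move=> x y; rewrite ipC [b x.2 _]ipC.
- by move=> a x y z; rewrite /= !ipDl !ipZl; ring.
- by move=> x; rewrite addr_ge0 ?ip_ge0.
Defined.

Lemma prod_ipE x y : prod_ip x y = b x.1 y.1 + b x.2 y.2. Proof. by []. Qed.

Lemma prod_nrmE x : nrm prod_ip x ^+ 2 = nrm b x.1 ^+ 2 + nrm b x.2 ^+ 2.
Proof. by rewrite !sqr_nrm. Qed.

Lemma prod_nrm_le x c : 0 <= c -> nrm b x.1 <= c / 2 -> nrm b x.2 <= c / 2 ->
  nrm prod_ip x <= c.
Proof.
move=> c0 h1 h2; apply: nrm_le => //; rewrite prod_ipE -!sqr_nrm.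
have := nrm_ge0 b x.1; have := nrm_ge0 b x.2.
move: (nrm b x.1) (nrm b x.2) h1 h2 => p q *; nra.
Qed.

Lemma prod_nrm_fst x : nrm b x.1 <= nrm prod_ip x.
Proof.
rewrite -(@ler_pXn2r _ 2) ?nnegrE ?nrm_ge0 // prod_nrmE lerDl sqr_ge0 //.
Qed.

Lemma prod_nrm_snd x : nrm b x.2 <= nrm prod_ip x.
Proof.
rewrite -(@ler_pXn2r _ 2) ?nnegrE ?nrm_ge0 // prod_nrmE lerDr sqr_ge0 //.
Qed.

Lemma prod_nrm0 x : nrm prod_ip x = 0 <-> nrm b x.1 = 0 /\ nrm b x.2 = 0.
Proof.
split=> [h|[h1 h2]].
  by split; apply/eqP; rewrite eq_le nrm_ge0 andbT -h ?prod_nrm_fst ?prod_nrm_snd.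
by apply/eqP; rewrite -sqrf_eq0 prod_nrmE h1 h2 expr0n addr0.
Qed.

Lemma prod_complete : complete_nrm b -> complete_nrm prod_ip.
Proof.
move=> cb x cx.
have [e e0|l1 h1] := cb (fun n => (x n).1).
  have [N hN] := cx _ e0; exists N => m n Nm Nn.
  exact: le_trans (prod_nrm_fst (x m - x n)) (hN _ _ Nm Nn).
have [e e0|l2 h2] := cb (fun n => (x n).2).
  have [N hN] := cx _ e0; exists N => m n Nm Nn.
  exact: le_trans (prod_nrm_snd (x m - x n)) (hN _ _ Nm Nn).
exists (l1, l2) => e e0; have e2 := divr_gt0 e0 (ltr0Sn R 1).
have [N hN] := h1 _ e2; have [M hM] := h2 _ e2; exists (maxn N M) => n.
rewrite geq_max => /andP[Nn Mn].
by apply: prod_nrm_le; [exact: ltW|exact: hN|exact: hM].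
Qed.

(** Multiplication by i, for [(x, y)] read as [x + i y]. *)
Definition rot_prod (x : W) : W := (- x.2, x.1).

Lemma rot_prodP : rotation prod_ip rot_prod.
Proof.
split=> [x y|x y|x y]; rewrite ?prod_ipE /=.
- by rewrite !ipE; ring.
- by rewrite !ipE; ring.
- by rewrite /rot_prod; congr pair; rewrite /= opprD.
Qed.

Definition prod_map (K : V -> V) (x : W) : W := (K x.1, K x.2).

Lemma prod_inverse_op K C : inverse_op b K C -> inverse_op prod_ip (prod_map K) C.
Proof.
move=> Kop; have C1 := op_bound_ge1 Kop; split => //.
- by move=> x y; rewrite !prod_ipE !(op_sym Kop).
- move=> x; have C0 : 0 <= C by lra.
  rewrite -(@ler_pXn2r _ 2) ?nnegrE ?mulr_ge0 ?nrm_ge0 // exprMn !prod_nrmE mulrDr.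
  have h z : nrm b (K z) ^+ 2 <= (C * nrm b z) ^+ 2.
    by apply: sqr_le; [exact: nrm_ge0|exact: (op_bound Kop)].
  by rewrite -!exprMn; apply: lerD; [exact: (h x.1)|exact: (h x.2)].
move=> x /prod_nrm0[/(op_inj Kop) h1 /(op_inj Kop) h2]; exact/prod_nrm0.
Qed.

Lemma prod_commutes K C : inverse_op b K C -> commutes_rot prod_ip rot_prod (prod_map K).
Proof.
move=> Kop x; apply: ip0_nrm0 => y; rewrite ipBl !prod_ipE /=.
by rewrite (op_sym Kop (- x.2)) !ipNl (op_sym Kop x.2) subrr.
Qed.

Definition conj_prod (x : W) : W := (x.1, - x.2).

Lemma nrm_conj_prod x : nrm prod_ip (conj_prod x) = nrm prod_ip x.
Proof. by rewrite /nrm !prod_ipE /= ipNl ipNr opprK. Qed.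

Lemma conj_prodB x y : conj_prod (x - y) = conj_prod x - conj_prod y.
Proof. by rewrite /conj_prod; congr pair; rewrite /= opprD. Qed.

Lemma conj_prodK x : conj_prod (conj_prod x) = x.
Proof. by case: x => x y; rewrite /conj_prod /= opprK. Qed.

Lemma prod_map_conj K C x : inverse_op b K C ->
  nrm prod_ip (conj_prod (prod_map K x) - prod_map K (conj_prod x)) = 0.
Proof.
move=> Kop; apply/prod_nrm0; split; rewrite /=; first by rewrite subrr nrm0.
by apply: ip0_nrm0 => z; rewrite ipBl ipNl !(op_sym Kop) ipNl subrr.
Qed.

Lemma prod_op_close K1 K2 kappa : 0 <= kappa -> op_close b K1 K2 kappa ->
  op_close prod_ip (prod_map K1) (prod_map K2) kappa.
Proof.
move=> k0 [Q [Qle h1 h2]]; exists (prod_map Q); split=> x.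
- rewrite -(@ler_pXn2r _ 2) ?nnegrE ?mulr_ge0 ?nrm_ge0 // exprMn !prod_nrmE mulrDr.
  have h z : nrm b (Q z) ^+ 2 <= (kappa * nrm b z) ^+ 2.
    by apply: sqr_le; [exact: nrm_ge0|exact: Qle].
  by rewrite -!exprMn; apply: lerD; [exact: (h x.1)|exact: (h x.2)].
- by apply/prod_nrm0; split; exact: h1.
- by apply/prod_nrm0; split; exact: h2.
Qed.

End Product.

(** * The inverse of the Sturm-Liouville operator *)

Section SturmLiouville.
Context {R : realType}.
Local Notation mu := (@lebesgue_measure R).
Local Notation RL := (measurableTypeR R).
Local Notation D := (@unit_itv R).
Local Notation ip := (@L2ip R).
Local Notation L2fun := (@L2fun R).
Local Notation T := (@dirichlet_prim R).
Hint Resolve mD muD_lty measurable_L2fun : core.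
Implicit Types f g h k : L2fun.

(** The lower bound is that of [form_potential]; it is satisfied by all
potentials that are uniformly close to a nonnegative one. *)
Definition potential (q : R -> R) := (exists C, ess_bounded q C) /\
  {ae mu, forall x, D x -> - 2^-1 <= q x}.

Lemma potential_form q : potential q -> form_potential ip (mulq q).
Proof.
move=> [[C qC] qge]; split; [exact: mulqC qC| |by move=> x; apply: (mulq_ge qC)].
by exists C; [case: qC|exact: nrm_mulq qC].
Qed.

Lemma sl_inv_exists (q : R -> R) :
  {K : L2fun -> L2fun | K = form_inverse ip T (mulq q)}.
Proof. by exists (form_inverse ip T (mulq q)). Qed.
Definition sl_inv (q : R -> R) : L2fun -> L2fun := projT1 (sl_inv_exists q).
Lemma sl_invE q : sl_inv q = form_inverse ip T (mulq q).
Proof. exact: (projT2 (sl_inv_exists q)). Qed.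

Lemma T_adj x y : ip (T x) y = ip x (- meanfree (volt y)).
Proof. by rewrite dirichlet_prim_ip (ipNr ip). Qed.

Lemma sl_inv_op q : potential q -> inverse_op ip (sl_inv q) 2.
Proof.
move=> /potential_form qP; rewrite sl_invE.
exact: (form_inverse_op (@L2_complete R) T_adj (@nrm_dirichlet_prim R) (@dirichlet_prim_dense R) qP).
Qed.

Lemma sl_inv_close q1 q2 kappa : potential q1 -> potential q2 ->
  ess_bounded (fun x => q1 x - q2 x) kappa -> op_close ip (sl_inv q1) (sl_inv q2) kappa.
Proof.
move=> p1 p2 q12; have [[C1 b1] _] := p1; have [[C2 b2] _] := p2.
rewrite !sl_invE; apply: (form_op_close (@L2_complete R) T_adj (@nrm_dirichlet_prim R)
  (potential_form p1) (potential_form p2) (Q := mulq (fun x => q1 x - q2 x))).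
  exact: nrm_mulq q12.
move=> x z; rewrite -ipBl; apply: L2ip_ae; apply: aeW => t Dt.
by rewrite L2funB (mulqE q12) // (mulqE b1) // (mulqE b2) // mulrBl.
Qed.

Lemma square_integrable_eq (f g : R -> R) : (forall x, D x -> f x = g x) ->
  square_integrable f -> square_integrable g.
Proof.
move=> fg [mf sf]; split.
  by apply: eq_measurable_fun mf => x /[!inE] Dx; exact: fg.
by apply: eq_integrable sf => // x /[!inE] Dx; rewrite fg.
Qed.

Lemma square_integrable_integrable_cc (f : R -> R) :
  measurable_fun (`[0, 1]%classic : set RL) f -> square_integrable f ->
  mu.-integrable `[0, 1] (fun x => (f x)%:E).
Proof.
move=> mf sf; apply: integrable_unit_cc; first exact/measurable_EFinP.
apply: eq_integrable (integrable1_L2fun (toL2 f)) => // x /[!inE] Dx.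
by rewrite (toL2E sf Dx).
Qed.

Lemma prim1 f : prim f 1 = ip f one2.
Proof.
rewrite L2ip1 prim_unit ?ler01 ?lexx //; last exact: integrable_L2fun_cc.
apply: eq_Rintegral => t; rewrite inE in_unit => /andP[_ /ltW ->] //.
Qed.

Lemma toL2_ae (f : R -> R) : square_integrable f -> {ae mu, forall x, D x -> f x = toL2 f x}.
Proof. by move=> sf; apply: aeW => x Dx; rewrite (toL2E sf Dx). Qed.

Lemma dirichlet_primE h x : ip h one2 = 0 -> D x -> T h x = prim h x.
Proof.
move=> h0 Dx; rewrite (voltE _ Dx); congr (prim _ x).
by apply/funext => t; rewrite /meanfree h0 L2funB L2funZ mul0r subr0.
Qed.

(** Integration by parts: with [w = y''], the boundary conditions on [y] make [y']
orthogonal to constants, so [y = T y'], and [y' = const + volt w] is tested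
against [k] through the adjoint of [T]. *)
Lemma strong_to_weak q f (y y' w : R -> R) : potential q ->
  mu.-integrable `[0, 1] (fun x => (w x)%:E) -> square_integrable w ->
  mu.-integrable `[0, 1] (fun x => (y' x)%:E) ->
  (forall x, 0 <= x -> x <= 1 -> y' x = y' 0 + prim w x) ->
  (forall x, 0 <= x -> x <= 1 -> y x = prim y' x) -> y 1 = 0 ->
  {ae mu, forall x, D x -> f x = - w x + q x * y x} ->
  {ae mu, forall x, D x -> y x = sl_inv q f x}.
Proof.
move=> qP wi sw y'i y'E yE y1 fE; have [[C qC] _] := qP.
pose W : L2fun := toL2 w.
have wW x : 0 <= x -> x <= 1 -> prim w x = prim W x.
  move=> x0 x1; apply: eq_prim => //; first exact: integrable_L2fun_cc.
  exact: toL2_ae.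
have sy' : square_integrable y'.
  apply: (@square_integrable_eq (fun x => cst (y' 0) x + prim W x)).
    by move=> x; rewrite in_unit => /andP[/ltW x0 /ltW x1]; rewrite [RHS]y'E // wW.
  by apply: square_integrableD; [exact: square_integrable_cst|exact: square_integrable_prim].
pose h : L2fun := toL2 y'.
have hy x : 0 <= x -> x <= 1 -> prim h x = y x.
  move=> x0 x1; rewrite yE //; apply/esym; apply: eq_prim => //.
    exact: integrable_L2fun_cc.
  exact: toL2_ae.
have h1 : ip h one2 = 0 by rewrite -prim1 hy ?ler01.
have Th x : D x -> T h x = y x.
  move=> Dx; rewrite dirichlet_primE //; move: Dx; rewrite in_unit => /andP[/ltW ? /ltW ?].
  exact: hy.
have hk k : ip h k = - ip W (T k).
  have -> : ip h k = ip h (meanfree k) by rewrite /meanfree (ipBr ip) (ipZr ip) h1 mulr0 subr0.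
  rewrite (@L2ip_ae _ h (y' 0 *: one2 + volt W)).
    rewrite (ipPl ip) -!meanfree_ip (ipC ip (meanfree one2)) -meanfree_ip (ipC ip (meanfree k)).
    rewrite (ipC ip W) T_adj (ipNr ip) opprK (ipC ip k).
    rewrite (_ : ip one2 (meanfree k) = 0) ?mulr0 ?add0r //.
    by rewrite (ipC ip) meanfree_one2.
  apply: aeW => x Dx; have := Dx; rewrite in_unit => /andP[/ltW x0 /ltW x1].
  by rewrite (toL2E sy' Dx) L2funD L2funZ (one2E Dx) (voltE _ Dx) mulr1 y'E // wW.
have wf : weak_form ip T (mulq q) f h.
  move=> k; rewrite hk -(ipNl ip) -(ipDl ip); apply/esym; apply: L2ip_ae.
  apply: ae_mono fE => x /[swap] Dx /(_ Dx) ->.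
  by rewrite L2funD L2funN (toL2E sw Dx) (mulqE qC _ Dx) Th.
have /nrm_aeB := weak_form_inverse (@L2_complete R) T_adj (@nrm_dirichlet_prim R) (potential_form qP) wf.
by rewrite -sl_invE; apply: ae_mono => x /[swap] Dx /(_ Dx) <-; rewrite Th.
Qed.

(** Elliptic regularity. The weak form says that [h] is the mean free part of the
primitive of [w = q y - f]; this primitive is the continuous representative of
[y'], and its primitive that of [y]. *)
Lemma weak_to_strong q f : potential q -> exists (y y' : R -> R) (w : L2fun),
  [/\ mu.-integrable `[0, 1] (fun x => (y' x)%:E),
      forall x, 0 <= x -> x <= 1 -> y' x = y' 0 + prim w x,
      forall x, 0 <= x -> x <= 1 -> y x = prim y' x &
      [/\ y 0 = 0, y 1 = 0, forall x, D x -> y x = sl_inv q f x &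
      forall x, D x -> f x = - w x + q x * sl_inv q f x]].
Proof.
move=> qP; have [[C qC] _] := qP.
pose w : L2fun := mulq q (sl_inv q f) - f.
(* subtracting the mean of the primitive makes y vanish at 1 *)
pose c0 := ip (volt w) one2.
pose y' x := prim w x - c0.
pose h : L2fun := xget 0 [set h | weak_form ip T (mulq q) f h].
have hh : weak_form ip T (mulq q) f h.
  exact: (weak_form_xget (@L2_complete R) T_adj (@nrm_dirichlet_prim R) (potential_form qP)).
have y'D x : D x -> y' x = meanfree (volt w) x.
  by move=> Dx; rewrite /y' L2funB L2funZ (one2E Dx) mulr1 (voltE _ Dx).
have hw : {ae mu, forall x, D x -> h x = meanfree (volt w) x}.
  apply/nrm_aeB; apply: ip0_nrm0 => k; rewrite (ipBl ip).
  have := hh k; move=> hk.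
  have -> : ip (meanfree (volt w)) k = - ip w (T k).
    by rewrite (ipC ip w) T_adj (ipNr ip) opprK (ipC ip k).
  have -> : ip w (T k) = ip (mulq q (sl_inv q f)) (T k) - ip f (T k) by rewrite /w (ipBl ip).
  rewrite -hk sl_invE /form_inverse -/h; move: (ip h k) (ip _ (T k)) => a c; lra.
have sy' : square_integrable y'.
  apply: square_integrable_eq (square_integrable_L2 (meanfree (volt w))) => x Dx.
  by rewrite y'D.
have my' : measurable_fun (`[0, 1]%classic : set RL) y'.
  by apply: measurable_funB => //; apply: measurable_prim; exact: integrable_L2fun_cc.
have iy' := square_integrable_integrable_cc my' sy'.
have hy' x : 0 <= x -> x <= 1 -> prim y' x = prim h x.
  move=> x0 x1; apply: eq_prim => //; first exact: integrable_L2fun_cc.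
  by apply: ae_mono hw => t /[swap] Dt /(_ Dt) ->; rewrite y'D.
have h1 : ip h one2 = 0 by rewrite (L2ip_ae _ hw) meanfree_one2.
exists (prim y'), y', w; split => //.
- by move=> x x0 x1; rewrite /y' prim0 sub0r addrC.
- split.
  + exact: prim0.
  + by rewrite hy' ?ler01 // prim1.
  + move=> x Dx; rewrite sl_invE /form_inverse -/h dirichlet_primE //.
    by move: Dx; rewrite in_unit => /andP[/ltW x0 /ltW x1]; rewrite hy'.
  + move=> x Dx; rewrite L2funB (mulqE qC _ Dx); ring.
Qed.

End SturmLiouville.

(** * Complex L^2(0, 1) as pairs of real functions *)

Section ComplexL2.
Local Open Scope complex_scope.
Context {R : realType}.
Local Notation mu := (@lebesgue_measure R).
Local Notation RL := (measurableTypeR R).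
Local Notation D := (@unit_itv R).
Local Notation ip := (@L2ip R).
Local Notation L2fun := (@L2fun R).
Hint Resolve mD muD_lty measurable_L2fun : core.

Definition CL2 : lmodType R := (L2fun * L2fun)%type.
Definition Cip : semi_ip CL2 := prod_ip ip.
Local Notation J := (@rot_prod R L2fun).
Local Notation Cnrm := (nrm Cip).

Definition toCL2 (f : R -> R[i]) : CL2 :=
  (toL2 (fun x => complex.Re (f x)), toL2 (fun x => complex.Im (f x))).
Definition ofCL2 (w : CL2) : R -> R[i] := fun x => w.1 x +i* w.2 x.

Lemma L2norm_poweR (f : R -> R[i]) :
  L2norm f = ((\int[mu]_(x in D) (complex.Re (f x) ^+ 2 + complex.Im (f x) ^+ 2)%:E) `^ 2^-1)%E.
Proof.
rewrite /L2norm /Lpnorm unlock; congr (_ `^ _)%E.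
rewrite [RHS]integral_mkcond; apply: eq_integral => x _.
rewrite !patchE; case: ifP => _ /=.
  case: (f x) => r i /=; rewrite powR_mulrn ?ger0_norm ?sqrtr_ge0 //.
  by rewrite sqr_sqrtr // addr_ge0 ?sqr_ge0.
by rewrite normr0 powR0 // pnatr_eq0.
Qed.

Lemma L2_square_integrable (f : R -> R[i]) : L2 f <->
  square_integrable (fun x => complex.Re (f x)) /\ square_integrable (fun x => complex.Im (f x)).
Proof.
split=> [[mr mi]|[sr si]].
  rewrite L2norm_poweR => h.
  have m2 : measurable_fun (D : set RL) (fun x => (complex.Re (f x) ^+ 2 + complex.Im (f x) ^+ 2)%:E).
    by apply/measurable_EFinP; apply: measurable_funD; apply: measurable_funX.
  have i2 : mu.-integrable D (fun x => (complex.Re (f x) ^+ 2 + complex.Im (f x) ^+ 2)%:E).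
    apply/integrableP; split => //.
    under eq_integral => x _ do rewrite gee0_abs ?lee_fin ?addr_ge0 ?sqr_ge0 //.
    by apply: lty_poweRy h; rewrite invr_neq0 // pnatr_eq0.
  split; split => //; apply: le_integrable i2 => //.
  - by apply/measurable_EFinP; apply: measurable_funX.
  - by move=> x _; rewrite /= lee_fin !ger0_norm ?addr_ge0 ?sqr_ge0 // lerDl sqr_ge0.
  - by apply/measurable_EFinP; apply: measurable_funX.
  - by move=> x _; rewrite /= lee_fin !ger0_norm ?addr_ge0 ?sqr_ge0 // lerDr sqr_ge0.
split; [exact: sr.1|exact: si.1|rewrite L2norm_poweR].
apply: poweR_lty; under eq_integral => x _ do rewrite EFinD.
rewrite integralD //; [|exact: sr.2|exact: si.2].
by apply: lte_add_pinfty; apply: integrable_lty => //; [exact: sr.2|exact: si.2].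
Qed.

Lemma toCL2_fst f x : L2 f -> D x -> (toCL2 f).1 x = complex.Re (f x).
Proof. by move=> /L2_square_integrable[sr _] Dx; rewrite (toL2E sr Dx). Qed.
Lemma toCL2_snd f x : L2 f -> D x -> (toCL2 f).2 x = complex.Im (f x).
Proof. by move=> /L2_square_integrable[_ si] Dx; rewrite (toL2E si Dx). Qed.

Lemma L2_ofCL2 w : L2 (ofCL2 w).
Proof. by apply/L2_square_integrable; split; exact: square_integrable_L2. Qed.

Lemma L2normE (f : R -> R[i]) : L2 f -> L2norm f = (Cnrm (toCL2 f))%:E.
Proof.
move=> Lf; rewrite L2norm_poweR.
have -> : (\int[mu]_(x in D) (complex.Re (f x) ^+ 2 + complex.Im (f x) ^+ 2)%:E =
    (Cnrm (toCL2 f) ^+ 2)%:E)%E.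
  rewrite prod_nrmE EFinD !square_nrmE -integralD //; last 2 first.
  - exact: (square_integrable_L2 _).2.
  - exact: (square_integrable_L2 _).2.
  apply: eq_integral => x /[!inE] Dx; rewrite toCL2_fst // toCL2_snd //.
rewrite poweR_EFin; congr EFin; rewrite -(powR_mulrn 2 (nrm_ge0 _ _)) -powRrM.
by rewrite mulfV ?pnatr_eq0 // powRr1 // nrm_ge0.
Qed.

Lemma ae_eq01E f g : L2 f -> L2 g ->
  ae_eq01 f g <-> Cnrm (toCL2 f - toCL2 g) = 0.
Proof.
move=> Lf Lg; rewrite prod_nrm0 !nrm_aeB; split => [fg|[h1 h2]].
  by split; apply: ae_mono fg => x /[swap] Dx /(_ Dx) fg;
    rewrite ?(toCL2_fst Lf Dx, toCL2_fst Lg Dx, toCL2_snd Lf Dx, toCL2_snd Lg Dx) fg.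
apply: ae_mono2 h1 h2 => x /[swap] h2 /[swap] Dx /(_ Dx); move: (h2 Dx).
rewrite (toCL2_fst Lf Dx) (toCL2_fst Lg Dx) (toCL2_snd Lf Dx) (toCL2_snd Lg Dx).
by case: (f x) => a b; case: (g x) => c d /= -> ->.
Qed.

Lemma L2_sub (f g : R -> R[i]) : L2 f -> L2 g -> L2 (fun x => f x - g x) /\
  Cnrm (toCL2 (fun x => f x - g x) - (toCL2 f - toCL2 g)) = 0.
Proof.
move=> Lf Lg.
have Lfg : L2 (fun x => f x - g x).
  move: (Lf) (Lg) => /L2_square_integrable[f1 f2] /L2_square_integrable[g1 g2].
  apply/L2_square_integrable; split.
    apply: square_integrable_eq (square_integrableD f1 (square_integrableZ (-1) g1)) => x _.
    by case: (f x) => a b; case: (g x) => c d /=; rewrite mulN1r.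
  apply: square_integrable_eq (square_integrableD f2 (square_integrableZ (-1) g2)) => x _.
  by case: (f x) => a b; case: (g x) => c d /=; rewrite mulN1r.
split => //; apply/prod_nrm0; split; apply/nrm_aeB; apply: aeW => x Dx.
  rewrite (toCL2_fst Lfg Dx) L2funB (toCL2_fst Lf Dx) (toCL2_fst Lg Dx).
  by case: (f x) => a b; case: (g x) => c d.
rewrite (toCL2_snd Lfg Dx) L2funB (toCL2_snd Lf Dx) (toCL2_snd Lg Dx).
by case: (f x) => a b; case: (g x) => c d.
Qed.

Lemma L2norm_sub (f g : R -> R[i]) : L2 f -> L2 g ->
  L2norm (fun x => f x - g x) = (Cnrm (toCL2 f - toCL2 g))%:E.
Proof.
move=> Lf Lg; have [Lfg e] := L2_sub Lf Lg.
by rewrite L2normE // (nrm0_eq e).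
Qed.

Definition conjC2 : CL2 -> CL2 := @conj_prod R L2fun.

(** The pairing is bilinear, so the second argument is conjugated to express it by
the real inner product. *)
Lemma pairingE f phi : L2 f -> L2 phi -> pairing f phi =
  Cip (toCL2 f) (conjC2 (toCL2 phi)) +i* Cip (toCL2 f) (J (conjC2 (toCL2 phi))).
Proof.
move=> Lf Lp; rewrite /pairing /cintegral /Cip !prod_ipE /= !opprK.
move: (Lf) (Lp) => /L2_square_integrable[f1 f2] /L2_square_integrable[p1 p2].
have toI (u v : R -> R) : square_integrable u -> square_integrable v ->
    ip (toL2 u) (toL2 v) = \int[mu]_(x in D) (u x * v x).
  by move=> su sv; rewrite L2ipE; apply: eq_Rintegral => x /[!inE] Dx; rewrite !toL2E.
rewrite (ipNr ip) !toI // -RintegralB ?square_integrableM // -RintegralD ?square_integrableM //.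
congr (_ +i* _); apply: eq_Rintegral => x _; case: (f x) => a b; case: (phi x) => c d //=.
Qed.

End ComplexL2.

(** * The Sturm-Liouville graph and its test functions *)

Section Graph.
Local Open Scope complex_scope.
Context {R : realType}.
Local Notation mu := (@lebesgue_measure R).
Local Notation RL := (measurableTypeR R).
Local Notation D := (@unit_itv R).
Local Notation ip := (@L2ip R).
Local Notation J := (@rot_prod R (@L2fun R)).
Local Notation Cip := (@Cip R).
Local Notation CL2 := (@CL2 R).
Local Notation Cnrm := (nrm Cip).
Hint Resolve mD muD_lty measurable_L2fun : core.

Definition Csl_inv (q : R -> R) : CL2 -> CL2 := prod_map (sl_inv q).

Lemma Cip_complete : complete_nrm Cip.
Proof. exact/prod_complete/L2_complete. Qed.

Lemma Csl_inv_op q : potential q -> inverse_op Cip (Csl_inv q) 2.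
Proof. by move=> /sl_inv_op; exact: prod_inverse_op. Qed.

Lemma Csl_inv_J q : potential q -> commutes_rot Cip J (Csl_inv q).
Proof. by move=> /sl_inv_op; exact: prod_commutes. Qed.

Lemma Csl_inv_conj q w : potential q ->
  Cnrm (conjC2 (Csl_inv q w) - Csl_inv q (conjC2 w)) = 0.
Proof. by move=> /sl_inv_op; exact: prod_map_conj. Qed.

Lemma is_primitive_comp F g : is_primitive 0 1 F g ->
  [/\ mu.-integrable `[0, 1] (fun x => (complex.Re (g x))%:E),
      mu.-integrable `[0, 1] (fun x => (complex.Im (g x))%:E) &
      forall x, 0 <= x -> x <= 1 ->
        complex.Re (F x) = complex.Re (F 0) + prim (fun x => complex.Re (g x)) x /\
        complex.Im (F x) = complex.Im (F 0) + prim (fun x => complex.Im (g x)) x].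
Proof.
move=> [[gr gi] h]; split => // x x0 x1.
by rewrite h ?in_itv /= ?x0 //; case: (F 0).
Qed.

(** The coefficients of the operator are real, so the real and imaginary parts are
treated separately. *)
Lemma SL_graph_inv q f g : potential q -> SL_graph q f g ->
  [/\ L2 f, L2 g & Cnrm (toCL2 f - Csl_inv q (toCL2 g)) = 0].
Proof.
move=> qP [Lg [y [f'' [[Lf Lf'' fy [y' [/is_primitive_comp[y'r y'i yE] /is_primitive_comp[wr wi y'E]]]] y0 y1 gE]]]].
split => //; have /L2_square_integrable[sr si] := Lf''.
have fyg : {ae mu, forall x, D x -> g x = - f'' x + (q x)%:C * y x}.
  by apply: ae_mono2 fy gE => x h1 h2 Dx; rewrite h2 // h1.
apply/prod_nrm0; split; apply/nrm_aeB.
  have := @strong_to_weak R q (toCL2 g).1 (fun x => complex.Re (y x)) _ _ qP wr sr y'r.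
  move=> /(_ (fun x x0 x1 => (y'E x x0 x1).1)) H.
  have yE1 x : 0 <= x -> x <= 1 -> complex.Re (y x) = prim (fun x => complex.Re (y' x)) x.
    by move=> x0 x1; rewrite (yE x x0 x1).1 y0 add0r.
  have {}H := H yE1 (ltac:(by rewrite y1)).
  have {}H : {ae mu, forall x, D x -> complex.Re (y x) = sl_inv q (toCL2 g).1 x}.
    apply: H; apply: ae_mono fyg => x /[swap] Dx /(_ Dx) e; rewrite (toCL2_fst Lg Dx) e.
    by case: (f'' x) => a b; case: (y x) => c d /=; rewrite mul0r subr0.
  apply: ae_mono2 fy H => x h1 h2 Dx; rewrite (toCL2_fst Lf Dx) h1 //; exact: h2.
have := @strong_to_weak R q (toCL2 g).2 (fun x => complex.Im (y x)) _ _ qP wi si y'i.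
move=> /(_ (fun x x0 x1 => (y'E x x0 x1).2)) H.
have yE1 x : 0 <= x -> x <= 1 -> complex.Im (y x) = prim (fun x => complex.Im (y' x)) x.
  by move=> x0 x1; rewrite (yE x x0 x1).2 y0 add0r.
have {}H := H yE1 (ltac:(by rewrite y1)).
have {}H : {ae mu, forall x, D x -> complex.Im (y x) = sl_inv q (toCL2 g).2 x}.
  apply: H; apply: ae_mono fyg => x /[swap] Dx /(_ Dx) e; rewrite (toCL2_snd Lg Dx) e.
  by case: (f'' x) => a b; case: (y x) => c d /=; rewrite mul0r addr0.
apply: ae_mono2 fy H => x h1 h2 Dx; rewrite (toCL2_snd Lf Dx) h1 //; exact: h2.
Qed.

Lemma SL_graph_of_inv q f g : potential q -> L2 f -> L2 g ->
  Cnrm (toCL2 f - Csl_inv q (toCL2 g)) = 0 -> SL_graph q f g.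
Proof.
move=> qP Lf Lg /prod_nrm0[/nrm_aeB e1 /nrm_aeB e2]; split => //.
have [yr [yr' [wr [yr'i yr'E yrE [yr0 yr1 yrD gr]]]]] := weak_to_strong (toCL2 g).1 qP.
have [yi [yi' [wi [yi'i yi'E yiE [yi0 yi1 yiD gi]]]]] := weak_to_strong (toCL2 g).2 qP.
exists (fun x => yr x +i* yi x), (ofCL2 (wr, wi)).
have fy : ae_eq01 f (fun x => yr x +i* yi x).
  apply: ae_mono2 e1 e2 => x h1 h2 Dx.
  have h1' : complex.Re (f x) = sl_inv q (toCL2 g).1 x by rewrite -(toCL2_fst Lf Dx); exact: h1.
  have h2' : complex.Im (f x) = sl_inv q (toCL2 g).2 x by rewrite -(toCL2_snd Lf Dx); exact: h2.
  by rewrite (yrD x Dx) (yiD x Dx) -h1' -h2'; case: (f x).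
split; [split => //; first exact: L2_ofCL2| | |].
- exists (fun x => yr' x +i* yi' x); split; split => //.
  + move=> x; rewrite in_itv /= => /andP[x0 x1].
    by rewrite yrE // yiE // yr0 yi0 /cintegral /= -[RHS]/(_ +i* _) !add0r.
  + by split; exact: integrable_L2fun_cc.
  + move=> x; rewrite in_itv /= => /andP[x0 x1].
    by rewrite yr'E // yi'E.
- by rewrite yr0 yi0.
- by rewrite yr1 yi1.
apply: ae_mono fy => x /[swap] Dx /(_ Dx) ->.
have {}gr : complex.Re (g x) = - wr x + q x * yr x by rewrite -(toCL2_fst Lg Dx) yrD //; exact: gr.
have {}gi : complex.Im (g x) = - wi x + q x * yi x by rewrite -(toCL2_snd Lg Dx) yiD //; exact: gi.
apply/eqP; rewrite eq_complex gr gi; apply/andP; split; apply/eqP => /=.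
  by rewrite mul0r subr0.
by rewrite mul0r addr0.
Qed.

(** The pairing is bilinear: pairing with the conjugate of [w] is the inner product
with [w]. *)
Definition test_of (w : CL2) : R -> R[i] := ofCL2 (conjC2 w).

Lemma toCL2K w : Cnrm (toCL2 (ofCL2 w) - w) = 0.
Proof.
apply/prod_nrm0; split; apply/nrm_aeB; apply: aeW => x Dx.
  by rewrite (toCL2_fst (L2_ofCL2 w) Dx).
by rewrite (toCL2_snd (L2_ofCL2 w) Dx).
Qed.

Lemma SL_graph_test q v w : potential q -> Cnrm (v - Csl_inv q w) = 0 ->
  SL_graph q (test_of v) (test_of w).
Proof.
move=> qP vw; apply: SL_graph_of_inv => //; try exact: L2_ofCL2.
apply: null_trans (toCL2K _) _.
apply: (@null_trans _ _ Cip (conjC2 (Csl_inv q w))).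
  by rewrite -(conj_prodB v) nrm_conj_prod.
apply: null_trans (Csl_inv_conj w qP) _.
by apply: (op_null (Csl_inv_op qP)); rewrite nrmBC; exact: toCL2K.
Qed.

(** An infinite chain of preimages under the inverse is what it means to be in the
domain of every power of the operator. *)
Lemma SL_test_chain q (g : nat -> CL2) : potential q ->
  (forall m, Cnrm (Csl_inv q (g m.+1) - g m) = 0) -> forall m, SL_test q (test_of (g m)).
Proof.
move=> qP hg m n; elim: n m => [|n ih] m /=; first exact: L2_ofCL2.
exists (test_of (g m.+1)); split; last exact: ih.
by apply: SL_graph_test => //; rewrite nrmBC.
Qed.

(** Prepending [Csl_inv q (g 0)] to a chain starting near [psi] gives a test
function whose image under the operator approximates [psi]. *)
Lemma SL_test_dense q (psi : CL2) e : potential q -> 0 < e -> exists v w : CL2,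
  [/\ SL_test q (test_of v), SL_test q (test_of w), SL_graph q (test_of v) (test_of w),
      Cnrm (v - Csl_inv q w) = 0 & Cnrm (w - psi) <= e].
Proof.
move=> qP e0; have [g [g0 hg]] := mittag_leffler Cip_complete (Csl_inv_op qP) psi e0.
pose g' n := if n is n'.+1 then g n' else Csl_inv q (g 0%N).
have hg' m : Cnrm (Csl_inv q (g' m.+1) - g' m) = 0.
  by case: m => [|m] /=; [rewrite subrr nrm0|exact: hg].
exists (g' 0%N), (g' 1%N); split => //=.
- exact: (SL_test_chain qP hg' 0%N).
- exact: (SL_test_chain qP hg' 1%N).
- by apply: SL_graph_test => //; rewrite subrr nrm0.
- by rewrite subrr nrm0.
Qed.

Lemma pairing_test f w : L2 f ->
  pairing f (test_of w) = Cip (toCL2 f) w +i* Cip (toCL2 f) (J w).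
Proof.
move=> Lf; rewrite pairingE //; last exact: L2_ofCL2.
have e : Cnrm (conjC2 (toCL2 (test_of w)) - w) = 0.
  by rewrite -[X in _ - X]conj_prodK -(conj_prodB (toCL2 _)) nrm_conj_prod; exact: toCL2K.
congr (_ +i* _); rewrite ipC [RHS]ipC; apply: nrm0_ipB => //.
by rewrite -(rotB (rot_prodP ip)) (rot_isom (rot_prodP ip)).
Qed.

Lemma Re_pairing_test f w : L2 f -> complex.Re (pairing f (test_of w)) = Cip (toCL2 f) w.
Proof. by move=> Lf; rewrite pairing_test. Qed.

Lemma Im_pairing_test f w : L2 f -> complex.Im (pairing f (test_of w)) = Cip (toCL2 f) (J w).
Proof. by move=> Lf; rewrite pairing_test. Qed.

End Graph.

(** * Essential bounds and the clock of a coefficient *)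

Section Nets.
Context {R : realType}.
Local Notation mu := (@lebesgue_measure R).
Local Notation RL := (measurableTypeR R).

Lemma mu_setT_gt0 : (0 < mu [set: RL])%E.
Proof.
apply: (@lt_le_trans _ _ (mu (`[0, 1]%classic : set RL))).
  by rewrite lebesgue_measure_itv /= lte_fin ltr01 -EFinB subr0 lte_fin.
by apply: le_measure; rewrite ?inE.
Qed.

Lemma Lpnorm_oo_ae (A : set R) (f : R -> R) c : (Lpnorm +oo A f <= c%:E)%E ->
  {ae mu, forall x, A x -> `|f x| <= c}.
Proof.
rewrite /Lpnorm unlock mu_setT_gt0 => /ess_supP; apply: ae_mono => x /= h Ax.
by move: h; rewrite patchE mem_set // lee_fin.
Qed.

Lemma Linfty_bounded (A : set R) (f : R -> R) : Linfty A f ->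
  exists2 c, 0 <= c & {ae mu, forall x, A x -> `|f x| <= c}.
Proof.
move=> [_ fin]; have : (0 <= Lpnorm +oo A f)%E by exact: Lnorm_ge0.
case E : (Lpnorm +oo A f) => [c| |] //.
- by rewrite lee_fin => c0; exists c => //; apply: Lpnorm_oo_ae; rewrite E.
- by rewrite E in fin.
Qed.

Lemma cvg_right0 (F : R -> \bar R) : F e @[e --> 0^'+] --> 0%E ->
  forall eta, 0 < eta -> exists d, 0 < d /\ forall e, 0 < e -> e <= d -> (F e <= eta%:E)%E.
Proof.
move=> F0 eta eta0.
have : \forall e \near 0^'+, (F e < eta%:E)%E.
  apply: (F0 [set x | (x < eta%:E)%E]).
  by apply: open_nbhs_nbhs; split; [exact: open_ereal_lt_ereal|rewrite /= lte_fin].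
rewrite /at_right /within /= => /nbhs_ballP[d /= d0 h]; exists (d / 2).
split=> [|e e0 ed]; first exact: divr_gt0.
apply: ltW; apply: h => //=; rewrite /ball /= sub0r normrN gtr0_norm //.
by apply: le_lt_trans ed _; rewrite ltr_pdivrMr // ltr_pMr // ltr1n.
Qed.

Lemma cvg_right0_of (F : R -> \bar R) : (forall e, (0 <= F e)%E) ->
  (forall eta, 0 < eta -> exists d, 0 < d /\
    forall e, 0 < e -> e <= d -> (F e <= eta%:E)%E) ->
  F e @[e --> 0^'+] --> 0%E.
Proof.
move=> F0 h; apply/fine_cvgP.
have nearP (P : R -> Prop) d : 0 < d -> (forall e, 0 < e -> e <= d -> P e) ->
    \forall e \near 0^'+, P e.
  move=> d0 hP; rewrite /at_right /within /=; apply/nbhs_ballP; exists d => //= e.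
  rewrite /ball /= sub0r normrN => ed e0; apply: hP => //.
  by apply: ltW; apply: le_lt_trans ed; exact: ler_norm.
split.
  have [d [d0 hd]] := h 1 ltr01; apply: (nearP _ d d0) => e e0 ed.
  by rewrite ge0_fin_numE // (le_lt_trans (hd e e0 ed)) // ltry.
apply/cvgrPdist_le => eta eta0; have [d [d0 hd]] := h eta eta0.
apply: (nearP _ d d0) => e e0 ed; rewrite /= sub0r normrN.
have := hd e e0 ed; have := F0 e; case: (F e) => [x| |] //=.
by rewrite !lee_fin => x0 xe; rewrite ger0_norm.
Qed.

Lemma Rintegral_ae_le (A : set RL) (f : R -> R) M : measurable A -> (mu A < +oo)%E ->
  0 <= M -> measurable_fun A f -> {ae mu, forall x, A x -> `|f x| <= M} ->
  `|\int[mu]_(x in A) f x| <= M * fine (mu A).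
Proof.
move=> mA fA M0 mf fM.
have fi := bounded_integrable mA fA mf fM.
apply: (le_trans (le_normr_Rintegral mA fi)).
have mE : measurable_fun A (EFin \o f) by exact/measurable_EFinP.
have h : {ae mu, forall x, A x -> (`|(EFin \o f) x| <= M%:E)%E}.
  by apply: ae_mono fM => x /[apply] h; rewrite lee_fin.
have := integral_le_bound M%:E mA mE (ltac:(by rewrite lee_fin)) h => {}h.
have muA : mu A \is a fin_num by rewrite ge0_fin_numE.
rewrite -lee_fin EFinM /Rintegral !fineK //.
by apply: integrable_fin_num => //; exact: (integrable_abse fi).
Qed.

End Nets.

Section TimeIntegral.
Context {R : realType}.
Local Notation mu := (@lebesgue_measure R).
Local Notation RL := (measurableTypeR R).
Variables (T Abar : R) (a : R -> R).
Local Notation I := (`[0, T]%classic : set RL).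

Record coefficient : Prop := Coefficient {
  coef_ge0 : 0 <= Abar;
  coef_meas : measurable_fun I a;
  coef_ae : {ae mu, forall x, I x -> `|a x| <= Abar} }.
Hypothesis ha : coefficient.

Definition bounded_measurable (g : R -> R) :=
  measurable_fun I g /\ exists m, forall r, I r -> `|g r| <= m.

Definition time_integral (g : R -> R) (s t : R) : R := \int[mu]_(r in `]s, t]) (a r * g r).

Lemma itv_lty (s t : R) (b1 b2 : bool) :
  (mu [set` Interval (BSide b1 s) (BSide b2 t)] < +oo)%E.
Proof. by rewrite lebesgue_measure_itv /=; case: ifP => _; rewrite ?ltry // -EFinB ltry. Qed.

Lemma mu_oc (s t : R) : s <= t -> fine (mu (`]s, t]%classic : set RL)) = t - s.
Proof.
move=> st; rewrite lebesgue_measure_itv /= lte_fin; case: ltP => //= ts.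
by rewrite (_ : t = s) ?subrr //; apply/eqP; rewrite eq_le ts.
Qed.

Lemma time_integrable g : bounded_measurable g -> mu.-integrable I (fun r => (a r * g r)%:E).
Proof.
move=> [mg [m gm]]; apply: (@bounded_integrable _ _ _ (Abar * m)) => //.
- exact: itv_lty.
- by apply: measurable_funM => //; exact: coef_meas.
apply: ae_mono (coef_ae ha) => x /[swap] Ix /(_ Ix) h.
by rewrite normrM ler_pM // gm.
Qed.

Lemma sub_time s t : 0 <= s -> t <= T -> `]s, t]%classic `<=` I.
Proof. by move=> s0 tT; apply: subset_itv; rewrite bnd_simp. Qed.

Lemma time_integral_le g s t m : bounded_measurable g -> 0 <= s -> s <= t -> t <= T ->
  0 <= m -> (forall r, s <= r -> r <= t -> `|g r| <= m) ->
  `|time_integral g s t| <= m * (Abar * (t - s)).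
Proof.
move=> [mg _] s0 st tT m0 gm; have A0 := coef_ge0 ha.
have mI : measurable (`]s, t]%classic : set RL) by [].
have mag : measurable_fun (`]s, t]%classic : set RL) (fun r => a r * g r).
  by apply: measurable_funS (measurable_funM (coef_meas ha) mg) => //; exact: sub_time.
apply: (le_trans (Rintegral_ae_le (M := Abar * m) mI (itv_lty _ _ _ _) _ mag _)).
- by rewrite mulr_ge0.
- apply: ae_mono (coef_ae ha) => x h xst.
  have := h (sub_time s0 tT xst); move: xst; rewrite /= in_itv /= => /andP[/ltW sx xt] h'.
  by rewrite normrM ler_pM // gm.
by rewrite (mu_oc st) mulrA (mulrC Abar).
Qed.

Lemma time_integral_split g s t : bounded_measurable g -> 0 <= s -> s <= t -> t <= T ->
  \int[mu]_(r in `[0, t]) (a r * g r) - \int[mu]_(r in `[0, s]) (a r * g r) =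
  time_integral g s t.
Proof.
move=> bg s0 st tT; apply: Rintegral_itvB; rewrite ?bnd_simp //.
by apply: integrableS (time_integrable bg) => //; apply: subset_itvl; rewrite bnd_simp.
Qed.

Lemma time_integrableS g s t : bounded_measurable g -> 0 <= s -> t <= T ->
  mu.-integrable (`]s, t]%classic : set RL) (fun r => (a r * g r)%:E).
Proof. by move=> bg s0 tT; apply: integrableS (time_integrable bg) => //; exact: sub_time. Qed.

Lemma bounded_measurableB g h : bounded_measurable g -> bounded_measurable h ->
  bounded_measurable (fun r => g r - h r).
Proof.
move=> [mg [m gm]] [mh [n hn]]; split; first exact: measurable_funB.
by exists (m + n) => r Ir; rewrite (le_trans (ler_normB _ _)) // lerD ?gm ?hn.
Qed.

Lemma bounded_measurable_cst c : bounded_measurable (cst c).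
Proof. by split; [exact: measurable_cst|exists `|c|]. Qed.

Lemma time_integralB g h s t : bounded_measurable g -> bounded_measurable h ->
  0 <= s -> t <= T ->
  time_integral (fun r => g r - h r) s t = time_integral g s t - time_integral h s t.
Proof.
move=> bg bh s0 tT; rewrite /time_integral -RintegralB //; last 2 first.
- exact: time_integrableS.
- exact: time_integrableS.
by apply: eq_Rintegral => r _; rewrite mulrBr.
Qed.

Lemma time_integralZ c g s t : bounded_measurable g -> 0 <= s -> t <= T ->
  time_integral (fun r => c * g r) s t = c * time_integral g s t.
Proof.
move=> bg s0 tT; rewrite /time_integral -RintegralZl //; last exact: time_integrableS.
by apply: eq_Rintegral => r _; rewrite mulrCA.
Qed.

(** The new time, in which the coefficient becomes 1. *)
Definition clock (t : R) : R := \int[mu]_(r in `[0, t]) a r.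

Lemma clockB s t : 0 <= s -> s <= t -> t <= T -> clock t - clock s = time_integral (cst 1) s t.
Proof.
move=> s0 st tT; rewrite -(time_integral_split (bounded_measurable_cst 1)) //.
by congr (_ - _); apply: eq_Rintegral => r _; rewrite mulr1.
Qed.

Lemma clock0 : clock 0 = 0.
Proof. by rewrite /clock set_itv1 Rintegral_set1. Qed.

Lemma coef_integrable : mu.-integrable I (fun r => (a r)%:E).
Proof.
apply: eq_integrable (time_integrable (bounded_measurable_cst 1)) => // x _.
by rewrite mulr1.
Qed.

(** The intermediate value theorem for the continuous function [clock]. *)
Lemma clock_surj s : 0 <= T -> 0 <= s -> s <= clock T -> exists t, [/\ 0 <= t, t <= T & clock t = s].
Proof.
move=> T0 s0 sT.
have [|t] := @IVT R clock 0 T s T0 (parameterized_integral_continuous T0 coef_integrable).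
  by rewrite clock0 (min_idPl (le_trans s0 sT)) (max_idPr (le_trans s0 sT)) s0.
by rewrite in_itv /= => /andP[t0 tT] e; exists t.
Qed.

Lemma clock_le s t : 0 <= s -> s <= t -> t <= T -> clock t - clock s <= Abar * (t - s).
Proof.
move=> s0 st tT; rewrite clockB //.
have := @time_integral_le (cst 1) s t 1 (bounded_measurable_cst 1) s0 st tT ler01.
by rewrite mul1r => h; apply: le_trans (ler_norm _) (h _) => r _ _; rewrite normr1.
Qed.

Lemma clock_ge alpha s t : {ae mu, forall r, I r -> alpha <= a r} -> 0 <= s -> s <= t -> t <= T ->
  alpha * (t - s) <= clock t - clock s.
Proof.
move=> ae s0 st tT; rewrite clockB //.
have bc := bounded_measurable_cst 1.
have e : alpha * (t - s) = \int[mu]_(r in `]s, t]) alpha.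
  by rewrite Rintegral_cst //; congr (_ * _); rewrite -(mu_oc st).
have ic : mu.-integrable (`]s, t]%classic : set RL) (fun=> alpha%:E).
  apply: (@bounded_integrable _ _ _ `|alpha|) => //; first exact: itv_lty.
  by apply: aeW.
have ia := time_integrableS bc s0 tT.
rewrite e -subr_ge0 /time_integral -RintegralB //.
have -> : \int[mu]_(x in `]s, t]) (a x * cst 1 x - alpha) =
    \int[mu]_(x in `]s, t]) `|a x * cst 1 x - alpha|.
  have mm : measurable_fun (`]s, t]%classic : set RL) (fun x => a x * cst 1 x - alpha).
    apply: measurable_funB => //; apply: measurable_funS (measurable_funM (coef_meas ha) bc.1) => //.
    exact: sub_time.
  congr fine; apply: ae_eq_integral => //.
  - exact/measurable_EFinP.
  - by apply/measurable_EFinP; apply: measurableT_comp.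
  apply: ae_mono ae => x h xst; have := h (sub_time s0 tT xst) => {}h.
  by congr EFin; rewrite ger0_norm // mulr1 subr_ge0.
exact: Rintegral_ge0.
Qed.

End TimeIntegral.

Lemma clock_close (R : realType) (T A1 A2 kappa : R) (a1 a2 : R -> R) t :
  coefficient T A1 a1 -> coefficient T A2 a2 -> 0 <= kappa ->
  {ae @lebesgue_measure R, forall r, `[0, T]%classic r -> `|a1 r - a2 r| <= kappa} ->
  0 <= t -> t <= T -> `|clock a1 t - clock a2 t| <= kappa * T.
Proof.
move=> h1 h2 k0 h t0 tT; have T0 := le_trans t0 tT.
have h3 : coefficient T kappa (fun r => a1 r - a2 r).
  by split => //; apply: measurable_funB; [exact: coef_meas h1|exact: coef_meas h2].
have i1 := coef_integrable h1; have i2 := coef_integrable h2.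
have sub : `[0, t]%classic `<=` `[0, T]%classic by apply: subset_itvl; rewrite bnd_simp.
have -> : clock a1 t - clock a2 t = clock (fun r => a1 r - a2 r) t.
  by rewrite /clock RintegralB //; [apply: integrableS i1|apply: integrableS i2].
rewrite -[clock _ t]subr0 -(clock0 (fun r => a1 r - a2 r)) (clockB h3) //.
have := @time_integral_le _ _ _ _ h3 (cst 1) 0 t 1 (bounded_measurable_cst _ 1) (lexx _) t0 tT ler01.
rewrite mul1r subr0 => h4; apply: le_trans (h4 _) _; first by move=> *; rewrite normr1.
by rewrite ler_wpM2l.
Qed.

(** * The integrated evolution equation *)

Section Curves.
Context {R : realType} {V : lmodType R} (b : semi_ip V) (J : V -> V).
Local Notation mu := (@lebesgue_measure R).
Local Notation RL := (measurableTypeR R).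
Hypothesis rot : rotation b J.
Variable T : R.
Hypothesis T0 : 0 <= T.

Definition norm_continuous (v : R -> V) := forall t, 0 <= t -> t <= T ->
  forall e, 0 < e -> exists2 d, 0 < d & forall s, 0 <= s -> s <= T -> `|t - s| < d ->
  nrm b (v s - v t) <= e.

Lemma within_continuous_of (f : R -> R) :
  (forall t, 0 <= t -> t <= T -> forall e, 0 < e -> exists2 d, 0 < d &
    forall s, 0 <= s -> s <= T -> `|t - s| < d -> `|f t - f s| <= e) ->
  {within `[0, T], continuous f}.
Proof.
move=> h; apply/subspace_continuousP => t /=; rewrite in_itv /= => /andP[t0 tT].
apply/cvgrPdist_le => e e0; have [d d0 hd] := h t t0 tT e e0.
rewrite /within /=; apply/nbhs_ballP; exists d => //= s ts.
by rewrite in_itv /= => /andP[s0 sT]; apply: hd.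
Qed.

Section Continuous.
Variable v : R -> V.
Hypothesis cv : norm_continuous v.

Lemma nrm_dist x y : `|nrm b x - nrm b y| <= nrm b (y - x).
Proof.
rewrite ler_norml; have := nrm_le_add b x y; have := nrm_le_add b y x.
by rewrite (nrmBC b x y) => *; apply/andP; split; lra.
Qed.

Lemma curve_bounded : exists2 B, 0 <= B & forall t, 0 <= t -> t <= T -> nrm b (v t) <= B.
Proof.
have cn : {within `[0, T], continuous (fun t => nrm b (v t))}.
  apply: within_continuous_of => t t0 tT e e0; have [d d0 hd] := cv t0 tT e0.
  by exists d => // s s0 sT ts; apply: (le_trans (nrm_dist _ _)); exact: hd.
have [c _ hc] := EVT_max T0 cn; exists (nrm b (v c)); first exact: nrm_ge0.
by move=> t t0 tT; apply: hc; rewrite in_itv /= t0.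
Qed.

Lemma curve_ip_measurable psi : bounded_measurable T (fun r => b (v r) psi).
Proof.
split.
  apply: subspace_continuous_measurable_fun => //.
  apply: within_continuous_of => t t0 tT e e0.
  have p0 : 0 < nrm b psi + 1 by rewrite ltr_wpDl ?nrm_ge0.
  have [d d0 hd] := cv t0 tT (divr_gt0 e0 p0); exists d => // s s0 sT ts.
  rewrite distrC -ipBl (le_trans (cauchy_schwarz _ _ _)) //.
  apply: (@le_trans _ _ (e / (nrm b psi + 1) * (nrm b psi + 1))).
    by rewrite ler_pM ?nrm_ge0 ?hd // lerDl.
  by rewrite divfK // gt_eqF.
have [B B0 hB] := curve_bounded; exists (B * nrm b psi) => r.
rewrite /= in_itv /= => /andP[r0 rT].
by rewrite (le_trans (cauchy_schwarz _ _ _)) // ler_wpM2r ?nrm_ge0 // hB.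
Qed.

Lemma curve_rot_measurable psi : bounded_measurable T (fun r => b (J (v r)) psi).
Proof.
have := curve_ip_measurable (- J psi); congr bounded_measurable.
by apply/funext => r; rewrite ipNr (rot_skew rot).
Qed.
End Continuous.

(** [K (v t - v s) = int_s^t a J v], tested against [psi]; here [K] has been moved
onto [psi] by symmetry. *)
Record integral_evolution (K : V -> V) (a : R -> R) (v : R -> V) : Prop := IntegralEvolution {
  ie_cont : norm_continuous v;
  ie_eq : forall psi s t, 0 <= s -> s <= t -> t <= T ->
    b (v t - v s) (K psi) = time_integral a (fun r => b (J (v r)) psi) s t }.

Lemma integral_weak_evolution K Abar a v : coefficient T Abar a ->
  integral_evolution K a v -> weak_evolution b J K T Abar (clock a) v.
Proof.
move=> ca ie; split => s t psi c m s0 st tT h.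
have m0 : 0 <= m by apply: le_trans (h s (lexx _) st); exact: normr_ge0.
have bm := curve_rot_measurable (ie_cont ie) psi.
have bc := bounded_measurable_cst T 1.
rewrite (ie_eq ie) // (clockB ca) // (mulrC _ c) -(time_integralZ ca) //.
have bc' := bounded_measurable_cst T c.
rewrite -(time_integralB ca) //; last by rewrite [X in bounded_measurable _ X](_ : _ = cst c) //; apply/funext => r; rewrite mulr1.
apply: (time_integral_le ca) => //; last by move=> r sr rt; rewrite mulr1; exact: h.
apply: bounded_measurableB => //.
by rewrite [X in bounded_measurable _ X](_ : _ = cst c) //; apply/funext => r; rewrite mulr1.
Qed.

Lemma integral_evolutionB K Abar a v w : coefficient T Abar a ->
  integral_evolution K a v -> integral_evolution K a w ->
  integral_evolution K a (fun t => v t - w t).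
Proof.
move=> ca iv iw; split=> [t t0 tT e e0|psi s t s0 st tT].
  have e2 := divr_gt0 e0 (ltr0Sn R 1).
  have [d1 d10 h1] := ie_cont iv t0 tT e2; have [d2 d20 h2] := ie_cont iw t0 tT e2.
  exists (Num.min d1 d2); first by rewrite lt_min d10.
  move=> s s0 sT; rewrite lt_min => /andP[s1 s2].
  rewrite subrACA (le_trans (nrmB _ _ _)) //.
  by have := h1 s s0 sT s1; have := h2 s s0 sT s2; lra.
rewrite subrACA ipBl (ie_eq iv) // (ie_eq iw) // -(time_integralB ca) //.
- by congr (time_integral _ _ _ _); apply/funext => r; rewrite (rotB rot) ipBl.
- exact: curve_rot_measurable (ie_cont iv) _.
- exact: curve_rot_measurable (ie_cont iw) _.
Qed.

Lemma integral_evolution_unique K C Abar a v w : coefficient T Abar a ->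
  inverse_op b K C -> commutes_rot b J K ->
  integral_evolution K a v -> integral_evolution K a w -> nrm b (v 0 - w 0) = 0 ->
  forall t, 0 <= t -> t <= T -> nrm b (v t - w t) = 0.
Proof.
move=> ca Kop KJ iv iw e0 t t0 tT; have id := integral_evolutionB ca iv iw.
have [B B0 hB] := curve_bounded (ie_cont id).
exact: (weak_unique rot Kop KJ (integral_weak_evolution ca id) (coef_ge0 ca) hB e0 t0 tT).
Qed.

(** The resolvent identity bounds the difference of the inverses. *)
Lemma op_close_nrm K1 K2 C1 C2 kappa g : inverse_op b K1 C1 -> inverse_op b K2 C2 ->
  0 <= kappa -> op_close b K1 K2 kappa ->
  nrm b (K1 g - K2 g) <= C2 * (kappa * (C1 * nrm b g)).
Proof.
move=> op1 op2 k0 [Q [Qle _ h]]; have C20 : 0 <= C2 by have := op_bound_ge1 op2; lra.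
apply: (le_trans (nrm_triangle b (K2 (g - Q (K1 g))) _ _)).
rewrite h add0r -(op_nrmB op2) (le_trans (op_bound op2 _)) // ler_wpM2l //.
rewrite addrAC subrr sub0r nrmN (le_trans (Qle _)) // ler_wpM2l //.
exact: op_bound op1 _.
Qed.

(** All terms of the integrated equation are continuous in the operator, the
coefficient and the solution; their errors are collected in [L]. *)
Lemma integral_evolution_limit K Abar a v : coefficient T Abar a ->
  (forall eta, 0 < eta -> exists K' a' v',
    [/\ integral_evolution K' a' v', coefficient T Abar a',
        forall g, nrm b (K' g) <= 2 * nrm b g,
        forall g, nrm b (K' g - K g) <= eta * nrm b g &
        [/\ forall t, 0 <= t -> t <= T -> nrm b (v t - v' t) <= eta &
            {ae mu, forall r, `[0, T]%classic r -> `|a' r - a r| <= eta}]]) ->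
  integral_evolution K a v.
Proof.
move=> ca approx.
have cv : norm_continuous v.
  move=> t t0 tT e e0; have e3 : 0 < e / 3 by rewrite divr_gt0.
  have [K' [a' [v' [ie' _ _ _ [hv _]]]]] := approx _ e3.
  have [d d0 hd] := ie_cont ie' t0 tT e3; exists d => // s s0 sT ts.
  apply: (le_trans (nrm_triangle b (v' s) _ _)).
  have := nrm_triangle b (v' t) (v' s) (v t).
  have := hd s s0 sT ts; have := hv s s0 sT; have := hv t t0 tT.
  by rewrite (nrmBC b (v t)) => *; lra.
split => // psi s t s0 st tT.
have [B B0 hB] := curve_bounded cv.
have A0 := coef_ge0 ca.
pose n := nrm b psi; have n0 : 0 <= n := nrm_ge0 _ _.
pose L := (B + B) * n + 2 * (2 * n) + n * (Abar * (t - s)) + B * n * (t - s).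
have ts0 : 0 <= t - s by rewrite subr_ge0.
have L0 : 0 <= L.
  have ? : 0 <= n * (Abar * (t - s)) by rewrite !mulr_ge0.
  have ? : 0 <= B * n * (t - s) by rewrite !mulr_ge0.
  have ? : 0 <= B * n by rewrite mulr_ge0.
  by rewrite /L; lra.
apply/eqP; rewrite -subr_eq0 -normr_le0; apply: le_eps => e e0; rewrite add0r.
have L1 : 0 < L + 1 by rewrite ltr_wpDl.
pose eta := e / (L + 1); have eta0 : 0 < eta by rewrite divr_gt0.
have [K' [a' [v' [ie' ca' K'2 KK' [hv ha]]]]] := approx _ eta0.
suff h : `|b (v t - v s) (K psi) - time_integral a (fun r => b (J (v r)) psi) s t| <= eta * L.
  apply: (le_trans h); rewrite -[leRHS](divfK (lt0r_neq0 L1)) -/eta.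
  by rewrite ler_wpM2l ?(ltW eta0) // lerDl.
have bv := curve_rot_measurable cv psi.
have bv' := curve_rot_measurable (ie_cont ie') psi.
have sT := le_trans st tT; have t0 := le_trans s0 st.
have E := ie_eq ie' psi s0 st tT.
have h1 : `|b (v t - v s) (K psi) - b (v t - v s) (K' psi)| <= eta * ((B + B) * n).
  rewrite -ipBr (le_trans (cauchy_schwarz _ _ _)) // (nrmBC b (K psi)).
  rewrite (_ : eta * ((B + B) * n) = (B + B) * (eta * n)); last by ring.
  rewrite ler_pM ?nrm_ge0 ?KK' //.
  by rewrite (le_trans (nrmB _ _ _)) // lerD ?hB.
have h2 : `|b (v t - v s) (K' psi) - b (v' t - v' s) (K' psi)| <= eta * (2 * (2 * n)).
  rewrite -ipBl subrACA (le_trans (cauchy_schwarz _ _ _)) //.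
  rewrite (_ : eta * (2 * (2 * n)) = (eta + eta) * (2 * n)); last by ring.
  rewrite ler_pM ?nrm_ge0 ?K'2 //.
  by rewrite (le_trans (nrmB _ _ _)) // lerD ?hv.
have h3 : `|time_integral a' (fun r => b (J (v' r)) psi) s t -
     time_integral a' (fun r => b (J (v r)) psi) s t| <= eta * (n * (Abar * (t - s))).
  rewrite -(time_integralB ca') // mulrA.
  apply: (time_integral_le ca') => //; first exact: bounded_measurableB.
    by rewrite mulr_ge0 // ltW.
  move=> r sr rt; rewrite -ipBl -(rotB rot) (le_trans (cauchy_schwarz _ _ _)) //.
  rewrite (rot_isom rot) ler_wpM2r // nrmBC hv //; lra.
have h4 : `|time_integral a' (fun r => b (J (v r)) psi) s t -
     time_integral a (fun r => b (J (v r)) psi) s t| <= eta * (B * n * (t - s)).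
  have cd : coefficient T eta (fun r => a' r - a r).
    split; [exact: ltW| |exact: ha].
    by apply: measurable_funB; [exact: coef_meas ca'|exact: coef_meas ca].
  have -> : time_integral a' (fun r => b (J (v r)) psi) s t -
     time_integral a (fun r => b (J (v r)) psi) s t =
     time_integral (fun r => a' r - a r) (fun r => b (J (v r)) psi) s t.
    rewrite /time_integral -RintegralB //; last 2 first.
    - exact: (time_integrableS ca').
    - exact: (time_integrableS ca).
    by apply: eq_Rintegral => r _; rewrite mulrBl.
  rewrite mulrCA; apply: (time_integral_le cd) => //; first by rewrite mulr_ge0.
  move=> r sr rt; rewrite (le_trans (cauchy_schwarz _ _ _)) // (rot_isom rot).
  by rewrite ler_wpM2r // hB //; lra.
have -> : eta * L = eta * ((B + B) * n) + eta * (2 * (2 * n)) +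
    eta * (n * (Abar * (t - s))) + eta * (B * n * (t - s)) by rewrite /L; ring.
move: h1 h2 h3 h4; rewrite E.
move: (b (v t - v s) (K psi)) (b (v t - v s) (K' psi)) (time_integral a' _ s t)
  (time_integral a' _ s t) (time_integral a _ s t) => x1 x2 x4 x3 x5 h1 h2 h3 h4.
have -> : x1 - x5 = (x1 - x2) + (x2 - x3) + (x3 - x4) + (x4 - x5) by ring.
by do 3![apply: (le_trans (ler_normD _ _)); apply: lerD => //].
Qed.

End Curves.

(** * Solutions and the integrated equation *)

Section Solutions.
Local Open Scope complex_scope.
Context {R : realType}.
Local Notation mu := (@lebesgue_measure R).
Local Notation RL := (measurableTypeR R).
Local Notation J := (@rot_prod R (@L2fun R)).
Local Notation Cip := (@Cip R).
Local Notation CL2 := (@CL2 R).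
Local Notation Cnrm := (nrm Cip).
Variables (T : R).
Hypothesis T0 : 0 <= T.

Lemma rotC : rotation Cip J. Proof. exact: rot_prodP. Qed.

Lemma in_time r : `[0, T]%classic r -> 0 <= r /\ r <= T.
Proof. by rewrite /= in_itv /= => /andP. Qed.

Lemma continuous_L2P (u : R -> R -> R[i]) : continuous_L2 T u <->
  (forall t, 0 <= t -> t <= T -> L2 (u t)) /\
  norm_continuous Cip T (fun t => toCL2 (u t)).
Proof.
split=> [[uL uc]|[uL uc]].
  have uL' t : 0 <= t -> t <= T -> L2 (u t) by move=> t0 tT; apply: uL; rewrite in_itv /= t0.
  split => // t t0 tT e e0; have tI : t \in `[0, T] by rewrite in_itv /= t0.
  have := uc t tI => /(_ [set x | (x < e%:E)%E]).
  have nb : nbhs 0%E [set x | (x < e%:E)%E].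
    by apply: open_nbhs_nbhs; split; [exact: open_ereal_lt_ereal|rewrite /= lte_fin].
  move=> /(_ nb); rewrite /within /= => /nbhs_ballP[d /= d0 hd].
  exists d => // s s0 sT ts; have sI : s \in `[0, T] by rewrite in_itv /= s0.
  have := hd s ts sI; rewrite /= (L2norm_sub (uL' s s0 sT) (uL' t t0 tT)) lte_fin.
  exact: ltW.
split=> [t|t]; rewrite in_itv /= => /andP[t0 tT]; first exact: uL.
have hs s : 0 <= s -> s <= T -> L2norm (u s \- u t) = (Cnrm (toCL2 (u s) - toCL2 (u t)))%:E.
  by move=> s0 sT; rewrite -L2norm_sub //; exact: uL.
have nearP (Q : R -> Prop) d : 0 < d ->
    (forall s, 0 <= s -> s <= T -> `|t - s| < d -> Q s) ->
    \forall s \near within `[0, T] (nbhs t), Q s.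
  move=> d0 hQ; rewrite /within /=; apply/nbhs_ballP; exists d => //= s ts.
  by rewrite in_itv /= => /andP[s0 sT]; apply: hQ.
apply/fine_cvgP; split.
  by apply: (nearP _ 1) => // s s0 sT _; rewrite hs.
apply/cvgrPdist_le => e e0; have [d d0 hd] := uc t t0 tT e e0.
apply: (nearP _ d) => // s s0 sT ts; rewrite /= hs //= sub0r normrN ger0_norm ?nrm_ge0 //.
exact: hd.
Qed.

Lemma is_primitive_compT F g : is_primitive 0 T F g ->
  [/\ mu.-integrable `[0, T] (fun x => (complex.Re (g x))%:E),
      mu.-integrable `[0, T] (fun x => (complex.Im (g x))%:E) &
      forall x, 0 <= x -> x <= T ->
        complex.Re (F x) = complex.Re (F 0) + \int[mu]_(t in `[0, x]) complex.Re (g t)].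
Proof.
by move=> [[gr gi] h]; split => // x x0 x1; rewrite h ?in_itv /= ?x0 //; case: (F 0).
Qed.

(** The norm is a supremum over test functions, as these are dense. *)
Lemma test_dense_le q (x : CL2) c : potential q -> 0 <= c ->
  (forall w, SL_test q (test_of w) -> Cip x w <= c * Cnrm w) -> Cnrm x <= c.
Proof.
move=> qP c0 h; apply: nrm_dual_le => // y; apply: le_eps => e e0.
have n0 := nrm_ge0 Cip x.
have L1 : 0 < Cnrm x + c + 1 by rewrite ltr_wpDl // addr_ge0.
pose d := e / (Cnrm x + c + 1); have d0 : 0 < d by rewrite divr_gt0.
have [_ [w [_ wt _ _ wy]]] := SL_test_dense y qP d0.
have h1 := h w wt; have h2 : Cip x (y - w) <= Cnrm x * d.
  by rewrite (le_trans (ip_le_nrm _ _ _)) // ler_wpM2l // nrmBC.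
have h3 : c * Cnrm w <= c * (Cnrm y + d).
  by rewrite ler_wpM2l // (le_trans (nrm_le_add _ _ y)) // lerD2l.
have h4 : Cip x y = Cip x w + Cip x (y - w) by rewrite (ipBr Cip) addrC subrK.
have h5 : (Cnrm x + c) * d <= e.
  rewrite -[leRHS](divfK (lt0r_neq0 L1)) -/d mulrC.
  by rewrite ler_wpM2l ?(ltW d0) // lerDl.
rewrite h4; move: h1 h2 h3 h5; rewrite mulrDl mulrDr.
move: (Cip x w) (Cip x (y - w)) (c * Cnrm w) (c * Cnrm y) (Cnrm x * d) (c * d) => *; lra.
Qed.

(** A derivative in the dual of the test functions that is bounded in L^2 makes the
curve Lipschitz in L^2. *)
Lemma derivative_lipschitz q (u U : R -> R -> R[i]) M : potential q -> 0 <= M ->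
  (forall t, 0 <= t -> t <= T -> L2 (u t)) ->
  (forall t, 0 <= t -> t <= T -> L2 (U t) /\ Cnrm (toCL2 (U t)) <= M) ->
  time_derivative T q u (fun t => pairing (U t)) ->
  forall s t, 0 <= s -> s <= t -> t <= T ->
    Cnrm (toCL2 (u t) - toCL2 (u s)) <= M * (t - s).
Proof.
move=> qP M0 uL UM du s t s0 st tT.
have sT := le_trans st tT; have t0 := le_trans s0 st.
apply: (test_dense_le qP); first by rewrite mulr_ge0 // subr_ge0.
move=> w /du/is_primitive_compT[ir _ h].
have E r : 0 <= r -> r <= T -> complex.Re (pairing (u r) (test_of w)) = Cip (toCL2 (u r)) w.
  by move=> r0 rT; by rewrite Re_pairing_test //; exact: uL.
have -> : Cip (toCL2 (u t) - toCL2 (u s)) w =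
    \int[mu]_(r in `]s, t]) complex.Re (pairing (U r) (test_of w)).
  rewrite (ipBl Cip) -!E // h // [in X in _ - X]h //.
  rewrite opprD addrACA subrr add0r; apply: Rintegral_itvB; rewrite ?bnd_simp //.
  by apply: integrableS ir => //; apply: subset_itvl; rewrite bnd_simp.
have sub := @sub_time R T s t s0 tT.
have mw : measurable_fun (`]s, t]%classic : set RL) (fun r => complex.Re (pairing (U r) (test_of w))).
  case/integrableP : ir => /measurable_EFinP mr _.
  by apply: measurable_funS mr.
apply: le_trans (ler_norm _) _.
apply: (le_trans (Rintegral_ae_le (M := M * Cnrm w) _ (itv_lty _ _ _ _) _ mw _)) => //.
- by rewrite mulr_ge0 ?nrm_ge0.
- apply: aeW => r /sub/in_time[r0 rT].
  have [UL Ur] := UM r r0 rT; rewrite (Re_pairing_test w UL).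
  by rewrite (le_trans (cauchy_schwarz _ _ _)) // ler_wpM2r ?nrm_ge0.
by rewrite (mu_oc st) mulrAC.
Qed.

(** For a test function [v0 = K w] the equation in the dual is exactly the
integrated equation tested against [w], because the operator sends [v0] to [w].
Such [w] are dense, and both sides are continuous in [w]. *)
Lemma solution_integral_evolution q a Abar u0 u : potential q -> coefficient T Abar a ->
  solution T q a u0 u ->
  integral_evolution Cip J T (Csl_inv q) a (fun t => toCL2 (u t)).
Proof.
move=> qP ca [/continuous_L2P[uL uc] _ [U [dU eqU]]].
have Kop := Csl_inv_op qP; have A0 := coef_ge0 ca.
have main v0 w s t : SL_test q (test_of v0) -> SL_graph q (test_of v0) (test_of w) ->
    Cnrm (v0 - Csl_inv q w) = 0 -> 0 <= s -> s <= t -> t <= T ->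
    Cip (toCL2 (u t) - toCL2 (u s)) (Csl_inv q w) =
    time_integral a (fun r => Cip (J (toCL2 (u r))) w) s t.
  move=> tv gv vw s0 st tT; have sT := le_trans st tT; have t0 := le_trans s0 st.
  have bm := curve_rot_measurable rotC T0 uc w.
  have /is_primitive_compT[ir _ h] := dU _ tv.
  have E r : 0 <= r -> r <= T ->
      complex.Re (pairing (u r) (test_of v0)) = Cip (toCL2 (u r)) (Csl_inv q w).
    move=> r0 rT; rewrite (Re_pairing_test v0 (uL r r0 rT)).
    by rewrite (ipC Cip) (nrm0_ipB _ vw) (ipC Cip).
  have aeU x : 0 <= x -> x <= T -> \int[mu]_(r in `[0, x]) complex.Re (U r (test_of v0)) =
      \int[mu]_(r in `[0, x]) (a r * Cip (J (toCL2 (u r))) w).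
    move=> x0 xT; have sub : `[0, x]%classic `<=` `[0, T]%classic.
      by apply: subset_itvl; rewrite bnd_simp.
    congr fine; apply: ae_eq_integral => //.
    - by case/integrableP : ir => mr _; apply: measurable_funS mr.
    - case/integrableP : (time_integrable ca bm) => mr _; exact: measurable_funS mr.
    apply: ae_mono eqU => r hr /sub Ir; congr EFin; have := hr Ir _ _ tv gv.
    have [r0 rT] := in_time Ir.
    move=> /(congr1 (@complex.Im R)); rewrite (rot_skew rotC) -(Im_pairing_test w (uL r r0 rT)).
    case: (U r _) => p p'; case: (pairing _ _) => z z' /= hz.
    have -> : p = - (a r * z') by move: hz; lra.
    by rewrite mulrN.
  rewrite (ipBl Cip) -!E // h // [in X in _ - X]h // !aeU // opprD addrACA subrr add0r.
  exact: (time_integral_split ca bm).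
split => // psi s t s0 st tT.
have [B B0 hB] := curve_bounded T0 uc.
have sT := le_trans st tT; have t0 := le_trans s0 st.
have ts0 : 0 <= t - s by rewrite subr_ge0.
pose L := (B + B) * 2 + B * (Abar * (t - s)).
have L0 : 0 <= L by rewrite addr_ge0 // !mulr_ge0 // addr_ge0.
have L1 : 0 < L + 1 by rewrite ltr_wpDl.
apply/eqP; rewrite -subr_eq0 -normr_le0; apply: le_eps => e e0; rewrite add0r.
pose d := e / (L + 1); have d0 : 0 < d by rewrite divr_gt0.
have [v0 [w [tv _ gv vw wp]]] := SL_test_dense psi qP d0.
have := main v0 w s t tv gv vw s0 st tT => E.
have h1 : `|Cip (toCL2 (u t) - toCL2 (u s)) (Csl_inv q psi) -
    Cip (toCL2 (u t) - toCL2 (u s)) (Csl_inv q w)| <= (B + B) * 2 * d.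
  rewrite -(ipBr Cip) (le_trans (cauchy_schwarz _ _ _)) // -mulrA ler_pM ?nrm_ge0 //.
    by rewrite (le_trans (nrmB _ _ _)) // lerD ?hB.
  rewrite -(op_nrmB Kop) (le_trans (op_bound Kop _)) // ler_wpM2l //.
  by rewrite nrmBC.
have h2 : `|time_integral a (fun r => Cip (J (toCL2 (u r))) w) s t -
    time_integral a (fun r => Cip (J (toCL2 (u r))) psi) s t| <= B * (Abar * (t - s)) * d.
  have b1 := curve_rot_measurable rotC T0 uc w; have b2 := curve_rot_measurable rotC T0 uc psi.
  rewrite -(time_integralB ca) // mulrAC.
  apply: (time_integral_le ca) => //; first exact: bounded_measurableB.
    by rewrite mulr_ge0 // ltW.
  move=> r sr rt; rewrite -(ipBr Cip) (le_trans (cauchy_schwarz _ _ _)) //.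
  rewrite (rot_isom rotC) ler_pM ?nrm_ge0 // hB //; lra.
have h3 : L * d <= e.
  rewrite -[leRHS](divfK (lt0r_neq0 L1)) -/d mulrC.
  by rewrite ler_wpM2l ?(ltW d0) // lerDl.
apply: le_trans h3; rewrite /L [in leRHS]mulrDl.
move: h1 h2; rewrite E; move: (Cip _ _) (time_integral a _ s t) (time_integral a _ s t) => x z y h1 h2.
rewrite (_ : x - z = (x - y) + (y - z)); last by ring.
by apply: (le_trans (ler_normD _ _)); apply: lerD.
Qed.

Lemma is_primitive_of F g :
  mu.-integrable `[0, T] (fun x => (complex.Re (g x))%:E) ->
  mu.-integrable `[0, T] (fun x => (complex.Im (g x))%:E) ->
  (forall x, 0 <= x -> x <= T -> complex.Re (F x) - complex.Re (F 0) =
     \int[mu]_(t in `[0, x]) complex.Re (g t) /\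
     complex.Im (F x) - complex.Im (F 0) = \int[mu]_(t in `[0, x]) complex.Im (g t)) ->
  is_primitive 0 T F g.
Proof.
move=> gr gi h; split => // x; rewrite in_itv /= => /andP[x0 xT].
have [h1 h2] := h x x0 xT; apply/eqP; rewrite eq_complex; apply/andP; split; apply/eqP.
  by rewrite (raddfD (@complex.Re R)) /= -h1 addrC subrK.
by rewrite (raddfD (@complex.Im R)) /= -h2 addrC subrK.
Qed.

(** The time derivative is forced by the equation: its value at a test function
[phi] is [i a <u, L phi>]. The integrated equation gives the real part of the
required identity with [p'], the conjugate of [L phi], and its imaginary part
with [J p']. *)
Lemma integral_evolution_solution q a Abar u0 (v : R -> CL2) (u : R -> R -> R[i]) :
  potential q -> coefficient T Abar a ->
  integral_evolution Cip J T (Csl_inv q) a v ->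
  (forall t, u t = ofCL2 (v t)) -> ae_eq01 (u 0) u0 -> solution T q a u0 u.
Proof.
move=> qP ca iv uE u00; have Kop := Csl_inv_op qP.
have uL t : L2 (u t) by rewrite uE; exact: L2_ofCL2.
have uv t : Cnrm (toCL2 (u t) - v t) = 0 by rewrite uE; exact: toCL2K.
have cv := ie_cont iv.
(* the image of a test function under the operator, defined up to null sets *)
pose Lphi (phi : R -> R[i]) : R -> R[i] :=
  if pselect (exists g, SL_graph q phi g) is left h then projT1 (cid h) else phi.
have LphiP phi : SL_test q phi -> SL_graph q phi (Lphi phi).
  move=> tphi; rewrite /Lphi; case: pselect => [h|[]]; first exact: (projT2 (cid h)).
  by have [g [hg _]] := tphi 1%N; exists g.
have pE t phi : L2 phi -> pairing (u t) phi = Cip (v t) (conjC2 (toCL2 phi)) +i*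
     Cip (v t) (J (conjC2 (toCL2 phi))).
  move=> Lp; rewrite pairingE //.
  by congr (_ +i* _); apply: nrm0_ipB.
split.
- apply/continuous_L2P; split => // t t0 tT e e0; have [d d0 hd] := cv t t0 tT e e0.
  exists d => // s s0 sT ts; apply: le_trans (hd s s0 sT ts).
  apply: (le_trans (nrm_triangle Cip (v s) _ _)); rewrite uv add0r.
  by apply: (le_trans (nrm_triangle Cip (v t) _ _)); rewrite (nrmBC Cip (v t)) uv addr0.
- exact: u00.
exists (fun t phi => 'i%C * ((a t)%:C * pairing (u t) (Lphi phi))); split.
  move=> phi tphi; have gphi := LphiP _ tphi.
  have [Lp Lg pg] := SL_graph_inv qP gphi.
  pose p' := conjC2 (toCL2 (Lphi phi)).
  have pp' : Cnrm (conjC2 (toCL2 phi) - Csl_inv q p') = 0.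
    apply: null_trans (Csl_inv_conj _ qP).
    by rewrite -(conj_prodB (toCL2 phi)) nrm_conj_prod.
  have Jpp' : Cnrm (J (conjC2 (toCL2 phi)) - Csl_inv q (J p')) = 0.
    apply: null_trans (Csl_inv_J qP p').
    by rewrite -(rotB rotC) (rot_isom rotC).
  have reE t : complex.Re ('i%C * ((a t)%:C * pairing (u t) (Lphi phi))) =
      a t * Cip (J (v t)) p'.
    rewrite pE // (rot_skew rotC) -/p'; move: (Cip _ _) (Cip _ _) => x y /=; ring.
  have imE t : complex.Im ('i%C * ((a t)%:C * pairing (u t) (Lphi phi))) =
      a t * Cip (J (v t)) (J p').
    rewrite pE // (rot_ip rotC) -/p'; move: (Cip _ _) (Cip _ _) => x y /=; ring.
  have b1 := curve_rot_measurable rotC T0 cv p'.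
  have b2 := curve_rot_measurable rotC T0 cv (J p').
  apply: is_primitive_of.
  - by apply: eq_integrable (time_integrable ca b1) => // x _; rewrite reE.
  - by apply: eq_integrable (time_integrable ca b2) => // x _; rewrite imE.
  move=> x x0 xT; rewrite !pE //; split.
    rewrite (@eq_Rintegral _ _ _ mu `[0, x]%classic (fun t => a t * Cip (J (v t)) p')); last by move=> t _; rewrite reE.
    have := ie_eq iv p' (lexx 0) x0 xT; rewrite -(time_integral_split ca b1) //.
    rewrite set_itv1 Rintegral_set1 subr0 => <-.
    rewrite -[LHS]/(Cip (v x) _ - Cip (v 0) _) -(ipBl Cip).
    by rewrite (ipC Cip) (nrm0_ipB _ pp') (ipC Cip).
  rewrite (@eq_Rintegral _ _ _ mu `[0, x]%classic (fun t => a t * Cip (J (v t)) (J p'))); last by move=> t _; rewrite imE.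
  have := ie_eq iv (J p') (lexx 0) x0 xT; rewrite -(time_integral_split ca b2) //.
  rewrite set_itv1 Rintegral_set1 subr0 => <-.
  rewrite -[LHS]/(Cip (v x) _ - Cip (v 0) _) -(ipBl Cip).
  by rewrite (ipC Cip) (nrm0_ipB _ Jpp') (ipC Cip).
apply: aeW => t _ phi g tphi gphi.
have [Lp Lg pg] := SL_graph_inv qP gphi.
have [_ Lg' pg'] := SL_graph_inv qP (LphiP _ tphi).
have gg : Cnrm (conjC2 (toCL2 (Lphi phi)) - conjC2 (toCL2 g)) = 0.
  rewrite -(conj_prodB (toCL2 (Lphi phi))) nrm_conj_prod; apply: (op_inj Kop).
  rewrite (op_nrmB Kop); apply: (@null_trans _ _ Cip (toCL2 phi)) => //.
  by rewrite nrmBC.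
have -> : pairing (u t) (Lphi phi) = pairing (u t) g.
  rewrite !pE //; congr (_ +i* _); rewrite (ipC Cip) [RHS](ipC Cip); apply: nrm0_ipB => //.
  by rewrite -(rotB rotC) (rot_isom rotC).
by rewrite mulrA -expr2 sqr_i mulN1r addNr.
Qed.

End Solutions.

(** * Convergence of very weak solutions *)

Section VeryWeak.
Context {R : realType}.
Local Notation mu := (@lebesgue_measure R).
Local Notation RL := (measurableTypeR R).
Local Notation J := (@rot_prod R (@L2fun R)).
Local Notation Cip := (@Cip R).
Local Notation CL2 := (@CL2 R).
Local Notation Cnrm := (nrm Cip).
Local Notation D := (@unit_itv R).

Lemma Linfty_ess_bounded (q : R -> R) : Linfty `]0, 1[ q -> exists C, ess_bounded q C.
Proof. by move=> hq; have [c c0 hc] := Linfty_bounded hq; exists c; split => //; exact: hq.1. Qed.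

(** Nonnegative up to [1/2] is what coercivity of the form allows. *)
Lemma potential_perturb (q q' : R -> R) : Linfty `]0, 1[ q' ->
  {ae mu, forall x, D x -> 0 <= q x} -> {ae mu, forall x, D x -> `|q x - q' x| <= 2^-1} ->
  potential q'.
Proof.
move=> lq' q0 h; split; first exact: Linfty_ess_bounded.
apply: ae_mono2 q0 h => x h1 h2 Dx; move: (h1 Dx) (h2 Dx); rewrite ler_norml => h3 /andP[_ h4].
by lra.
Qed.

Lemma Lpnorm_small (A : set R) (f : R -> R) (g : R -> R -> R) :
  Lpnorm +oo A (fun x => f x - g e x) @[e --> 0^'+] --> 0%E ->
  forall eta, 0 < eta -> exists d, 0 < d /\ forall e, 0 < e -> e <= d ->
    {ae mu, forall x, A x -> `|f x - g e x| <= eta}.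
Proof.
move=> /cvg_right0 h eta /h[d [d0 hd]]; exists d; split => // e e0 ed.
exact: Lpnorm_oo_ae (hd e e0 ed).
Qed.

Lemma ess_bounded_sub (q q1 q2 : R -> R) C1 C2 k1 k2 kappa :
  ess_bounded q1 C1 -> ess_bounded q2 C2 -> 0 <= kappa -> k1 + k2 <= kappa ->
  {ae mu, forall x, D x -> `|q x - q1 x| <= k1} ->
  {ae mu, forall x, D x -> `|q x - q2 x| <= k2} ->
  ess_bounded (fun x => q1 x - q2 x) kappa.
Proof.
move=> [m1 _ _] [m2 _ _] k0 kk h1 h2; split => //; first exact: measurable_funB.
apply: ae_mono2 h1 h2 => x h1 h2 Dx; apply: le_trans kk.
apply: (le_trans (ler_distD (q x) _ _)); rewrite (distrC (q1 x)).
by apply: lerD; [exact: h1|exact: h2].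
Qed.

Section Data.
Variables (T a0 : R) (q a : R -> R) (u0 : R -> R[i]).
Variables (qe ae : R -> R -> R) (u0e : R -> R -> R[i]) (ue : R -> R -> R -> R[i]).
Hypotheses (hT : 0 < T) (hq : Linfty `]0, 1[ q).
Hypothesis hq0 : {ae mu, forall x, D x -> 0 <= q x}.
Hypotheses (ha : Linfty `[0, T] a) (ha0 : 0 < a0).
Hypothesis haa0 : forall t, t \in `[0, T] -> a0 <= a t.
Hypothesis hu0 : L2 u0.
Hypothesis hqe : Lpnorm +oo `]0, 1[ (fun x => q x - qe e x) @[e --> 0^'+] --> 0%E.
Hypothesis hae : Lpnorm +oo `[0, T] (fun t => a t - ae e t) @[e --> 0^'+] --> 0%E.
Hypothesis hu0e : L2norm (fun x => u0 x - u0e e x) @[e --> 0^'+] --> 0%E.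
Hypothesis hue : very_weak_solution T qe ae u0e ue.

Let T0 : (0 : R) <= T. Proof. exact: (ltW hT). Qed.
Let v e t : CL2 := toCL2 (ue e t).

Lemma unit_mem (e : R) : 0 < e -> e <= 1 -> e \in `]0, 1].
Proof. by move=> e0 e1; rewrite in_itv /= e0. Qed.

Lemma L2_u0e e : 0 < e -> e <= 1 -> L2 (u0e e).
Proof.
move=> e0 e1; have [[_ _ [f'' [h _ _]]] _ _ _] := hue.
by have [y []] := h e (unit_mem e0 e1).
Qed.

Lemma L2_ue e t : 0 < e -> e <= 1 -> 0 <= t -> t <= T -> L2 (ue e t).
Proof.
move=> e0 e1 t0 tT; have [_ _ [h _] _] := hue; apply: h; first exact: unit_mem.
by rewrite in_itv /= t0.
Qed.

Lemma initial_small eta : 0 < eta -> exists d, 0 < d /\ forall e, 0 < e -> e <= d -> e <= 1 ->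
  Cnrm (toCL2 u0 - v e 0) <= eta.
Proof.
move=> /(cvg_right0 hu0e)[d [d0 hd]]; exists d; split => // e e0 ed e1.
have := hd e e0 ed; rewrite L2norm_sub ?lee_fin //; last exact: L2_u0e.
move=> h; rewrite (@nrm0_eq _ _ Cip _ (toCL2 u0 - toCL2 (u0e e))) //.
rewrite subrACA subrr sub0r nrmN; apply/ae_eq01E.
- by apply: L2_ue.
- exact: L2_u0e.
- by have [_ hs _ _] := hue; have [_ ] := hs e (unit_mem e0 e1).
Qed.

Lemma potential_limit : potential q.
Proof.
apply: (@potential_perturb q q) => //; apply: aeW => x _.
by rewrite subrr normr0 invr_ge0.
Qed.

(** All constants of the comparison become independent of [e] here; replacing [a0]
by [a0 / 2] leaves room for the distance between [ae e] and [a]. *)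
Lemma uniform_regime : exists e1 Abar, [/\ 0 < e1, e1 <= 1, 0 <= Abar, coefficient T Abar a &
  forall e, 0 < e -> e <= e1 -> [/\ potential (qe e), coefficient T Abar (ae e),
    {ae mu, forall r, `[0, T]%classic r -> a0 / 2 <= ae e r} &
    Cnrm (v e 0) <= Cnrm (toCL2 u0) + 1]].
Proof.
have [Ca Ca0 hCa] := Linfty_bounded ha.
have a02 : 0 < a0 / 2 by rewrite divr_gt0.
have h2 : 0 < 2^-1 :> R by rewrite invr_gt0.
have [d1 [d10 hd1]] := Lpnorm_small hqe h2.
have [d2 [d20 hd2]] := Lpnorm_small hae a02.
have [d3 [d30 hd3]] := initial_small ltr01.
exists (Num.min 1 (Num.min d1 (Num.min d2 d3))), (Ca + a0).
have A0 : 0 <= Ca + a0 by rewrite addr_ge0 // ltW.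
split; rewrite ?lt_min ?ltr01 ?d10 ?d20 ?ge_min ?lexx //.
  split => //; first exact: ha.1.
  by apply: ae_mono hCa => x /[apply] h; rewrite (le_trans h) // lerDl ltW.
move=> e e0; rewrite !le_min => /and4P[e1 ed1 ed2 ed3].
have [[[hqm _] [ham _] _] _ _ _] := hue.
have close := hd2 e e0 ed2.
split.
- exact: potential_perturb (hqm e (unit_mem e0 e1)) hq0 (hd1 e e0 ed1).
- split => //; first exact: (ham e (unit_mem e0 e1)).1.
  apply: ae_mono2 hCa close => x h3 h4 Ix; move: (h3 Ix) (h4 Ix); rewrite !ler_norml.
  by move=> /andP[p1 p2] /andP[p3 p4]; apply/andP; split; lra.
- apply: ae_mono close => x /[swap] Ix /(_ Ix); rewrite ler_norml => /andP[_ p].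
  by have := haa0 Ix; lra.
- have := hd3 e e0 ed3 e1; have := nrm_le_add Cip (v e 0) (toCL2 u0).
  by rewrite (nrmBC Cip (v e 0)); lra.
Qed.

Lemma ue_integral_evolution e Abar : 0 < e -> e <= 1 -> potential (qe e) ->
  coefficient T Abar (ae e) ->
  integral_evolution Cip J T (Csl_inv (qe e)) (ae e) (v e).
Proof.
move=> e0 e1 qP ca; have [_ hs _ _] := hue.
exact: solution_integral_evolution T0 _ _ _ _ _ qP ca (hs e (unit_mem e0 e1)).
Qed.

Lemma ue_lipschitz e : 0 < e -> e <= 1 -> potential (qe e) ->
  exists M, forall s t, 0 <= s -> s <= t -> t <= T -> Cnrm (v e t - v e s) <= M * (t - s).
Proof.
move=> e0 e1 qP; have [_ _ _ [dtu [hd [dL [N [C [C0 hC]]]]]]] := hue.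
have eI := unit_mem e0 e1.
exists (C * e ^- N); apply: (derivative_lipschitz qP _ _ _ (hd e eI)).
- by rewrite mulr_ge0 ?(ltW C0) // invr_ge0 exprn_ge0 // ltW.
- by move=> t t0 tT; exact: L2_ue.
- move=> t t0 tT; have tI : t \in `[0, T] by rewrite in_itv /= t0.
  have L := dL e t eI tI; split => //.
  by have := hC e t eI tI; rewrite L2normE // lee_fin.
Qed.

(** The Lipschitz constant of [ue e] is finite for each [e] but may grow as [e]
decreases; it enters the constant [E] of the regular evolution only. *)
Lemma ue_smooth e Abar : 0 < e -> e <= 1 -> potential (qe e) -> coefficient T Abar (ae e) ->
  {ae mu, forall r, `[0, T]%classic r -> a0 / 2 <= ae e r} ->
  exists U G E, smooth_evolution Cip J (Csl_inv (qe e)) (clock (ae e) T) E U G /\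
    forall t, 0 <= t -> t <= T -> U (clock (ae e) t) = v e t.
Proof.
move=> e0 e1 qP ca age; have [M hM] := ue_lipschitz e0 e1 qP.
have a02 : 0 < a0 / 2 by rewrite divr_gt0.
apply: (smooth_of_weak (rotC (R := R)) (@Cip_complete R) (Csl_inv_op qP) (Csl_inv_J qP)
  (integral_weak_evolution (rotC (R := R)) T0 ca (ue_integral_evolution e0 e1 qP ca)) hT a02 hM).
- exact: clock0.
- move=> s t s0 st tT; apply/andP; split; first exact: (clock_ge ca).
  exact: (clock_le ca).
- by move=> s s0 sT; apply: (clock_surj ca).
Qed.

(** The net is indexed by a continuous parameter, so the regular evolutions are
chosen for all small [e] at once; the remaining hypotheses of the comparison are
the convergence of the data. *)
Lemma ue_cauchy eta : 0 < eta -> exists e2, [/\ 0 < e2, e2 <= 1 &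
  forall e d t, 0 < e -> e <= e2 -> 0 < d -> d <= e2 -> 0 <= t -> t <= T ->
    Cnrm (v e t - v d t) <= eta].
Proof.
move=> eta0; have [e1 [Abar [e10 e11 A0 ca reg]]] := uniform_regime.
have /choice[P hP] e : exists p : (R -> CL2) * (R -> CL2) * R, 0 < e -> e <= e1 ->
    smooth_evolution Cip J (Csl_inv (qe e)) (clock (ae e) T) p.2 p.1.1 p.1.2 /\
    forall t, 0 <= t -> t <= T -> p.1.1 (clock (ae e) t) = v e t.
  have [e0|] := boolP (0 < e); last by exists (fun=> 0, fun=> 0, 0).
  have [ee1|] := boolP (e <= e1); last by exists (fun=> 0, fun=> 0, 0).
  have [qP cae age _] := reg e e0 ee1.
  have [U [G [E h]]] := ue_smooth e0 (le_trans ee1 e11) qP cae age.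
  by exists (U, G, E).
have U0 e : 0 < e -> e <= e1 -> (P e).1.1 0 = v e 0.
  by move=> e0 ee1; have [_ /(_ 0 (lexx _) T0)] := hP e e0 ee1; rewrite clock0.
have a0T : 0 < a0 / 2 * T by rewrite mulr_gt0 // divr_gt0.
have clk e t : 0 < e -> e <= e1 -> 0 <= t -> t <= T ->
    a0 / 2 * t <= clock (ae e) t /\ clock (ae e) t <= Abar * t.
  move=> e0 ee1 t0 tT; have [_ cae age _] := reg e e0 ee1.
  have := clock_ge cae age (lexx 0) t0 tT; have := clock_le cae (lexx 0) t0 tT.
  by rewrite clock0 !subr0.
have [||||eta'|e2 [e20 e21 he2]] := net_cauchy (rotC (R := R))
   (K := fun e => Csl_inv (qe e)) (U := fun e => (P e).1.1) (G := fun e => (P e).1.2)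
   (A := fun e => clock (ae e)) (S := fun e => clock (ae e) T) (D := fun e => (P e).2)
   (C := 2) (M := Cnrm (toCL2 u0) + 1) (smin := a0 / 2 * T) (Sbar := Abar * T) (T := T)
   e10 a0T _ _ _ _ _ eta0; last first.
- exists e2; split => //; first exact: le_trans e11.
  move=> e d t e0 ee2 d0 de2 t0 tT.
  have := he2 e d t e0 ee2 d0 de2 t0 tT.
  by rewrite (hP e e0 (le_trans ee2 e21)).2 // (hP d d0 (le_trans de2 e21)).2.
- move=> eta'0; have h2 : 0 < eta' / 2 by rewrite divr_gt0.
  have hTe : 0 < eta' / (2 * (T + 1)) by rewrite divr_gt0 // mulr_gt0 // addr_gt0.
  have [d1 [d10 hd1]] := Lpnorm_small hqe h2.
  have [d2 [d20 hd2]] := Lpnorm_small hae hTe.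
  have [d3 [d30 hd3]] := initial_small h2.
  exists (Num.min e1 (Num.min d1 (Num.min d2 d3))).
  split; first by rewrite !lt_min e10 d10 d20.
  move=> e d e0; rewrite !le_min => /and4P[ee1 ed1 ed2 ed3] d0 /and4P[de1 dd1 dd2 dd3].
  have [qeP cae _ _] := reg e e0 ee1; have [qdP cad _ _] := reg d d0 de1.
  split.
  + rewrite !U0 //; apply: (le_trans (nrm_triangle Cip (toCL2 u0) _ _)).
    have := hd3 e e0 ed3 (le_trans ee1 e11); have := hd3 d d0 dd3 (le_trans de1 e11).
    by rewrite (nrmBC Cip (v e 0)); lra.
  + apply: prod_op_close; first exact: ltW.
    apply: sl_inv_close => //; have [[C1 b1] _] := qeP; have [[C2 b2] _] := qdP.
    apply: (ess_bounded_sub b1 b2 (ltW eta'0) _ (hd1 e e0 ed1) (hd1 d d0 dd1)); lra.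
  + move=> t t0 tT; have T1 : 0 < 2 * (T + 1) by rewrite mulr_gt0 // addr_gt0.
    have k0 : 0 <= eta' / (T + 1) by rewrite divr_ge0 ?ltW // addr_gt0.
    apply: (le_trans (clock_close cae cad k0 _ t0 tT)); last first.
      rewrite mulrAC ler_pdivrMr ?addr_gt0 // ler_wpM2l ?(ltW eta'0) // lerDl //.
    apply: ae_mono2 (hd2 e e0 ed2) (hd2 d d0 dd2) => x h3 h4 Ix.
    apply: (le_trans (ler_distD (a x) _ _)); rewrite (distrC (ae e x)).
    have -> : eta' / (T + 1) = eta' / (2 * (T + 1)) + eta' / (2 * (T + 1)).
      by field; rewrite gt_eqF // addr_gt0.
    by apply: lerD; [exact: h3|exact: h4].
- move=> e t e0 ee1 t0 tT; have [h3 h4] := clk e t e0 ee1 t0 tT.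
  have [_ cae age _] := reg e e0 ee1.
  apply/andP; split; first by apply: le_trans h3; rewrite mulr_ge0 // divr_ge0 // ltW.
  have := clock_ge cae age t0 tT (lexx T).
  have : 0 <= a0 / 2 * (T - t) by rewrite mulr_ge0 ?subr_ge0 // divr_ge0 // ltW.
  by lra.
- by move=> e e0 ee1; have [h3 h4] := clk e T e0 ee1 T0 (lexx T); rewrite h3.
- by move=> e e0 ee1; rewrite U0 //; have [] := reg e e0 ee1.
- move=> e e0 ee1; have [qP _ _ _] := reg e e0 ee1.
  by split; [exact: Csl_inv_op|exact: Csl_inv_J|exact: (hP e e0 ee1).1].
Qed.

(** Completeness is used along [e = 1 / (n + 1)], pointwise in time; the uniform
Cauchy property then gives uniform convergence for all [e]. *)
Lemma ue_limit : exists V : R -> CL2, forall eta, 0 < eta -> exists e2, [/\ 0 < e2, e2 <= 1 &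
  forall e t, 0 < e -> e <= e2 -> 0 <= t -> t <= T -> Cnrm (V t - v e t) <= eta].
Proof.
have ep0 n : 0 < n.+1%:R^-1 :> R by rewrite invr_gt0.
have /choice[V hV] t : exists l, 0 <= t -> t <= T -> cvg_nrm Cip (fun n => v n.+1%:R^-1 t) l.
  have [t0|] := boolP (0 <= t); last by exists 0.
  have [tT|] := boolP (t <= T); last by exists 0.
  have [|l hl] := @Cip_complete R (fun n => v n.+1%:R^-1 t); last by exists l.
  move=> eta eta0; have [e2 [e20 e21 he2]] := ue_cauchy eta0.
  have [N hN] := inv_succ_le e20; exists N => m n Nm Nn.
  by apply: he2 => //; exact: hN.
exists V => eta eta0; have eta2 := divr_gt0 eta0 (ltr0Sn R 1).
have [e2 [e20 e21 he2]] := ue_cauchy eta2; exists e2; split => // e t e0 ee2 t0 tT.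
have [N hN] := inv_succ_le e20; have [M hM] := hV t t0 tT _ eta2.
have h1 := hM _ (leq_maxr N M); have h2 := hN _ (leq_maxl N M).
move: h1 h2; set n := maxn N M => h1 h2.
apply: (le_trans (nrm_triangle Cip (v n.+1%:R^-1 t) _ _)).
have := he2 n.+1%:R^-1 e t (ep0 n) h2 e0 ee2 t0 tT.
by rewrite (nrmBC Cip (V t)); move: h1; lra.
Qed.

Lemma limit_solution (V : R -> CL2) :
  (forall eta, 0 < eta -> exists e2, [/\ 0 < e2, e2 <= 1 &
    forall e t, 0 < e -> e <= e2 -> 0 <= t -> t <= T -> Cnrm (V t - v e t) <= eta]) ->
  solution T q a u0 (fun t => ofCL2 (V t)).
Proof.
move=> hV; have [e1 [Abar [e10 e11 A0 ca reg]]] := uniform_regime.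
apply: (integral_evolution_solution T0 potential_limit ca (v := V)) => //.
  apply: (integral_evolution_limit (rotC (R := R)) T0 ca) => eta eta0.
  have [e2 [e20 e21 he2]] := hV _ eta0.
  have eta4 : 0 < eta / 4 by rewrite divr_gt0.
  have [d1 [d10 hd1]] := Lpnorm_small hqe eta4.
  have [d2 [d20 hd2]] := Lpnorm_small hae eta0.
  pose e := Num.min (Num.min e1 e2) (Num.min d1 d2).
  have e0 : 0 < e by rewrite !lt_min e10 e20 d10.
  have : e <= e by []; rewrite {2}/e !le_min => /andP[/andP[ee1 ee2] /andP[ed1 ed2]].
  have [qP cae _ _] := reg e e0 ee1.
  exists (Csl_inv (qe e)), (ae e), (v e); split => //.
  - exact: (ue_integral_evolution e0 (le_trans ee1 e11) qP cae).
  - exact: op_bound (Csl_inv_op qP).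
  - move=> g.
    have qc : op_close Cip (Csl_inv (qe e)) (Csl_inv q) (eta / 4).
      apply: prod_op_close; first exact: ltW.
      apply: sl_inv_close => //; first exact: potential_limit.
      have [[C1 b1] _] := qP; have [C2 b2] := Linfty_ess_bounded hq.
      apply: (ess_bounded_sub b1 b2 (ltW eta4) _ (hd1 e e0 ed1) (k2 := 0)); first by rewrite addr0.
      by apply: aeW => x _; rewrite subrr normr0.
    apply: (le_trans (op_close_nrm _ (Csl_inv_op qP) (Csl_inv_op potential_limit) (ltW eta4) qc)).
    move: (Cnrm g) => n; lra.
  split; first by move=> t t0 tT; exact: he2.
  by apply: ae_mono (hd2 e e0 ed2) => x /[apply]; rewrite distrC.
apply/ae_eq01E => //; first exact: L2_ofCL2.
apply/eqP; rewrite eq_le nrm_ge0 andbT; apply: le_eps => eta eta0; rewrite add0r.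
have eta2 : 0 < eta / 2 by rewrite divr_gt0.
have [e2 [e20 e21 he2]] := hV _ eta2; have [d [d0 hd]] := initial_small eta2.
pose e := Num.min e2 d; have e0 : 0 < e by rewrite lt_min e20.
have : e <= e by []; rewrite {2}/e le_min => /andP[ee2 ed].
have h1 := he2 e 0 e0 ee2 (lexx _) T0; have h2 := hd e e0 ed (le_trans ee2 e21).
apply: (le_trans (nrm_triangle Cip (V 0) _ _)); rewrite (@toCL2K R (V 0)) add0r.
apply: (le_trans (nrm_triangle Cip (v e 0) _ _)).
by rewrite (nrmBC Cip (v e 0) (toCL2 u0)); lra.
Qed.

Lemma solution_unique u w : solution T q a u0 u -> solution T q a u0 w ->
  forall t, t \in `[0, T] -> ae_eq01 (u t) (w t).
Proof.
move=> su sw t; rewrite in_itv /= => /andP[t0 tT].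
have [_ [Abar [_ _ _ ca _]]] := uniform_regime.
have qP := potential_limit.
have iu := solution_integral_evolution T0 qP ca su.
have iw := solution_integral_evolution T0 qP ca sw.
have [/continuous_L2P[uL _] u00 _] := su; have [/continuous_L2P[wL _] w00 _] := sw.
apply/ae_eq01E; [exact: uL|exact: wL|].
apply: (integral_evolution_unique (rotC (R := R)) T0 ca (Csl_inv_op qP) (Csl_inv_J qP) iu iw) => //.
apply/ae_eq01E; [exact: uL|exact: wL|].
by apply: ae_mono2 u00 w00 => x h1 h2 Dx; rewrite h1 // h2.
Qed.

Lemma very_weak_consistency : exists u : R -> R -> R[i],
  [/\ solution T q a u0 u,
      (forall w, solution T q a u0 w -> forall t, t \in `[0, T] -> ae_eq01 (w t) (u t)) &
      ereal_sup [set L2norm (fun x => u t x - ue e t x) | t in `[0, T]]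
        @[e --> 0^'+] --> 0%E].
Proof.
have [V hV] := ue_limit; have sV := limit_solution hV.
exists (fun t => ofCL2 (V t)); split => //; first by move=> w sw; exact: solution_unique.
apply: cvg_right0_of => [e|eta eta0].
  apply: (@le_trans _ _ (L2norm (fun x => ofCL2 (V 0) x - ue e 0 x))); first exact: Lnorm_ge0.
  by apply: ereal_sup_ubound; exists 0 => //=; rewrite in_itv /= lexx.
have [e2 [e20 e21 he2]] := hV _ eta0; exists e2; split => // e e0 ee2.
apply: ge_ereal_sup => _ [t + <-]; rewrite /= in_itv /= => /andP[t0 tT].
have Lu := L2_ue e0 (le_trans ee2 e21) t0 tT.
rewrite (L2norm_sub (L2_ofCL2 (V t)) Lu) lee_fin.
rewrite (@nrm0_eq _ _ Cip _ (V t - v e t)) ?he2 //.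
by rewrite subrACA subrr subr0 toCL2K.
Qed.

End Data.
End VeryWeak.

Theorem theorem3p9 (R : realType) (T a0 : R) (q a : R -> R) (u0 : R -> R[i])
  (hT : 0 < T)
  (hq : Linfty `]0, 1[ q)
  (hq0 : {ae @lebesgue_measure R, forall x, x \in `]0, 1[ -> 0 <= q x})
  (ha : Linfty `[0, T] a)
  (ha0 : 0 < a0)
  (haa0 : forall t, t \in `[0, T] -> a0 <= a t)
  (hu0 : L2 u0)
  (qe ae : R -> R -> R) (u0e : R -> R -> R[i]) (ue : R -> R -> R -> R[i])
  (hqe : Lpnorm +oo `]0, 1[ (fun x => q x - qe e x) @[e --> 0^'+] --> 0%E)
  (hae : Lpnorm +oo `[0, T] (fun t => a t - ae e t) @[e --> 0^'+] --> 0%E)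
  (hu0e : L2norm (fun x => u0 x - u0e e x) @[e --> 0^'+] --> 0%E)
  (hue : very_weak_solution T qe ae u0e ue) :
  exists u : R -> R -> R[i],
    [/\ solution T q a u0 u,
        (forall v, solution T q a u0 v ->
          forall t, t \in `[0, T] -> ae_eq01 (v t) (u t)) &
        ereal_sup [set L2norm (fun x => u t x - ue e t x) | t in `[0, T]]
          @[e --> 0^'+] --> 0%E].
Proof. exact: very_weak_consistency hT hq hq0 ha ha0 haa0 hu0 hqe hae hu0e hue. Qed.
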